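(* Let $\Gamma$ be a countable (discrete) group with Kazhdan's property (T) and let $A$ be a countable torsion-free abelian group. Assume there is a non-split central extension $$1 \to A \to G \to \Gamma \to 1.$$ Assume further that at least one of the following holds: (a) $\Gamma$ is perfect; (b) $G$ has property (T) and $A = \mathbb{Z}$. If $\Gamma$ is flexibly HS-stable, then $G$ is not hyperlinear.
   Context: For $x \in M_d(\mathbb{C})$, $\tau_d(x) = \frac1d \mathrm{Tr}(x)$ and $\|x\|_{2,\tau_d} = \tau_d(x^*x)^{1/2}$ (normalized Hilbert–Schmidt norm). $U(d) \subset M_d(\mathbb{C})$ is the unitary group. Hyperlinear: a group $G$ is hyperlinear if for every $\epsilon>0$ and every finite subset $F \subset G$ there exist $d \in \mathbb{N}$ and a map $\varphi: F \to U(d)$ such that $\|\varphi(g)\varphi(h) - \varphi(gh)\|_{2,\tau_d} < \epsilon$ for all $g,h \in F$ with $gh \in F$, and $\|\varphi(g) - 1\|_{2,\tau_d} > \sqrt{2} - \epsilon$ for all $g \in F \setminus \{1_G\}$. Asymptotic homomorphism: for a countable group $\Gamma$, a sequence of maps $\varphi_n : \Gamma \to U(d_n)$ ($d_n \in \mathbb{N}$) such that $\lim_n \|\varphi_n(g)\varphi_n(h) - \varphi_n(gh)\|_{2,\tau_{d_n}} = 0$ for all $g,h \in \Gamma$. Flexibly HS-stable: a countable group $\Gamma$ is flexibly HS-stable if for every asymptotic homomorphism $\varphi_n : \Gamma \to U(d_n)$ there exist homomorphisms $\pi_n : \Gamma \to U(D_n)$ with $D_n \ge d_n$ and $\lim_n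 D_n/d_n = 1$ such that $\lim_n \|\varphi_n(g) - P_n \pi_n(g) P_n\|_{2,\tau_{d_n}} = 0$ for all $g \in \Gamma$, where $P_n : \mathbb{C}^{D_n} \to \mathbb{C}^{d_n}$ is the projection onto the first $d_n$ coordinates (so $P_n\pi_n(g)P_n$ is regarded as an operator on $\mathbb{C}^{d_n}$). A central extension $1 \to A \to G \to \Gamma \to 1$ (image of $A$ central in $G$) is split if the quotient map $G \to \Gamma$ admits a section that is a group homomorphism; non-split otherwise. *)

(* Defs.v *)
(* The field of complex numbers is R[i] for R : realType. *)
From HB Require Import structures.
From mathcomp Require Import all_boot all_order all_algebra.
From mathcomp Require Import all_classical all_reals all_analysis complex.
Import Order.TTheory GRing.Theory Num.Theory Num.Def.
Import numFieldNormedType.Exports.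

Set Implicit Arguments.
Unset Strict Implicit.
Unset Printing Implicit Defensive.

Local Open Scope classical_set_scope.
Local Open Scope ring_scope.
Local Open Scope sesquilinear_scope.

Definition is_subgroup (G : groupType) (S : set G) : Prop :=
  [/\ S 1%g,
      forall x y, S x -> S y -> S (x * y)%g &
      forall x, S x -> S (x^-1)%g].

Definition derived_subgroup (G : groupType) : set G :=
  smallest (@is_subgroup G) [set z : G | exists x y, z = [~ x, y]%g].

Definition perfect (G : groupType) : Prop := @derived_subgroup G = [set: G].

Definition torsion_free (A : zmodType) : Prop :=
  forall (a : A) (n : nat), (0 < n)%N -> a *+ n = 0 -> a = 0.

Definition infinite_cyclic (A : zmodType) : Prop :=
  exists f : {additive int -> A}, bijective f.

(* The kernel is written additively, the other two groups multiplicatively. *)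
Record central_extension (A : zmodType) (G Gamma : groupType)
    (i : A -> G) (p : G -> Gamma) : Prop := CentralExtension {
  cext_incl_morph : {morph i : a b / a + b >-> (a * b)%g};
  cext_incl_inj : injective i;
  cext_proj_morph : {morph p : x y / (x * y)%g >-> (x * y)%g};
  cext_proj_surj : forall y, exists x, p x = y;
  cext_exact : [set x | p x = 1%g] = range i;
  cext_central : forall a x, commute (i a) x }.

Definition split_extension (G Gamma : groupType) (p : G -> Gamma) : Prop :=
  exists s : Gamma -> G,
    {morph s : x y / (x * y)%g >-> (x * y)%g} /\ cancel s p.

(* The inner product is linear in its first argument. *)
Record hilbertSpace (R : realType) := HilbertSpace {
  hilbert_sort :> completeNormedModType R[i];
  hdot : {dot hilbert_sort for conjC};
  hdot_norm : forall x : hilbert_sort, `|x| ^+ 2 = hdot x x }.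

(* The group laws make each isometry pi g bijective, hence unitary. *)
Record unitary_rep (R : realType) (G : groupType) (H : hilbertSpace R)
    (pi : G -> {linear H -> H}) : Prop := UnitaryRep {
  urep1 : pi 1%g =1 id;
  urepM : forall g h, pi (g * h)%g =1 pi g \o pi h;
  urep_isometry : forall g x y, hdot H (pi g x) (pi g y) = hdot H x y }.

(* Norms in H take their values in R[i]. *)
Definition almost_invariant (R : realType) (G : groupType) (H : hilbertSpace R)
    (pi : G -> {linear H -> H}) (S : seq G) (eps : R) (x : H) : Prop :=
  x != 0 /\ forall s, s \in S -> `|pi s x - x| < eps%:C%C * `|x|.

Definition invariant_vector (R : realType) (G : groupType) (H : hilbertSpace R)
    (pi : G -> {linear H -> H}) (x : H) : Prop :=
  forall g, pi g x = x.

Definition property_T (R : realType) (G : groupType) : Prop :=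
  exists (S : seq G) (eps : R), 0 < eps /\
    forall (H : hilbertSpace R) (pi : G -> {linear H -> H}),
      unitary_rep pi ->
      (exists x, almost_invariant pi S eps x) ->
      exists x : H, x != 0 /\ invariant_vector pi x.

Definition normalized_trace (R : realType) (d : nat) (x : 'M[R[i]]_d) : R[i] :=
  d%:R^-1 * \tr x.

(* The trace below is a nonnegative real, so taking its real part only changes
   the type. *)
Definition hs_norm (R : realType) (d : nat) (x : 'M[R[i]]_d) : R :=
  Num.sqrt (complex.Re (normalized_trace (x ^t* *m x))).

Definition hyperlinear (R : realType) (G : groupType) : Prop :=
  forall (eps : R) (F : seq G), 0 < eps ->
  exists (d : nat) (phi : G -> 'M[R[i]]_d),
    [/\ (0 < d)%N,
        forall g, g \in F -> phi g \is unitarymx,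
        forall g h, g \in F -> h \in F -> (g * h)%g \in F ->
          hs_norm (phi g *m phi h - phi (g * h)%g) < eps &
        forall g, g \in F -> g != 1%g ->
          Num.sqrt 2 - eps < hs_norm (phi g - 1%:M)].

Definition asymptotic_hom (R : realType) (G : groupType) (d : nat -> nat)
    (phi : forall n, G -> 'M[R[i]]_(d n)) : Prop :=
  [/\ forall n, (0 < d n)%N,
      forall n g, phi n g \is unitarymx &
      forall g h, hs_norm (phi n g *m phi n h - phi n (g * h)%g)
                    @[n --> \oo] --> (0 : R)].

Definition unitary_hom (R : realType) (G : groupType) (D : nat)
    (pi : G -> 'M[R[i]]_D) : Prop :=
  (forall g, pi g \is unitarymx) /\
  (forall g h, pi (g * h)%g = pi g *m pi h).

(* For d <= D, pid_mx d : 'M[R[i]]_(d, D) is the matrix of the projection of C^D onto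
   its first d coordinates, and its transpose that of the inclusion. *)
Definition compression (R : realType) (d D : nat) (x : 'M[R[i]]_D) :
    'M[R[i]]_d :=
  let P : 'M[R[i]]_(d, D) := pid_mx d in P *m x *m P^T.

Definition flexibly_HS_stable (R : realType) (G : groupType) : Prop :=
  forall (d : nat -> nat) (phi : forall n, G -> 'M[R[i]]_(d n)),
    asymptotic_hom phi ->
    exists (D : nat -> nat) (pi : forall n, G -> 'M[R[i]]_(D n)),
      [/\ forall n, unitary_hom (pi n),
          forall n, (d n <= D n)%N,
          ((D n)%:R / (d n)%:R : R) @[n --> \oo] --> (1 : R) &
          forall g, hs_norm (phi n g - compression (d n) (pi n g))
                      @[n --> \oo] --> (0 : R)].

(* Main.v *)
(**
  Suppose that G is hyperlinear.  An almost representation of G can be cut down to a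
  corner, namely a suitable range of spectral projections of the images of finitely many
  central elements, on which these elements act almost as scalars; choosing the corner by
  averaging keeps a given central element a <> 0 away from the identity.  In the limit this
  yields characters chi of A with chi a <> 1 that are almost realised by almost
  representations psi of G.  They are closed under products, because almost
  representations can be tensored, so simultaneous Diophantine approximation, with A torsion
  free, makes chi close to 1 on any prescribed finite subset of A while chi a <> 1.

  On the finite set of values of the extension cocycle that matters, chi is then close to 1,
  so psi composed with a section is an almost representation of Gamma, and stability
  provides an honest representation pi with psi close to P pi P on a given finite set.  The
  function f(g) = lim d^-1 Tr(P pi(p g) P psi(g)^* ), along an ultrafilter, is of
  positive type on G, as is |f|^2; it is close to 1 on the given finite set and
  transforms under A by the conjugate of chi.

  If G has property (T), the GNS representation of f has an invariant vector, which forces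
  chi = 1.  If only Gamma has property (T), then |f|^2, which descends to Gamma, is
  uniformly close to 1, and the cyclic vector can be corrected so that |f| becomes as close
  to 1 as desired; f is then almost multiplicative, hence chi is trivial on
  A intersected with [G, G].  For Gamma perfect and a non-split extension this
  intersection is not trivial: otherwise [G, G] would be the image of a splitting.
*)
From HB Require Import structures.
Require Import Defs.
From mathcomp Require Import all_boot all_order all_algebra.
From mathcomp Require Import all_classical all_reals all_analysis complex mxtens.
From mathcomp Require Import ring lra zify.
Import Order.TTheory GRing.Theory Num.Theory Num.Def.
Import numFieldNormedType.Exports.

Set Implicit Arguments.
Unset Strict Implicit.
Unset Printing Implicit Defensive.

Local Open Scope classical_set_scope.
Local Open Scope ring_scope.
Local Open Scope sesquilinear_scope.

(** * Complex moduli and semi-inner products *)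

(** The value chi a supplied by the recurrence argument may be arbitrarily close to 1, so an
    approximate conclusion about chi is worthless: the finite set and the tolerance asked of f have
    to be fixed before chi is known, and have to force chi a = 1 exactly. The predicate
    [detects_scalars] records this order of quantifiers, and both uses of property (T) are proofs of
    it. Exactness survives because a acts on the cyclic vector by an exact scalar, and the corrected
    vectors, being combinations of translates of the old one, stay eigenvectors of a for the same
    scalar. A second tension lies in the almost representations. Composed with a section, psi is
    multiplicative on Gamma only up to a fixed error, since chi is merely near 1 on the cocycle;
    stability is therefore first put into a finite form with a tolerance. On G, however, the psi run
    through a sequence with errors tending to 0 and one common chi, so the limit f is exactly of
    positive type and exactly equivariant, although it is only near 1 on the finite set. *)

Section ComplexModulus.
Variable R : realType.
Implicit Types (z w : R[i]) (x : R).

Definition cabs z : R := complex.Re `|z|.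

Lemma cabsE z : (cabs z)%:C%C = `|z|.
Proof. by rewrite /cabs normc_def. Qed.

Lemma cabs_ge0 z : 0 <= cabs z.
Proof. by rewrite -ler0c cabsE. Qed.

Lemma cabsM z w : cabs (z * w) = cabs z * cabs w.
Proof. by apply: complexI; rewrite rmorphM /= !cabsE normrM. Qed.

Lemma cabsD z w : cabs (z + w) <= cabs z + cabs w.
Proof. by rewrite -lecR rmorphD /= !cabsE ler_normD. Qed.

Lemma cabsN z : cabs (- z) = cabs z.
Proof. by rewrite /cabs normrN. Qed.

Lemma cabsB z w : cabs (z - w) <= cabs z + cabs w.
Proof. by rewrite -(cabsN w) cabsD. Qed.

Lemma cabs_distC z w : cabs (z - w) = cabs (w - z).
Proof. by rewrite -cabsN opprB. Qed.

Lemma cabs_conj z : cabs z^* = cabs z.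
Proof. by rewrite /cabs norm_conjC. Qed.

Lemma cabs0 : cabs 0 = 0.
Proof. by rewrite /cabs normr0. Qed.

Lemma cabs1 : cabs 1 = 1.
Proof. by rewrite /cabs normr1. Qed.

Lemma cabs_eq0 z : (cabs z == 0) = (z == 0).
Proof. by rewrite -(inj_eq (@complexI R)) cabsE /= normr_eq0. Qed.

Lemma cabsX z n : cabs (z ^+ n) = cabs z ^+ n.
Proof. by apply: complexI; rewrite rmorphXn /= !cabsE normrX. Qed.

Lemma cabs_real x : cabs x%:C%C = `|x|.
Proof. by rewrite /cabs normc_def /= expr0n /= addr0 sqrtr_sqr. Qed.

Lemma cabs2 z : cabs z ^+ 2 = complex.Re z ^+ 2 + complex.Im z ^+ 2.
Proof. by apply: complexI; rewrite rmorphXn /= cabsE -add_Re2_Im2. Qed.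

Lemma mul_conj z : z * z^* = (cabs z ^+ 2)%:C%C.
Proof. by rewrite rmorphXn /= cabsE normCK. Qed.

Lemma Re_le_cabs z : complex.Re z <= cabs z.
Proof.
by rewrite -lecR cabsE (le_trans _ (normc_ge_Re z))// lecR ler_norm.
Qed.

Lemma normRe_le_cabs z : `|complex.Re z| <= cabs z.
Proof. by rewrite -lecR cabsE normc_ge_Re. Qed.

Lemma normIm_le_cabs z : `|complex.Im z| <= cabs z.
Proof.
rewrite -(@ler_pXn2r _ 2) ?nnegrE ?cabs_ge0// real_normK ?num_real// cabs2.
by rewrite lerDr sqr_ge0.
Qed.

Lemma cabs_le_ReIm z : cabs z <= `|complex.Re z| + `|complex.Im z|.
Proof.
rewrite {1}[z]complexE (le_trans (cabsD _ _))// cabsM !cabs_real.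
by rewrite lerD2l /cabs normc_def /= expr0n expr1n /= add0r sqrtr1 mul1r.
Qed.

Lemma RecD z w : complex.Re (z + w) = complex.Re z + complex.Re w.
Proof. by case: z w => [a b] [c d]. Qed.

Lemma RecN z : complex.Re (- z) = - complex.Re z.
Proof. by case: z. Qed.

Lemma RecB z w : complex.Re (z - w) = complex.Re z - complex.Re w.
Proof. by rewrite RecD RecN. Qed.

Lemma ImcB z w : complex.Im (z - w) = complex.Im z - complex.Im w.
Proof. by case: z w => [a b] [c d]. Qed.

Lemma ImcD z w : complex.Im (z + w) = complex.Im z + complex.Im w.
Proof. by case: z w => [a b] [c d]. Qed.

Lemma RecM z w :
  complex.Re (z * w) = complex.Re z * complex.Re w - complex.Im z * complex.Im w.
Proof. by case: z w => [a b] [c d]. Qed.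

Lemma ImcM z w :
  complex.Im (z * w) = complex.Re z * complex.Im w + complex.Im z * complex.Re w.
Proof. by case: z w => [a b] [c d]. Qed.

Lemma Rec_sum I (r : seq I) (P : pred I) (F : I -> R[i]) :
  complex.Re (\sum_(i <- r | P i) F i) = \sum_(i <- r | P i) complex.Re (F i).
Proof. by elim/big_rec2: _ => // i x y _ <-; rewrite RecD. Qed.

Lemma Rec_conj z : complex.Re z^* = complex.Re z.
Proof. by case: z. Qed.

Lemma RecMr x z : complex.Re (x%:C%C * z) = x * complex.Re z.
Proof. by case: z => a b /=; rewrite mul0r subr0. Qed.

Lemma conj_realC x : (x%:C%C)^* = x%:C%C.
Proof. exact: conjc_real. Qed.

Lemma ge0_ReK z : 0 <= z -> (complex.Re z)%:C%C = z.
Proof. by case: z => a b; rewrite lecE /= => /andP[/eqP -> _]. Qed.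

Lemma Re_ge0 z : 0 <= z -> 0 <= complex.Re z.
Proof. by rewrite lecE => /andP[]. Qed.

Lemma phase z : exists w, cabs w = 1 /\ w * z = (cabs z)%:C%C.
Proof.
have [->|z0] := eqVneq z 0; first by exists 1; rewrite cabs1 mul1r cabs0.
have c0 : cabs z != 0 by rewrite cabs_eq0.
exists (z^* / (cabs z)%:C%C); split.
  rewrite cabsM cabs_conj -fmorphV /= cabs_real normfV.
  by rewrite ger0_norm ?cabs_ge0// divff.
by rewrite mulrAC (mulrC z^*) mul_conj -fmorphV -rmorphM /= expr2 mulfK.
Qed.

End ComplexModulus.

Section SemiInnerProduct.
Variables (R : realType) (V : lmodType R[i]) (B : V -> V -> R[i]).

Record semi_inner_product : Prop := SemiInnerProduct {
  sip_linear : forall a x y z, B (a *: x + y) z = a * B x z + B y z;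
  sip_herm : forall x y, B y x = (B x y)^*;
  sip_ge0 : forall x, 0 <= B x x }.

Definition sip_norm (x : V) : R := Num.sqrt (complex.Re (B x x)).

Hypothesis HB : semi_inner_product.

Lemma sip0l z : B 0 z = 0.
Proof.
have := sip_linear HB 1 0 0 z; rewrite scale1r addr0 mul1r => h.
by apply: (addrI (B 0 z)); rewrite addr0 -h.
Qed.

Lemma sipDl x y z : B (x + y) z = B x z + B y z.
Proof. by rewrite -{1}[x]scale1r (sip_linear HB) mul1r. Qed.

Lemma sipZl a x z : B (a *: x) z = a * B x z.
Proof. by rewrite -[_ *: _]addr0 (sip_linear HB) sip0l addr0. Qed.

Lemma sipNl x z : B (- x) z = - B x z.
Proof. by rewrite -scaleN1r sipZl mulN1r. Qed.

Lemma sipBl x y z : B (x - y) z = B x z - B y z.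
Proof. by rewrite sipDl sipNl. Qed.

Lemma sip_suml I (r : seq I) (P : pred I) (F : I -> V) z :
  B (\sum_(i <- r | P i) F i) z = \sum_(i <- r | P i) B (F i) z.
Proof. by apply: (big_morph (B^~ z)) => [x y|]; rewrite ?sipDl ?sip0l. Qed.

Lemma sip0r z : B z 0 = 0.
Proof. by rewrite (sip_herm HB) sip0l rmorph0. Qed.

Lemma sipDr x y z : B x (y + z) = B x y + B x z.
Proof. by rewrite (sip_herm HB) sipDl rmorphD /= -!(sip_herm HB). Qed.

Lemma sipZr a x z : B x (a *: z) = a^* * B x z.
Proof. by rewrite (sip_herm HB) sipZl rmorphM /= -(sip_herm HB). Qed.

Lemma sipNr x z : B x (- z) = - B x z.
Proof. by rewrite (sip_herm HB) sipNl rmorphN /= -(sip_herm HB). Qed.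

Lemma sipBr x y z : B x (y - z) = B x y - B x z.
Proof. by rewrite sipDr sipNr. Qed.

Lemma sip_sumr I (r : seq I) (P : pred I) (F : I -> V) z :
  B z (\sum_(i <- r | P i) F i) = \sum_(i <- r | P i) B z (F i).
Proof. by apply: (big_morph (B z)) => [x y|]; rewrite ?sipDr ?sip0r. Qed.

Lemma sip_norm_ge0 x : 0 <= sip_norm x.
Proof. exact: sqrtr_ge0. Qed.

Lemma sip_norm2 x : sip_norm x ^+ 2 = complex.Re (B x x).
Proof. by rewrite sqr_sqrtr// Re_ge0// (sip_ge0 HB). Qed.

Lemma sip_norm2C x : (sip_norm x ^+ 2)%:C%C = B x x.
Proof. by rewrite sip_norm2 ge0_ReK// (sip_ge0 HB). Qed.

Lemma sip_normD2 x y : sip_norm (x + y) ^+ 2 =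
  sip_norm x ^+ 2 + sip_norm y ^+ 2 + 2 * complex.Re (B x y).
Proof.
rewrite !sip_norm2 sipDl !sipDr !RecD (sip_herm HB x y) Rec_conj; ring.
Qed.

Lemma sip_normB2 x y : sip_norm (x - y) ^+ 2 =
  sip_norm x ^+ 2 + sip_norm y ^+ 2 - 2 * complex.Re (B x y).
Proof.
rewrite !sip_norm2 sipBl !sipBr !RecB (sip_herm HB x y) Rec_conj; ring.
Qed.

Lemma sip_normZ a x : sip_norm (a *: x) = cabs a * sip_norm x.
Proof.
apply/eqP; rewrite -(@eqrXn2 _ 2) ?mulr_ge0 ?cabs_ge0 ?sip_norm_ge0//.
rewrite exprMn !sip_norm2 sipZl sipZr mulrA mul_conj.
by rewrite -[X in _ == _ * X]sip_norm2 -sip_norm2C -rmorphM.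
Qed.

Lemma sip_norm0 : sip_norm 0 = 0.
Proof. by rewrite /sip_norm sip0l sqrtr0. Qed.

Lemma sip_normN x : sip_norm (- x) = sip_norm x.
Proof. by rewrite -scaleN1r sip_normZ cabsN cabs1 mul1r. Qed.

Lemma sip_distC x y : sip_norm (x - y) = sip_norm (y - x).
Proof. by rewrite -sip_normN opprB. Qed.

Lemma Re_sip_le x y : complex.Re (B x y) <= sip_norm x * sip_norm y.
Proof.
set a := sip_norm x; set b := sip_norm y.
have a0 : 0 <= a := sip_norm_ge0 x; have b0 : 0 <= b := sip_norm_ge0 y.
have key (s t : R) : 2 * (s * t * complex.Re (B x y)) <=
    s ^+ 2 * a ^+ 2 + t ^+ 2 * b ^+ 2.
  have := sqr_ge0 (sip_norm (s%:C%C *: x - t%:C%C *: y)).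
  rewrite sip_normB2 !sip_normZ !cabs_real sipZl sipZr conj_realC !exprMn.
  rewrite !real_normK ?num_real// RecMr RecMr -/a -/b; lra.
(* The form is only semidefinite, so a vector of norm 0 may be nonzero. In that case one side of
   [key] loses its quadratic term, and a large multiple of that vector contradicts a positive real
   part. *)
have [a1|a1] := eqVneq a 0.
  rewrite a1 mul0r leNgt; apply/negP => r0.
  have := key ((b ^+ 2 + 1) / complex.Re (B x y)) 1.
  rewrite a1 expr0n /= mulr0 add0r mulr1 divfK ?gt_eqF//.
  by rewrite expr1n mul1r; have := sqr_ge0 b; lra.
have [b1|b1] := eqVneq b 0.
  rewrite b1 mulr0 leNgt; apply/negP => r0.
  have := key 1 ((a ^+ 2 + 1) / complex.Re (B x y)).
  rewrite b1 expr0n /= mulr0 addr0 mul1r divfK ?gt_eqF//.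
  by rewrite expr1n mul1r; have := sqr_ge0 a; lra.
have ab : 0 < a * b by rewrite mulr_gt0// lt0r ?a1 ?b1.
have := key b a.
by move=> h; rewrite -(ler_pM2l ab); lra.
Qed.

Lemma cauchy_schwarz x y : cabs (B x y) <= sip_norm x * sip_norm y.
Proof.
have [w [w1 wE]] := phase (B x y).
have := Re_sip_le (w *: x) y; rewrite sipZl wE /= sip_normZ w1 mul1r; exact.
Qed.

Lemma sip_normD x y : sip_norm (x + y) <= sip_norm x + sip_norm y.
Proof.
rewrite -(@ler_pXn2r _ 2) ?nnegrE ?addr_ge0 ?sip_norm_ge0//.
by rewrite sip_normD2; have := Re_sip_le x y; lra.
Qed.

Lemma sip_normB x y : sip_norm (x - y) <= sip_norm x + sip_norm y.
Proof. by rewrite -(sip_normN y) sip_normD. Qed.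

Lemma sip_dist_triangle z x y :
  sip_norm (x - y) <= sip_norm (x - z) + sip_norm (z - y).
Proof. by rewrite -[x - y](subrKA z) sip_normD. Qed.

Lemma sip_norm_ldist x y : sip_norm x <= sip_norm y + sip_norm (x - y).
Proof. by rewrite -{1}[x](subrK y) addrC sip_normD. Qed.

End SemiInnerProduct.

(** * Limits of complex sequences *)

Section ComplexLimits.
Variable R : realType.

Definition limC (T : Type) (F : set_system T) (z : T -> R[i]) (l : R[i]) : Prop :=
  ((fun n => complex.Re (z n)) @ F --> complex.Re l) /\
  ((fun n => complex.Im (z n)) @ F --> complex.Im l).

Context {T : Type} {F : set_system T} {FF : Filter F}.
Implicit Types (z w : T -> R[i]) (l m : R[i]).

Lemma limC_cabsP z l : limC F z l <->
  forall e : R, 0 < e -> \forall n \near F, cabs (z n - l) < e.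
Proof.
split=> [[/cvgrPdist_lt za /cvgrPdist_lt zb] e e0|zl].
  have e2 : 0 < e / 2 by rewrite divr_gt0.
  near=> n; apply: le_lt_trans (cabs_le_ReIm _) _.
  rewrite RecB ImcB /= (splitr e) ltrD// distrC; near: n.
    exact: za.
  exact: zb.
split; apply/cvgrPdist_lt => e /zl; apply: filterS => n /=; apply: le_lt_trans.
  rewrite distrC -RecB; exact: normRe_le_cabs.
rewrite distrC -ImcB; exact: normIm_le_cabs.
Unshelve. all: by end_near. Qed.

Lemma limC_cst l : limC F (fun=> l) l.
Proof. by split; apply: cvg_cst. Qed.

Lemma limCD z w l m : limC F z l -> limC F w m -> limC F (fun n => z n + w n) (l + m).
Proof.
move=> [z1 z2] [w1 w2]; split.
  rewrite RecD; under eq_fun do rewrite RecD; exact: cvgD.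
rewrite ImcD; under eq_fun do rewrite ImcD; exact: cvgD.
Qed.

Lemma limCM z w l m : limC F z l -> limC F w m -> limC F (fun n => z n * w n) (l * m).
Proof.
move=> [z1 z2] [w1 w2]; split.
  rewrite RecM; under eq_fun do rewrite RecM; apply: cvgB; exact: cvgM.
rewrite ImcM; under eq_fun do rewrite ImcM; apply: cvgD; exact: cvgM.
Qed.

Lemma limCMl (c : R[i]) z l : limC F z l -> limC F (fun n => c * z n) (c * l).
Proof. by move=> zl; apply: limCM => //; exact: limC_cst. Qed.

Lemma limCB z w l m : limC F z l -> limC F w m -> limC F (fun n => z n - w n) (l - m).
Proof.
move=> zl wm; rewrite -mulN1r; under eq_fun do rewrite -mulN1r.
by apply: limCD => //; apply: limCMl.
Qed.

Lemma limC_sum (I : Type) (r : seq I) (z : I -> T -> R[i]) (l : I -> R[i]) :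
  (forall i, limC F (z i) (l i)) ->
  limC F (fun n => \sum_(i <- r) z i n) (\sum_(i <- r) l i).
Proof.
move=> zl; elim: r => [|i r IHr].
  by rewrite big_nil; under eq_fun do rewrite big_nil; exact: limC_cst.
by rewrite big_cons; under eq_fun do rewrite big_cons; exact: limCD.
Qed.

Lemma limC_conj z l : limC F z l -> limC F (fun n => (z n)^*) l^*.
Proof.
move=> /limC_cabsP zl; apply/limC_cabsP => e /zl; apply: filterS => n /=.
by rewrite -rmorphB cabs_conj.
Qed.

Lemma limC_cabs z l : limC F z l -> (fun n => cabs (z n)) @ F --> cabs l.
Proof.
move=> /limC_cabsP zl; apply/cvgrPdist_lt => e /zl; apply: filterS => n /=.
apply: le_lt_trans; rewrite ler_distl; apply/andP; split.
  by rewrite lerBlDl (le_trans _ (cabsD _ _))// subrK.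
by rewrite -{1}[l](subKr (z n)) cabsB.
Qed.

Lemma limC_0 z (x : T -> R) : x @ F --> 0 -> (\forall n \near F, cabs (z n) <= x n) ->
  limC F z 0.
Proof.
move=> /cvgrPdist_lt x0 zx; apply/limC_cabsP => e e0; near=> n.
rewrite subr0; apply: (@le_lt_trans _ _ (x n)); first by near: n.
apply: le_lt_trans (ler_norm _) _.
by rewrite -normrN -sub0r; near: n; exact: x0.
Unshelve. all: by end_near. Qed.

End ComplexLimits.

Section ComplexLimitsProper.
Variable R : realType.
Context {T : Type} {F : set_system T} {FF : ProperFilter F}.
Implicit Types (z w : T -> R[i]) (l m : R[i]).

Lemma limC_unique z l m : limC F z l -> limC F z m -> l = m.
Proof.
case: l m => [a b] [c d] [/= z1 z2] [/= w1 w2].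
by congr Complex; [apply: (cvg_unique (@Rhausdorff R) z1 w1)|apply: (cvg_unique (@Rhausdorff R) z2 w2)].
Qed.

Lemma limC_ge0 z l : limC F z l -> (\forall n \near F, 0 <= z n) -> 0 <= l.
Proof.
move=> zl z0; suff -> : l = (complex.Re l)%:C%C.
  rewrite ler0c; apply: (cvgr_to_ge zl.1).
  by apply: filterS z0 => n; exact: Re_ge0.
apply: (limC_unique zl); split; first exact: zl.1.
apply: (@cvg_trans _ ((fun=> 0 : R) @ F)); last exact: cvg_cst.
apply: near_eq_cvg; apply: filterS z0 => n.
by rewrite lecE => /andP[/eqP -> _].
Qed.

Lemma limC_cabs_le z l (M : R) : limC F z l ->
  (\forall n \near F, cabs (z n) <= M) -> cabs l <= M.
Proof.
by move=> /limC_cabs zl zM; apply: (cvgr_to_le zl zM).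
Qed.

End ComplexLimitsProper.

Section ComplexComplete.
Variable R : realType.

Lemma cauchy_seqR (x : nat -> R) :
  (forall e, 0 < e -> exists N, forall m n, (N <= m)%N -> (N <= n)%N -> `|x m - x n| < e) ->
  cvg (x @ \oo).
Proof.
move=> xc; apply/cauchy_cvgP/cauchyP => e e0.
have [N hN] := xc _ e0; exists (x N); exists N => // n /= Nn.
by rewrite /ball/= hN.
Qed.

Lemma cauchy_seqC (z : nat -> R[i]) :
  (forall e, 0 < e -> exists N, forall m n, (N <= m)%N -> (N <= n)%N -> cabs (z m - z n) < e) ->
  exists l, limC \oo z l.
Proof.
move=> zc.
have c1 : cvg ((fun n => complex.Re (z n)) @ \oo).
  apply: cauchy_seqR => e /zc [N hN]; exists N => m n h1 h2.
  apply: le_lt_trans (hN _ _ h1 h2); rewrite -RecB; exact: normRe_le_cabs.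
have c2 : cvg ((fun n => complex.Im (z n)) @ \oo).
  apply: cauchy_seqR => e /zc [N hN]; exists N => m n h1 h2.
  apply: le_lt_trans (hN _ _ h1 h2); rewrite -ImcB; exact: normIm_le_cabs.
by exists (lim ((fun n => complex.Re (z n)) @ \oo) +i*
  lim ((fun n => complex.Im (z n)) @ \oo))%C.
Qed.

(** The image ultrafilter lives on a compact segment, hence has a cluster point, and an ultrafilter
    converges to each of its cluster points. *)
Lemma ultra_limR (U : set_system nat) (x : nat -> R) (M : R) : UltraFilter U ->
  (forall n, `|x n| <= M) -> exists l : R, x @ U --> l.
Proof.
move=> UU xM; have := @segment_compact R (- M) M (x @ U) _.
case=> [|l [_ xl]].
  apply: (@filterS _ U _ setT) => [n _ /=|]; last exact: filterT.
  by have := xM n; rewrite in_itv /= ler_norml.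
exists l; apply/cvgrPdist_lt => e e0.
have [//|Ue] := in_ultra_setVsetC [set n | `|l - x n| < e] UU.
have [|y [/= h1 h2]] := xl [set y | ~ `|l - y| < e] (ball l e) Ue.
  exact: nbhsx_ballx.
by case: h1.
Unshelve. all: by end_near. Qed.

Lemma ultra_limC (U : set_system nat) (z : nat -> R[i]) (M : R) : UltraFilter U ->
  (forall n, cabs (z n) <= M) -> exists l, limC U z l.
Proof.
move=> UU zM.
have [a za] : exists l : R, (fun n => complex.Re (z n)) @ U --> l.
  by apply: ultra_limR => n; apply: le_trans (zM n); exact: normRe_le_cabs.
have [b zb] : exists l : R, (fun n => complex.Im (z n)) @ U --> l.
  by apply: ultra_limR => n; apply: le_trans (zM n); exact: normIm_le_cabs.
by exists (a +i* b)%C.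
Qed.

End ComplexComplete.

(** * Hilbert space completion *)

(** A Cauchy filter contains, for each n, a ball of radius 1 / n.+1; the centres of these balls form
    a Cauchy sequence, and its limit attracts the filter. Real radii suffice because a positive
    element of [R[i]] is real. *)
Lemma normed_seq_complete (R : realType) (H : normedModType R[i]) :
  (forall x : nat -> H,
    (forall e : R, 0 < e -> exists N, forall m n, (N <= m)%N -> (N <= n)%N ->
      `|x m - x n| < e%:C%C) ->
    exists l, forall e : R, 0 < e -> exists N, forall n, (N <= n)%N ->
      `|l - x n| <= e%:C%C) ->
  forall F : set_system H, ProperFilter F -> cauchy F -> cvg F.
Proof.
move=> Hseq F PF Fc; pose r (n : nat) : R := n.+1%:R^-1.
have r0 n : 0 < r n by rewrite invr_gt0 ltr0n.
have rlt (e : R) : 0 < e -> exists N, forall n, (N <= n)%N -> r n < e.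
  move=> e0; have [N _ hN] := near_infty_natSinv_lt (PosNum e0).
  by exists N => n /hN.
have /choice[x xF] : forall n : nat, exists x : H, F (ball x (r n)%:C%C).
  by move=> n; apply: (cauchyP F).1 => //; rewrite ltcR.
have [e e0|l hl] := Hseq x.
  have [N hN] := rlt (e / 2) (divr_gt0 e0 (ltr0Sn R 1)).
  exists N => m n /hN rm /hN rn.
  have [y [h1 h2]] := filter_ex (filterI (xF m) (xF n)).
  rewrite -!ball_normE /= in h1 h2.
  apply: le_lt_trans (ler_distD y _ _) _; rewrite (distrC y).
  apply: lt_trans (ltrD h1 h2) _; rewrite -rmorphD /= ltcR; lra.
apply/cvg_ex; exists l; apply/cvgrPdist_lt => e e0.
have eR : e = (complex.Re e)%:C%C by rewrite ge0_ReK// ltW.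
set e' := complex.Re e in eR; have e1 : 0 < e' by rewrite -ltcR -eR.
have [N1 h1] := hl (e' / 2) (divr_gt0 e1 (ltr0Sn R 1)).
have [N2 h2] := rlt (e' / 2) (divr_gt0 e1 (ltr0Sn R 1)).
apply: filterS (xF (maxn N1 N2)) => y; rewrite -ball_normE /= => xy.
rewrite eR (splitr e') rmorphD /=.
apply: le_lt_trans (ler_distD (x (maxn N1 N2)) _ _) _.
rewrite ler_ltD ?h1 ?leq_maxl// (lt_trans xy)// ltcR h2//.
exact: leq_maxr.
Qed.

Section Completion.
Variables (R : realType) (V : lmodType R[i]) (B : V -> V -> R[i]).

Definition sip_cauchy (u : nat -> V) : Prop :=
  forall e : R, 0 < e -> exists N, forall m n, (N <= m)%N -> (N <= n)%N ->
    sip_norm B (u m - u n) < e.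

Definition represents (u : nat -> V) (F : V -> R[i]) : Prop :=
  forall v, limC \oo (fun n => B (u n) v) (F v).

(* The class of a Cauchy sequence [u] is encoded by the functional [v |-> lim B (u n) v],
   so that no quotient is needed. *)
Definition completion_functional : {pred (V -> R[i])} :=
  [pred F | `[< exists2 u, sip_cauchy u & represents u F >]].

Hypothesis HB : semi_inner_product B.

Lemma sip_cauchyD (a : R[i]) u w : sip_cauchy u -> sip_cauchy w ->
  sip_cauchy (fun n => a *: u n + w n).
Proof.
move=> uc wc e e0.
have a1 : 0 < cabs a + 1 by rewrite ltr_wpDl ?cabs_ge0.
have [N hN] := uc (e / 2 / (cabs a + 1)) (divr_gt0 (divr_gt0 e0 (ltr0Sn R 1)) a1).
have [M hM] := wc (e / 2) (divr_gt0 e0 (ltr0Sn R 1)).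
exists (maxn N M) => m n; rewrite !geq_max => /andP[m1 m2] /andP[n1 n2].
rewrite opprD addrACA -scalerBr (le_lt_trans (sip_normD HB _ _))//.
rewrite (splitr e) ler_ltD ?hM// (sip_normZ HB).
have := ltW (hN m n m1 n1); rewrite ler_pdivlMr// mulrC; apply: le_trans.
by rewrite ler_wpM2r ?sip_norm_ge0// lerDl.
Qed.

Lemma representsD (a : R[i]) u w F G : represents u F -> represents w G ->
  represents (fun n => a *: u n + w n) (fun v => a * F v + G v).
Proof.
move=> uF wG v; under eq_fun do rewrite (sip_linear HB).
by apply: limCD => //; apply: limCMl.
Qed.

Lemma completion_submod_closed : submod_closed completion_functional.
Proof.
split=> [|a F G /asboolP[u uc uF] /asboolP[w wc wG]]; apply/asboolP.
  exists (fun=> 0) => [e e0|v].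
    by exists 0%N => m n _ _; rewrite subrr (sip_norm0 HB).
  by under eq_fun do rewrite (sip0l HB); exact: limC_cst.
exists (fun n => a *: u n + w n); first exact: sip_cauchyD.
exact: representsD.
Qed.

HB.instance Definition _ := GRing.isSubmodClosed.Build R[i] (V -> R[i])
  completion_functional completion_submod_closed.

(* The unused argument lets the structures below be inferred from the type. *)
Record completion (h : semi_inner_product B) := Completion {
  functional : V -> R[i];
  functionalP : functional \in completion_functional }.

HB.instance Definition _ := [isSub for @functional HB].
HB.instance Definition _ := [Choice of completion HB by <:].
HB.instance Definition _ := [SubChoice_isSubLmodule of completion HB by <:].

Lemma approx_ex (x : completion HB) : exists u, sip_cauchy u /\ represents u (functional x).
Proof. by have /asboolP[u] := functionalP x; exists u. Qed.

Definition cauchy_rep (x : completion HB) : nat -> V := sval (cid (approx_ex x)).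

Lemma approx_cauchy x : sip_cauchy (cauchy_rep x).
Proof. by rewrite /cauchy_rep; case: cid => u []. Qed.

Lemma approx_represents x : represents (cauchy_rep x) (functional x).
Proof. by rewrite /cauchy_rep; case: cid => u []. Qed.

Lemma sip_cauchy_bounded u : sip_cauchy u -> exists M, forall n, sip_norm B (u n) <= M.
Proof.
move=> /(_ 1 ltr01) [N hN].
exists (\sum_(i < N) sip_norm B (u i) + (sip_norm B (u N) + 1)) => n.
have [nN|Nn] := ltnP n N.
  rewrite (bigD1 (Ordinal nN)) //= -addrA lerDl.
  by rewrite !addr_ge0 ?sip_norm_ge0// sumr_ge0// => i _; exact: sip_norm_ge0.
rewrite (le_trans (sip_norm_ldist HB (u n) (u N)))//.
rewrite -[leLHS]add0r lerD ?sumr_ge0//; first by move=> i _; exact: sip_norm_ge0.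
by rewrite lerD2l ltW// hN.
Qed.

Lemma sip_cauchy_cauchy u w : sip_cauchy u -> sip_cauchy w ->
  exists l, limC \oo (fun n => B (u n) (w n)) l.
Proof.
move=> uc wc; apply: cauchy_seqC => e e0.
have [M uM] := sip_cauchy_bounded uc; have [L wL] := sip_cauchy_bounded wc.
have M0 : 0 <= M by apply: le_trans (uM 0%N); exact: sip_norm_ge0.
have L0 : 0 <= L by apply: le_trans (wL 0%N); exact: sip_norm_ge0.
have ML : 0 < M + L + 1 by rewrite ltr_wpDl// addr_ge0.
have e1 : 0 < e / (M + L + 1) by rewrite divr_gt0.
have [N1 h1] := uc _ e1; have [N2 h2] := wc _ e1.
exists (maxn N1 N2) => m n; rewrite !geq_max => /andP[m1 m2] /andP[n1 n2].
have -> : B (u m) (w m) - B (u n) (w n) =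
    B (u m - u n) (w m) + B (u n) (w m - w n).
  by rewrite (sipBl HB) (sipBr HB) addrA subrK.
apply: le_lt_trans (cabsD _ _) _.
have b1 := le_trans (cauchy_schwarz HB (u m - u n) (w m))
  (ler_pM (sip_norm_ge0 _ _) (sip_norm_ge0 _ _) (ltW (h1 _ _ m1 n1)) (wL m)).
have b2 := le_trans (cauchy_schwarz HB (u n) (w m - w n))
  (ler_pM (sip_norm_ge0 _ _) (sip_norm_ge0 _ _) (uM n) (ltW (h2 _ _ m2 n2))).
apply: le_lt_trans (lerD b1 b2) _.
rewrite (mulrC M) -mulrDr mulrAC ltr_pdivrMr// ltr_pM2l//.
by rewrite addrC ltrDl.
Qed.

(** Split [B (u n) (u n)] as [B (u n) (u n - u N) + B (u n) (u N)]: the first term is small because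
    [u] is Cauchy and bounded, the second because the represented functional is 0. Thus the
    functional determines the class of a Cauchy sequence. *)
Lemma represents0_norm u : sip_cauchy u -> represents u (fun=> 0) ->
  (fun n => sip_norm B (u n)) @ \oo --> (0 : R).
Proof.
move=> uc u0; apply/cvgrPdist_lt => e e0.
have [M uM] := sip_cauchy_bounded uc.
have M0 : 0 <= M by apply: le_trans (uM 0%N); exact: sip_norm_ge0.
have M1 : 0 < M + 1 by rewrite ltr_wpDl.
have e2 : 0 < e ^+ 2 / 2 by rewrite divr_gt0 ?exprn_gt0.
have [N hN] := uc _ (divr_gt0 e2 M1).
have /limC_cabsP/(_ _ e2) [N' _ hN'] := u0 (u N).
exists (maxn N N') => // n /=; rewrite geq_max => /andP[n1 n2].
rewrite sub0r normrN ger0_norm ?sip_norm_ge0//.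
rewrite -(@ltr_pXn2r _ 2) ?nnegrE ?sip_norm_ge0// ?(ltW e0)//.
rewrite (sip_norm2 HB) -{2}[u n](subrK (u N)) (sipDr HB) (le_lt_trans (Re_le_cabs _))//.
rewrite (le_lt_trans (cabsD _ _))// (splitr (e ^+ 2)) ler_ltD//; last first.
  by have := hN' n n2; rewrite subr0.
apply: le_trans (cauchy_schwarz HB _ _) _.
apply: le_trans (ler_pM (sip_norm_ge0 _ _) (sip_norm_ge0 _ _) (uM n) (ltW (hN _ _ n1 (leqnn N)))) _.
by rewrite mulrCA ger_pMr// ler_pdivrMr// mul1r lerDl.
Qed.

Definition cdot (x y : completion HB) : R[i] :=
  sval (cid (sip_cauchy_cauchy (approx_cauchy x) (approx_cauchy y))).

(** This frees [cdot] from the chosen representatives: the differences [d] and [d'] represent 0, so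
    their norms tend to 0, and the other factors are bounded. *)
Lemma cdotP x y u w : sip_cauchy u -> represents u (functional x) ->
  sip_cauchy w -> represents w (functional y) ->
  limC \oo (fun n => B (u n) (w n)) (cdot x y).
Proof.
move=> uc ux wc wy.
pose d n := -1 *: cauchy_rep x n + u n; pose d' n := -1 *: cauchy_rep y n + w n.
have dc : sip_cauchy d by apply: sip_cauchyD => //; exact: approx_cauchy.
have dc' : sip_cauchy d' by apply: sip_cauchyD => //; exact: approx_cauchy.
have d0 : (fun n => sip_norm B (d n)) @ \oo --> (0 : R).
  apply: represents0_norm => // v.
  by have := representsD (-1) (@approx_represents x) ux v; rewrite mulN1r addNr.
have d0' : (fun n => sip_norm B (d' n)) @ \oo --> (0 : R).
  apply: represents0_norm => // v.
  by have := representsD (-1) (@approx_represents y) wy v; rewrite mulN1r addNr.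
have [M wM] := sip_cauchy_bounded wc.
have [L xL] := sip_cauchy_bounded (@approx_cauchy x).
have lim0 : limC \oo (fun n => B (d n) (w n) + B (cauchy_rep x n) (d' n)) 0.
  rewrite -[0]addr0; apply: limCD.
    apply: (limC_0 (x := fun n => sip_norm B (d n) * M)).
      rewrite -[X in _ --> X](mul0r M); apply: cvgM => //; exact: cvg_cst.
    apply: nearW => n; rewrite (le_trans (cauchy_schwarz HB _ _))//.
    by rewrite ler_wpM2l// sip_norm_ge0.
  apply: (limC_0 (x := fun n => L * sip_norm B (d' n))).
    rewrite -[X in _ --> X](mulr0 L); apply: cvgM => //; exact: cvg_cst.
  apply: nearW => n; rewrite (le_trans (cauchy_schwarz HB _ _))//.
  by rewrite ler_wpM2r// sip_norm_ge0.
rewrite -[cdot x y]addr0.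
have -> : (fun n => B (u n) (w n)) = (fun n => B (cauchy_rep x n) (cauchy_rep y n) +
    (B (d n) (w n) + B (cauchy_rep x n) (d' n))).
  apply/funext => n; rewrite /d /d' !scaleN1r (sipDl HB) (sipDr HB) (sipNl HB) (sipNr HB).
  by ring.
apply: limCD => //; rewrite /cdot; by case: cid.
Qed.

Lemma cdot_sip : semi_inner_product cdot.
Proof.
split=> [a x y z|x y|x].
- have xyc := sip_cauchyD a (@approx_cauchy x) (@approx_cauchy y).
  have xyr : represents (fun n => a *: cauchy_rep x n + cauchy_rep y n) (functional (a *: x + y)).
    exact: (representsD a (@approx_represents x) (@approx_represents y)).
  have := cdotP xyc xyr (@approx_cauchy z) (@approx_represents z).
  under eq_fun do rewrite (sip_linear HB).
  move=> /limC_unique; apply; apply: limCD; [apply: limCMl|];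
  by apply: cdotP; (try exact: approx_cauchy); exact: approx_represents.
- apply: (@limC_unique _ _ \oo _ (fun n => B (cauchy_rep y n) (cauchy_rep x n))).
    by apply: cdotP; (try exact: approx_cauchy); exact: approx_represents.
  under eq_fun do rewrite (sip_herm HB).
  apply: limC_conj.
  by apply: cdotP; (try exact: approx_cauchy); exact: approx_represents.
- apply: (@limC_ge0 _ _ \oo _ (fun n => B (cauchy_rep x n) (cauchy_rep x n))).
    by apply: cdotP; (try exact: approx_cauchy); exact: approx_represents.
  by apply: nearW => n; exact: (sip_ge0 HB).
Qed.

Lemma embed_subproof (v : V) : B v \in completion_functional.
Proof.
apply/asboolP; exists (fun=> v) => [e e0|w]; last exact: limC_cst.
by exists 0%N => m n _ _; rewrite subrr (sip_norm0 HB).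
Qed.

Definition embed (v : V) : completion HB := @Completion HB _ (embed_subproof v).

Lemma embedP v : sip_cauchy (fun=> v) /\ represents (fun=> v) (functional (embed v)).
Proof.
split=> [e e0|w]; last exact: limC_cst.
by exists 0%N => m n _ _; rewrite subrr (sip_norm0 HB).
Qed.

Lemma cdot_embed x v : cdot x (embed v) = functional x v.
Proof.
apply: (@limC_unique _ _ \oo _ (fun n => B (cauchy_rep x n) v)).
  have [c r] := embedP v.
  by apply: cdotP => //; [exact: approx_cauchy|exact: approx_represents].
exact: approx_represents.
Qed.

Lemma cdot_eq0 x : cdot x x = 0 -> x = 0.
Proof.
move=> x0; apply/val_inj/funext => v /=; rewrite -cdot_embed.
apply/eqP; rewrite -cabs_eq0 -[_ == _]/(_ == 0) eq_le cabs_ge0 andbT.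
apply: le_trans (cauchy_schwarz cdot_sip _ _) _.
by rewrite /sip_norm x0 sqrtr0 mul0r.
Qed.

Lemma embed_linear a v w : embed (a *: v + w) = a *: embed v + embed w.
Proof. by apply/val_inj/funext => z /=; rewrite (sip_linear HB). Qed.

Lemma embedB v w : embed (v - w) = embed v - embed w.
Proof. by rewrite addrC -scaleN1r embed_linear scaleN1r addrC. Qed.

Lemma embed_norm v : sip_norm cdot (embed v) = sip_norm B v.
Proof. by rewrite /sip_norm cdot_embed. Qed.

Lemma norm_approx_embed (x : completion HB) u (e : R) (N : nat) :
  sip_cauchy u -> represents u (functional x) ->
  (forall n, (N <= n)%N -> sip_norm B (u n - u N) <= e) ->
  sip_norm cdot (x - embed (u N)) <= e.
Proof.
move=> uc ux ue.
have e0 : 0 <= e by apply: le_trans (ue N (leqnn _)); exact: sip_norm_ge0.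
rewrite -(@ler_pXn2r _ 2) ?nnegrE ?sip_norm_ge0// (sip_norm2 cdot_sip).
have [c r] := embedP (u N).
have rr := representsD (-1) r ux; have cc := sip_cauchyD (-1) c uc.
have xE : functional (x - embed (u N)) = (fun v => -1 * functional (embed (u N)) v + functional x v).
  by apply/funext => v /=; rewrite mulN1r addrC.
rewrite -xE in rr; have [h _] := cdotP cc rr cc rr.
apply: (cvgr_to_le h); exists N => // n /= /ue.
rewrite -(sip_norm2 HB) scaleN1r [- _ + _]addrC => h1.
by rewrite ler_pXn2r// ?nnegrE ?sip_norm_ge0.
Qed.

Lemma embed_dense (x : completion HB) (e : R) : 0 < e ->
  exists v, sip_norm cdot (x - embed v) < e.
Proof.
move=> e0; have [N hN] := approx_cauchy x (divr_gt0 e0 (ltr0Sn R 1) : 0 < e / 2).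
exists (cauchy_rep x N); apply: (@le_lt_trans _ _ (e / 2)).
  apply: norm_approx_embed; [exact: approx_cauchy|exact: approx_represents|].
  by move=> n Nn; rewrite ltW// hN.
by rewrite gtr_pMr// invf_lt1// ltr1n.
Qed.

Lemma sip_cauchy_cvg u : sip_cauchy u -> exists x : completion HB,
  forall e, 0 < e -> exists N, forall n, (N <= n)%N -> sip_norm cdot (x - embed (u n)) <= e.
Proof.
move=> uc.
have /choice[F uF] : forall v, exists l, limC \oo (fun n => B (u n) v) l.
  move=> v; apply: sip_cauchy_cauchy => // e e0.
  by exists 0%N => m n _ _; rewrite subrr (sip_norm0 HB).
have FP : F \in completion_functional by apply/asboolP; exists u.
exists (@Completion HB _ FP) => e e0; have [N hN] := uc e e0; exists N => n Nn.
by apply: norm_approx_embed => // m nm; rewrite ltW// hN// (leq_trans Nn).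
Qed.

(** Replacing each [x n] by an embedded vector within 1 / n.+1 reduces the claim to Cauchy sequences
    of [V], which converge in the completion by construction. *)
Lemma completion_seq_complete (x : nat -> completion HB) :
  (forall e : R, 0 < e -> exists N, forall m n, (N <= m)%N -> (N <= n)%N ->
    sip_norm cdot (x m - x n) < e) ->
  exists l, forall e : R, 0 < e -> exists N, forall n, (N <= n)%N ->
    sip_norm cdot (l - x n) <= e.
Proof.
move=> xc; pose r (n : nat) : R := n.+1%:R^-1.
have rlt (e : R) : 0 < e -> exists N, forall n, (N <= n)%N -> r n < e.
  move=> e0; have [N _ hN] := near_infty_natSinv_lt (PosNum e0).
  by exists N => n /hN.
have /choice[v xv] : forall n, exists v, sip_norm cdot (x n - embed v) < r n.
  by move=> n; apply: embed_dense; rewrite invr_gt0 ltr0n.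
have vc : sip_cauchy v.
  move=> e e0; have e4 : 0 < e / 4 by rewrite divr_gt0.
  have [N hN] := rlt _ e4; have [M hM] := xc _ e4.
  exists (maxn N M) => m n; rewrite !geq_max => /andP[m1 m2] /andP[n1 n2].
  rewrite -embed_norm embedB.
  have := sip_dist_triangle cdot_sip (x m) (embed (v m)) (embed (v n)).
  have := sip_dist_triangle cdot_sip (x n) (x m) (embed (v n)).
  have := hM _ _ m2 n2; have := xv m; have := xv n; have := hN _ m1; have := hN _ n1.
  rewrite (sip_distC cdot_sip (embed (v m)) (x m)).
  set a := sip_norm _ _; set b := sip_norm _ _; set c := sip_norm _ _.
  set d := sip_norm _ _; set f := sip_norm _ _; lra.
have [l hl] := sip_cauchy_cvg vc; exists l => e e0.
have e2 : 0 < e / 2 by rewrite divr_gt0.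
have [N1 h1] := hl _ e2; have [N2 h2] := rlt _ e2.
exists (maxn N1 N2) => n; rewrite geq_max => /andP[n1 n2].
have := sip_dist_triangle cdot_sip (embed (v n)) l (x n).
have := h1 n n1; have := h2 n n2; have := xv n.
rewrite (sip_distC cdot_sip (x n)).
set a := sip_norm _ _; set b := sip_norm _ _; set c := sip_norm _ _; lra.
Qed.

Definition cnorm (x : completion HB) : R[i] := (sip_norm cdot x)%:C%C.

Lemma cnormD x y : cnorm (x + y) <= cnorm x + cnorm y.
Proof. by rewrite /cnorm -rmorphD lecR (sip_normD cdot_sip). Qed.

Lemma cnormZ (a : R[i]) x : cnorm (a *: x) = `|a| * cnorm x.
Proof. by rewrite /cnorm (sip_normZ cdot_sip) rmorphM /= cabsE. Qed.

Lemma cnorm_eq0 x : cnorm x = 0 -> x = 0.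
Proof.
move=> /complexI x0; apply: cdot_eq0.
by rewrite -(sip_norm2C cdot_sip) x0 expr0n.
Qed.

HB.instance Definition _ := Lmodule_isNormed.Build R[i] (completion HB) cnormD cnormZ cnorm_eq0.

End Completion.

Section CompletionHilbert.
Variables (R : realType) (V : lmodType R[i]) (B : V -> V -> R[i]).
Hypothesis HB : semi_inner_product B.
Local Notation H := (completion HB).
Local Notation cd := (@cdot _ _ _ HB).

Lemma completion_complete (F : set_system H) : ProperFilter F -> cauchy F -> cvg F.
Proof.
apply: normed_seq_complete => x xc.
have [e e0|l hl] := @completion_seq_complete _ _ _ HB x.
  by have [N hN] := xc e e0; exists N => m n h1 h2; rewrite -ltcR; exact: hN.
exists l => e e0; have [N hN] := hl e e0; exists N => n Nn.
by have := hN n Nn; rewrite -lecR.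
Qed.

HB.instance Definition _ := Uniform_isComplete.Build H completion_complete.

Lemma cdot_bilinear : bilinear_for *%R (conjC \; *%R) cd.
Proof.
split=> [z a x y|z a x y]; rewrite ?(sip_linear (cdot_sip HB))//.
by rewrite (sipDr (cdot_sip HB)) (sipZr (cdot_sip HB)).
Qed.

HB.instance Definition _ := bilinear_isBilinear.Build R[i] H H R[i] *%R (conjC \; *%R)
  cd cdot_bilinear.

Lemma cdot_herm x y : cd x y = (-1) ^+ false * conjC (cd y x).
Proof. by rewrite mul1r -(sip_herm (cdot_sip HB)). Qed.

HB.instance Definition _ := isHermitianSesquilinear.Build R[i] H false conjC cd cdot_herm.

Lemma cdot_gt0 (x : H) : x != 0 -> 0 < cd x x.
Proof.
move=> x0; rewrite lt0r (sip_ge0 (cdot_sip HB)) andbT.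
by apply: contraNneq x0 => /cdot_eq0 ->.
Qed.

HB.instance Definition _ := isDotProduct.Build R[i] H cd cdot_gt0.

Lemma cdot_norm (x : H) : `|x| ^+ 2 = cd x x.
Proof. by rewrite -(sip_norm2C (cdot_sip HB)) rmorphXn. Qed.

Definition completion_hilbert : hilbertSpace R := HilbertSpace cdot_norm.

End CompletionHilbert.

Lemma hdot_sip (R : realType) (H : hilbertSpace R) : semi_inner_product (hdot H).
Proof.
split=> [a x y z|x y|x].
- by rewrite linearDl linearZl_LR.
- by rewrite hermC mul1r.
- by rewrite -hdot_norm exprn_ge0.
Qed.

Lemma hdot_eq0 (R : realType) (H : hilbertSpace R) (x : H) : hdot H x x = 0 -> x = 0.
Proof. by rewrite -hdot_norm => /eqP; rewrite expf_eq0 /= normr_eq0 => /eqP. Qed.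

Lemma hnormE (R : realType) (H : hilbertSpace R) (x : H) : `|x| = (sip_norm (hdot H) x)%:C%C.
Proof.
apply/eqP; rewrite -(@eqrXn2 _ 2) ?ler0c ?sip_norm_ge0//.
by rewrite hdot_norm -(sip_norm2C (hdot_sip H)) rmorphXn.
Qed.

(** * Functions of positive type *)

(** The convention is that of coefficients [f g = <pi g x, x>] with the inner product linear on the
    left: the kernel [f (h^-1 * g)] is then [<pi g x, pi h x>]. *)
Definition posdef (R : realType) (G : groupType) (f : G -> R[i]) : Prop :=
  (forall g, f (g^-1)%g = (f g)^*) /\
  (forall (n : nat) (g : 'I_n -> G) (c : 'I_n -> R[i]),
    0 <= \sum_i \sum_j c i * (c j)^* * f ((g j)^-1 * g i)%g).

Section PolyExtension.
Variables (K : fieldType) (W : lmodType K).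
Implicit Types (phi : nat -> W) (P Q : {poly K}).

(** Polynomials serve as the free vector space on an enumerated group, with ['X^n] standing for the
    n-th element; this is the linear extension of a map given on that basis. *)
Definition poly_ext phi P : W := \sum_(i < size P) P`_i *: phi i.

Lemma poly_ext_widen phi P n : (size P <= n)%N ->
  poly_ext phi P = \sum_(i < n) P`_i *: phi i.
Proof.
move=> Pn; rewrite /poly_ext (big_ord_widen _ (fun i => P`_i *: phi i) Pn).
rewrite [RHS](bigID (fun i : 'I_n => i < size P)%N) /= [X in _ + X]big1 ?addr0// => i.
by rewrite -leqNgt => Pi; rewrite nth_default// scale0r.
Qed.

Lemma poly_ext_linear phi a P Q :
  poly_ext phi (a *: P + Q) = a *: poly_ext phi P + poly_ext phi Q.
Proof.
pose n := maxn (size (a *: P + Q)) (maxn (size P) (size Q)).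
rewrite !(@poly_ext_widen _ _ n) ?leq_max ?leqnn ?orbT// scaler_sumr -big_split /=.
by apply: eq_bigr => i _; rewrite coefD coefZ scalerDl scalerA.
Qed.

Lemma poly_extXn phi n : poly_ext phi 'X^n = phi n.
Proof.
rewrite /poly_ext size_polyXn big_ord_recr /= big1 ?add0r ?coefXn ?eqxx ?scale1r//.
by move=> i _; rewrite coefXn ltn_eqF// scale0r.
Qed.

Lemma eq_poly_ext phi psi P : phi =1 psi -> poly_ext phi P = poly_ext psi P.
Proof. by move=> e; apply: eq_bigr => i _; rewrite e. Qed.

End PolyExtension.

Lemma poly_ext_comp (K : fieldType) (W W' : lmodType K) (L : W -> W') (phi : nat -> W) P :
  (forall a x y, L (a *: x + y) = a *: L x + L y) ->
  L (poly_ext phi P) = poly_ext (L \o phi) P.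
Proof.
move=> Ll; have L0 : L 0 = 0.
  have := Ll 1 0 0; rewrite !scale1r addr0 => h.
  by apply: (addrI (L 0)); rewrite addr0 -h.
by rewrite /poly_ext; elim/big_rec2: _ => // i x y _ <-; rewrite Ll.
Qed.

Section GNS.
Variables (R : realType) (G : groupType) (e : nat -> G) (f : G -> R[i]).
Hypothesis e_surj : forall g, exists n, e n = g.
Hypothesis fpd : posdef f.
Local Notation V := {poly R[i]}.

Definition gns_index (g : G) : nat := sval (cid (e_surj g)).

Lemma gns_indexK g : e (gns_index g) = g.
Proof. by rewrite /gns_index; case: cid. Qed.

(** [poly_ext] is linear, so conjugating the coefficients inside and the result outside makes the
    form conjugate-linear in [Q]. *)
Definition gns_form (P Q : V) : R[i] :=
  poly_ext (fun m => (poly_ext (fun n => (f ((e n)^-1 * e m)%g)^* ) Q)^* ) P.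

Lemma gns_form_sip : semi_inner_product gns_form.
Proof.
have E P Q : gns_form P Q = \sum_(i < size P) \sum_(j < size Q)
    P`_i * (Q`_j)^* * f ((e j)^-1 * e i)%g.
  apply: eq_bigr => i _; rewrite rmorph_sum /= scaler_sumr; apply: eq_bigr => j _.
  by rewrite rmorphM /= conjCK; rewrite -[LHS]/(_ * (_ * _)) mulrA.
split=> [a P Q S|P Q|P].
- exact: poly_ext_linear.
- rewrite !E rmorph_sum exchange_big /=; apply: eq_bigr => i _.
  rewrite rmorph_sum; apply: eq_bigr => j _.
  by rewrite !rmorphM /= conjCK -fpd.1 invgM invgK [_^* * _]mulrC.
- by rewrite E; exact: fpd.2.
Qed.
Local Notation HB := gns_form_sip.

(** Since [e] may repeat elements, the shift by 1 sends ['X^n] to the monomial of the chosen index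
    of [e n], not to itself. The group laws are therefore stated inside [gns_form], which does not
    see the difference. *)
Definition gns_shift (g : G) : V -> V := poly_ext (fun n => 'X^(gns_index (g * e n)%g)).

Lemma gns_shift_linear g a P Q :
  gns_shift g (a *: P + Q) = a *: gns_shift g P + gns_shift g Q.
Proof. exact: poly_ext_linear. Qed.

Lemma gns_shiftB g P Q : gns_shift g (P - Q) = gns_shift g P - gns_shift g Q.
Proof. by rewrite addrC -scaleN1r gns_shift_linear scaleN1r addrC. Qed.

Lemma gns_shiftXn g n : gns_shift g 'X^n = 'X^(gns_index (g * e n)%g).
Proof. exact: poly_extXn. Qed.

Lemma poly_ext_shift (phi : nat -> R[i]) g Q :
  poly_ext phi (gns_shift g Q) = poly_ext (fun n => phi (gns_index (g * e n)%g)) Q.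
Proof.
rewrite (poly_ext_comp (L := poly_ext phi)); last by move=> *; exact: poly_ext_linear.
by apply: eq_poly_ext => n /=; rewrite poly_extXn.
Qed.

Lemma gns_form_shiftr P g Q : gns_form P (gns_shift g Q) =
  poly_ext (fun m => (poly_ext (fun n => (f ((g * e n)^-1 * e m)%g)^* ) Q)^* ) P.
Proof.
apply: eq_poly_ext => m; rewrite poly_ext_shift; congr (_^* ).
by apply: eq_poly_ext => n; rewrite gns_indexK.
Qed.

Lemma gns_form_shiftl P g Q : gns_form (gns_shift g P) Q = gns_form P (gns_shift g^-1%g Q).
Proof.
rewrite gns_form_shiftr /gns_form poly_ext_shift; apply: eq_poly_ext => m.
congr (_^* ); apply: eq_poly_ext => n.
by rewrite gns_indexK invgM invgK mulgA.
Qed.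

Lemma gns_form_shiftM P g h Q :
  gns_form P (gns_shift (g * h)%g Q) = gns_form P (gns_shift g (gns_shift h Q)).
Proof.
rewrite !gns_form_shiftr; apply: eq_poly_ext => m; congr (_^* ).
by rewrite poly_ext_shift; apply: eq_poly_ext => n; rewrite gns_indexK mulgA.
Qed.

Lemma gns_form_shift1 P Q : gns_form P (gns_shift 1%g Q) = gns_form P Q.
Proof.
rewrite gns_form_shiftr; apply: eq_poly_ext => m; congr (_^* ).
by apply: eq_poly_ext => n; rewrite mul1g.
Qed.

Lemma gns_form_shift P Q g : gns_form (gns_shift g P) (gns_shift g Q) = gns_form P Q.
Proof. by rewrite gns_form_shiftl -gns_form_shiftM mulVg gns_form_shift1. Qed.

Lemma gns_form_Xn m n : gns_form 'X^m 'X^n = f ((e n)^-1 * e m)%g.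
Proof. by rewrite /gns_form !poly_extXn conjCK. Qed.

Lemma gns_form_Xn_eq m n P : e m = e n -> gns_form 'X^m P = gns_form 'X^n P.
Proof. by move=> emn; rewrite /gns_form !poly_extXn emn. Qed.

Local Notation H := (completion_hilbert gns_form_sip).

Lemma shift_cauchy g u : sip_cauchy gns_form u -> sip_cauchy gns_form (gns_shift g \o u).
Proof.
move=> uc r r0; have [N hN] := uc r r0; exists N => m n h1 h2 /=.
by rewrite -gns_shiftB /sip_norm gns_form_shift; exact: hN.
Qed.

Lemma shift_represents g u F : represents gns_form u F ->
  represents gns_form (gns_shift g \o u) (F \o gns_shift g^-1%g).
Proof. by move=> uF v /=; under eq_fun do rewrite gns_form_shiftl; exact: uF. Qed.

(** By [<g x, v> = <x, g^-1 v>], moving a vector by [g] amounts to precomposing its functional with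
    the shift by [g^-1]. *)
Lemma gns_act_subproof g (x : completion gns_form_sip) :
  functional x \o gns_shift g^-1%g \in completion_functional gns_form.
Proof.
have [u [uc ux]] := approx_ex x; apply/asboolP; exists (gns_shift g \o u).
  exact: shift_cauchy.
exact: shift_represents.
Qed.

Definition gns_act g (x : H) : H := @Completion _ _ _ gns_form_sip _ (gns_act_subproof g x).

Lemma gns_act_linear g : linear (gns_act g).
Proof. by move=> a x y; apply: val_inj. Qed.

HB.instance Definition _ g :=
  GRing.isLinear.Build R[i] H H *:%R (gns_act g) (gns_act_linear g).

Lemma functional_ext (x : completion gns_form_sip) v w :
  (forall P, gns_form P v = gns_form P w) -> functional x v = functional x w.
Proof.
move=> vw; have h := @approx_represents _ _ _ _ x v.
apply: (limC_unique h); under eq_fun do rewrite vw; exact: approx_represents.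
Qed.

Definition gns_rep g : {linear H -> H} := gns_act g.

Lemma gns_rep_unitary : unitary_rep gns_rep.
Proof.
split=> [x|g h x|g x y].
- by apply/val_inj/funext => v /=; apply: functional_ext => P; rewrite invg1 gns_form_shift1.
- apply/val_inj/funext => v /=; apply: functional_ext => P.
  by rewrite invgM gns_form_shiftM.
- rewrite -[LHS]/(cdot _ _) -[RHS]/(cdot _ _).
  have h := cdotP (@approx_cauchy _ _ _ _ x) (@approx_represents _ _ _ _ x)
    (@approx_cauchy _ _ _ _ y) (@approx_represents _ _ _ _ y).
  have c z := shift_cauchy g (@approx_cauchy _ _ _ gns_form_sip z).
  have r (z : H) : represents gns_form (gns_shift g \o cauchy_rep z) (functional (gns_act g z)).
    by move=> v; exact: (shift_represents g (@approx_represents _ _ _ _ z)).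
  have := cdotP (c x) (r x) (c y) (r y).
  under eq_fun do rewrite /= gns_form_shift.
  by move=> h2; exact: limC_unique h2 h.
Qed.

Definition gns_vec : H := embed gns_form_sip 'X^(gns_index 1%g).

Lemma gns_rep_vec g : gns_rep g gns_vec = embed gns_form_sip 'X^(gns_index g).
Proof.
apply/val_inj/funext => v /=.
by rewrite -gns_form_shiftl gns_shiftXn gns_indexK mulg1.
Qed.

Lemma gns_coef g : hdot H (gns_rep g gns_vec) gns_vec = f g.
Proof.
rewrite gns_rep_vec -[LHS]/(cdot _ _) cdot_embed /= gns_form_Xn !gns_indexK.
by rewrite invg1 mul1g.
Qed.

Lemma gns_cyclic (x : H) : (forall g, hdot H x (gns_rep g gns_vec) = 0) -> x = 0.
Proof.
move=> x0; apply: cdot_eq0.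
have xX n : cdot x (embed gns_form_sip 'X^n) = 0.
  rewrite -(x0 (e n)) gns_rep_vec -[RHS]/(cdot _ _) !cdot_embed.
  apply: functional_ext => P; rewrite [LHS](sip_herm HB) [RHS](sip_herm HB).
  by congr (_^* ); apply: gns_form_Xn_eq; rewrite gns_indexK.
have xP P : cdot x (embed gns_form_sip P) = 0.
  rewrite -[P]coefK poly_def (sip_herm (cdot_sip HB)) -[RHS](conjC0); congr (_^* ).
  elim/big_ind: _ => [|Q S hQ hS|i _].
  - have -> : embed gns_form_sip 0 = 0 by apply/val_inj/funext => z /=; rewrite (sip0l HB).
    by rewrite (sip0l (cdot_sip HB)).
  - have -> : embed gns_form_sip (Q + S) = embed gns_form_sip Q + embed gns_form_sip S.
      by apply/val_inj/funext => z /=; rewrite (sipDl HB).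
    by rewrite (sipDl (cdot_sip HB)) hQ hS addr0.
  - have -> : embed gns_form_sip (P`_i *: 'X^i) = P`_i *: embed gns_form_sip 'X^i.
      by apply/val_inj/funext => z /=; rewrite (sipZl HB).
    by rewrite (sipZl (cdot_sip HB)) (sip_herm (cdot_sip HB)) xX conjC0 mulr0.
have -> : x = 0.
  by apply/val_inj/funext => v; have := xP v; rewrite cdot_embed.
by rewrite (sip0l (cdot_sip HB)).
Qed.

End GNS.

Lemma gns (R : realType) (G : groupType) (f : G -> R[i]) :
  countable [set: G] -> posdef f ->
  exists (H : hilbertSpace R) (pi : G -> {linear H -> H}) (xi : H),
    [/\ unitary_rep pi, forall g, hdot H (pi g xi) xi = f g &
        forall x, (forall g, hdot H x (pi g xi) = 0) -> x = 0].
Proof.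
move=> /countable_injP[k kinj] fpd.
pose e n := if pselect (exists g, k g = n) is left h then sval (cid h) else 1%g.
have e_surj g : exists n, e n = g.
  exists (k g); rewrite /e; case: pselect => [h|[]]; last by exists g.
  by case: cid => g' /= kg; apply: kinj => //; rewrite inE.
exists (completion_hilbert (gns_form_sip e fpd)), (gns_rep e_surj fpd), (gns_vec e_surj fpd).
split; [exact: gns_rep_unitary|exact: gns_coef|exact: gns_cyclic].
Qed.

(** * Near-invariant cyclic vectors *)

Section UnitaryRep.
Variables (R : realType) (G : groupType) (H : hilbertSpace R) (pi : G -> {linear H -> H}).
Hypothesis Hpi : unitary_rep pi.
Implicit Types (x y : H) (g h : G).
Local Notation "'[ x , y ]" := (hdot H x y).
Local Notation nrm := (sip_norm (hdot H)).
Local Notation HS := (hdot_sip H).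

Lemma urepMx g h x : pi (g * h)%g x = pi g (pi h x).
Proof. by rewrite (urepM Hpi). Qed.

Lemma urep1x x : pi 1%g x = x.
Proof. by rewrite (urep1 Hpi). Qed.

Lemma urep_adj g x y : '[pi g x, y] = '[x, pi g^-1%g y].
Proof. by rewrite -[y in LHS](urep1x) -(mulgV g) urepMx (urep_isometry Hpi). Qed.

Lemma urep_linear g a x y : pi g (x + a *: y) = pi g x + a *: pi g y.
Proof. by rewrite linearD linearZ. Qed.

Lemma urepZ g a x : pi g (a *: x) = a *: pi g x.
Proof. by rewrite linearZ. Qed.

Lemma urep_norm g x : nrm (pi g x) = nrm x.
Proof. by rewrite /sip_norm (urep_isometry Hpi). Qed.

Lemma urep_dist2 g x : nrm (pi g x - x) ^+ 2 = 2 * (nrm x ^+ 2 - complex.Re '[pi g x, x]).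
Proof. by rewrite (sip_normB2 HS) urep_norm; ring. Qed.

Lemma almost_invariantP (S : seq G) (eps : R) x : 0 < eps -> 0 < nrm x ->
  (forall s, s \in S -> 2 * (nrm x ^+ 2 - complex.Re '[pi s x, x]) < eps ^+ 2 * nrm x ^+ 2) ->
  almost_invariant pi S eps x.
Proof.
move=> e0 x0 xS; split=> [|s /xS].
  by apply: contraTneq x0 => ->; rewrite (sip_norm0 HS) ltxx.
rewrite !hnormE -rmorphM /= ltcR -urep_dist2 -exprMn.
by rewrite ltr_pXn2r// ?nnegrE ?sip_norm_ge0// mulr_ge0 ?sip_norm_ge0// ltW.
Qed.

(* Near-multiplicativity: both error vectors [pi h x - <pi h x, x> x] and
   [pi g^-1 x - <pi g^-1 x, x> x] are orthogonal to [x]. *)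
Lemma coef_mul (rho : R) x g h : nrm x = 1 ->
  (forall g, 1 - rho <= cabs '[pi g x, x]) -> 0 <= rho <= 1 ->
  cabs ('[pi (g * h)%g x, x] - '[pi g x, x] * '[pi h x, x]) <= 2 * rho.
Proof.
move=> x1 xrho /andP[rho0 rho1].
have xx : '[x, x] = 1 by rewrite -(sip_norm2C HS) x1 expr1n.
pose u k := pi k x - '[pi k x, x] *: x.
have ux k : '[u k, x] = 0.
  by rewrite (sipBl HS) (sipZl HS) xx mulr1 subrr.
have un k : nrm (u k) ^+ 2 <= 2 * rho.
  have : '[u k, u k] = 1 - (cabs '[pi k x, x] ^+ 2)%:C%C.
    rewrite {2}/u (sipBr HS) (sipZr HS) ux mulr0 subr0 (sipBl HS) (sipZl HS).
    rewrite (urep_isometry Hpi) xx -mul_conj; congr (_ - _ * _).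
    by rewrite [LHS](sip_herm HS).
  rewrite (sip_norm2 HS) => ->; rewrite RecB /=.
  have := xrho k; set c := cabs _ => hc.
  have c2 : (1 - rho) ^+ 2 <= c ^+ 2 by rewrite ler_pXn2r// ?nnegrE ?cabs_ge0// subr_ge0.
  by have := sqr_ge0 rho; move: c2; rewrite sqrrB expr1n mul1r; lra.
have -> : '[pi (g * h)%g x, x] - '[pi g x, x] * '[pi h x, x] = '[u h, u g^-1%g].
  rewrite {2}/u (sipBr HS) (sipZr HS) ux mulr0 subr0 (sipBl HS) (sipZl HS).
  by rewrite -!urep_adj urepMx mulrC.
apply: le_trans (cauchy_schwarz HS _ _) _.
rewrite -(@ler_pXn2r _ 2) ?nnegrE ?mulr_ge0 ?sip_norm_ge0// exprMn [leRHS]expr2.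
by rewrite ler_pM ?exprn_ge0 ?sip_norm_ge0.
Qed.

Lemma coef_inv x g : '[pi g^-1%g x, x] = '[pi g x, x]^*.
Proof. by rewrite urep_adj invgK (sip_herm HS). Qed.

(** The loss beyond [rho] is quadratic: from |Im z| <= 4 rho one gets (Re z)^2 >= (1 - rho)^2 - 16
    rho^2, and Re z is positive because [z] is close to [p]. The constant 9 contributes 18 rho^2
    against these 16, and [rho <= 100^-1] absorbs the higher powers. *)
Lemma near_pos_Re (rho p : R) (z : R[i]) : 0 <= rho <= 100^-1 -> 2^-1 <= p ->
  1 - rho <= cabs z -> cabs (z - p%:C%C) <= 4 * rho ->
  1 - rho - 9 * rho ^+ 2 <= complex.Re z.
Proof.
move=> /andP[rho0 rho1] p2 zrho zp.
have zr : 2^-1 - 4 * rho <= complex.Re z.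
  have := le_trans (normRe_le_cabs _) zp; rewrite RecB /= ler_norml; lra.
have zi : complex.Im z ^+ 2 <= 16 * rho ^+ 2.
  have := le_trans (normIm_le_cabs _) zp; rewrite ImcB /= subr0.
  rewrite -(@ler_pXn2r _ 2) ?nnegrE ?mulr_ge0 ?ler0n// real_normK ?num_real//; lra.
have z2 : (1 - rho) ^+ 2 <= cabs z ^+ 2 by rewrite ler_pXn2r// ?nnegrE ?cabs_ge0//; lra.
rewrite cabs2 in z2.
rewrite leNgt; apply/negP => zlt.
have r0 : 0 <= complex.Re z by lra.
have : complex.Re z ^+ 2 < (1 - rho - 9 * rho ^+ 2) ^+ 2.
  by rewrite ltr_pXn2r// ?nnegrE//; apply: le_trans r0 (ltW zlt).
have : rho ^+ 2 <= rho / 100 by rewrite expr2 ler_wpM2l// (le_trans rho1).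
have : rho ^+ 2 * rho <= rho ^+ 2 / 100 by rewrite ler_wpM2l ?sqr_ge0.
have : rho ^+ 2 * rho ^+ 2 <= rho ^+ 2 * (rho / 100).
  by rewrite ler_wpM2l ?sqr_ge0// expr2 ler_wpM2l.
have : 0 <= rho ^+ 2 by apply: sqr_ge0.
have -> : (1 - rho - 9 * rho ^+ 2) ^+ 2 =
  (1 - rho) ^+ 2 - 18 * rho ^+ 2 + 18 * (rho ^+ 2 * rho) + 81 * (rho ^+ 2 * rho ^+ 2) by ring.
nra.
Qed.

(* If [pi g0 x] is at nearly maximal distance from the line of [x], the midpoint of [x]
   and (the correctly rotated) [pi g0 x] is moved less by all of [G]. *)
Lemma coef_improve (rho : R) x : 0 < rho <= 100^-1 -> nrm x = 1 ->
  (forall g, 1 - rho <= cabs '[pi g x, x]) ->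
  exists y, [/\ nrm y = 1, forall g, 1 - 3 / 4 * rho <= cabs '[pi g y, y] &
    forall z mu, (forall g, commute z g) -> pi z x = mu *: x -> pi z y = mu *: y].
Proof.
move=> /andP[rho0 rho1] x1 xrho.
have [all_good|] := pselect (forall g, 1 - 3 / 4 * rho <= cabs '[pi g x, x]).
  by exists x.
move=> /existsNP[g0] /negP; rewrite -ltNge => t_lt.
set t := cabs _ in t_lt; have t_ge : 1 - rho <= t := xrho g0.
have [w [w1 wE]] := phase '[pi g0 x, x]; rewrite -/t in wE.
have rho01 : 0 <= rho <= 1 by apply/andP; split; lra.
have rho02 : 0 <= rho <= 100^-1 by rewrite ltW.
have xx : '[x, x] = 1 by rewrite -(sip_norm2C HS) x1 expr1n.
have ww : w * w^* = 1 by rewrite mul_conj w1 expr1n.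
pose y := x + w *: pi g0 x.
have yE k : '[pi k y, y] = '[pi k x, x] + w * '[pi (k * g0)%g x, x] +
    w^* * '[pi (g0^-1 * k)%g x, x] + '[pi (g0^-1 * (k * g0))%g x, x].
  rewrite /y urep_linear (sipDl HS) !(sipDr HS) !(sipZl HS) !(sipZr HS) -!urepMx.
  have adj a : '[pi a x, pi g0 x] = '[pi (g0^-1 * a)%g x, x].
    by rewrite urepMx [RHS]urep_adj invgK.
  by rewrite !adj !mulrA [w * w^*]ww mul1r -!addrA; congr (_ + _); rewrite addrCA.
have yn2 : nrm y ^+ 2 = 2 + 2 * t.
  by rewrite (sip_normD2 HS) (sip_normZ HS) urep_norm w1 x1 (sip_herm HS) (sipZl HS) wE
    Rec_conj /=; ring.
have y0 : 0 < nrm y.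
  rewrite lt0r sip_norm_ge0 andbT; apply/eqP => y0.
  by move: yn2; rewrite y0 expr0n /=; lra.
have ybound k : (1 - 3 / 4 * rho) * nrm y ^+ 2 <= cabs '[pi k y, y].
  have [v [v1 vE]] := phase '[pi k x, x].
  set s := cabs _ in vE; have s_ge : 1 - rho <= s := xrho k.
  have s_le : s <= 1.
    by apply: le_trans (cauchy_schwarz HS _ _) _; rewrite urep_norm x1 mulr1.
  have t_le : t <= 1 by lra.
  have st : 2^-1 <= s * t.
    apply: (@le_trans _ _ ((1 - rho) * (1 - rho))); first by nra.
    by rewrite ler_pM//; lra.
  have stt : 2^-1 <= s * (t * t).
    apply: (@le_trans _ _ ((1 - rho) * ((1 - rho) * (1 - rho)))); first by nra.
    have b0 : 0 <= 1 - rho by case/andP: rho01 => _; rewrite -subr_ge0.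
    by apply: ler_pM => //; [exact: mulr_ge0|exact: ler_pM].
  have unit_abs a z : cabs a = 1 -> cabs (a * z) = cabs z by rewrite cabsM => ->; rewrite mul1r.
  have wc1 : cabs w^* = 1 by rewrite cabs_conj.
  have T2 : 1 - rho - 9 * rho ^+ 2 <= complex.Re (v * (w * '[pi (k * g0)%g x, x])).
    apply: (@near_pos_Re _ (s * t)) => //; first by rewrite !unit_abs.
    have -> : v * (w * '[pi (k * g0)%g x, x]) - (s * t)%:C%C =
        v * (w * ('[pi (k * g0)%g x, x] - '[pi k x, x] * '[pi g0 x, x])).
      by rewrite rmorphM /= -vE -wE; ring.
    by rewrite !unit_abs// (le_trans (coef_mul k g0 x1 xrho rho01))//; lra.
  have T3 : 1 - rho - 9 * rho ^+ 2 <= complex.Re (v * (w^* * '[pi (g0^-1 * k)%g x, x])).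
    apply: (@near_pos_Re _ (s * t)) => //; first by rewrite !unit_abs.
    have wE' : w^* * '[pi g0^-1%g x, x] = t%:C%C by rewrite coef_inv -rmorphM wE /= conj_realC.
    have -> : v * (w^* * '[pi (g0^-1 * k)%g x, x]) - (s * t)%:C%C =
        v * (w^* * ('[pi (g0^-1 * k)%g x, x] - '[pi g0^-1%g x, x] * '[pi k x, x])).
      by rewrite rmorphM /= -vE -wE'; ring.
    by rewrite !unit_abs// (le_trans (coef_mul g0^-1 k x1 xrho rho01))//; lra.
  (* Here multiplicativity is used twice, at a cost of 2 rho each time; this is the worst case and
     the origin of the 4 rho in [near_pos_Re]. *)
  have T4 : 1 - rho - 9 * rho ^+ 2 <= complex.Re (v * '[pi (g0^-1 * (k * g0))%g x, x]).
    apply: (@near_pos_Re _ (s * (t * t))) => //; first by rewrite !unit_abs.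
    have tt : (t * t)%:C%C = '[pi g0^-1%g x, x] * '[pi g0 x, x].
      by rewrite coef_inv [RHS]mulrC mul_conj -expr2.
    have -> : v * '[pi (g0^-1 * (k * g0))%g x, x] - (s * (t * t))%:C%C =
        v * ('[pi (g0^-1 * (k * g0))%g x, x] - '[pi g0^-1%g x, x] * '[pi (k * g0)%g x, x]) +
        v * ('[pi g0^-1%g x, x] * ('[pi (k * g0)%g x, x] - '[pi k x, x] * '[pi g0 x, x])).
      by rewrite rmorphM /= tt -vE; ring.
    apply: le_trans (cabsD _ _) _; rewrite !(cabsM v) v1 !mul1r.
    have e1 := coef_mul g0^-1 (k * g0) x1 xrho rho01.
    have e2 := coef_mul k g0 x1 xrho rho01.
    have e3 : cabs '[pi g0^-1%g x, x] <= 1.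
      by apply: le_trans (cauchy_schwarz HS _ _) _; rewrite urep_norm x1 mulr1.
    rewrite cabsM; have := ler_pM (cabs_ge0 _) (cabs_ge0 _) e3 e2; lra.
  (* After rotation by [v] the four terms of [yE] have real parts adding up to at least 4 - 4 rho -
     27 rho^2. As t < 1 - 3/4 rho, the target is at most 4 - 9/2 rho + 9/8 rho^2, and the gain of
     rho / 2 exceeds the quadratic terms when rho <= 1/100. *)
  apply: (@le_trans _ _ (complex.Re (v * '[pi k y, y]))); last first.
    by apply: le_trans (Re_le_cabs _) _; rewrite unit_abs.
  rewrite yE !mulrDr vE !RecD /=.
  rewrite yn2; have : rho ^+ 2 <= rho / 100 by rewrite expr2 ler_wpM2l// ltW.
  have : (1 - 3 / 4 * rho) * (2 + 2 * t) <= (1 - 3 / 4 * rho) * (2 + 2 * (1 - 3 / 4 * rho)).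
    by rewrite ler_wpM2l// ?lerD2l ?ler_pM2l// ?ltW//; lra.
  have -> : (1 - 3 / 4 * rho) * (2 + 2 * (1 - 3 / 4 * rho)) =
    4 - 9 / 2 * rho + 9 / 8 * rho ^+ 2 by field.
  lra.
exists (((nrm y)^-1)%:C%C *: y); split=> [|g|z mu zc zx].
- by rewrite (sip_normZ HS) cabs_real ger0_norm ?invr_ge0 ?sip_norm_ge0// mulVf ?gt_eqF.
- rewrite urepZ (sipZl HS) (sipZr HS) conj_realC !cabsM cabs_real.
  rewrite ger0_norm ?invr_ge0 ?sip_norm_ge0// mulrA -expr2 exprVn [leRHS]mulrC.
  by rewrite ler_pdivlMr// exprn_gt0.
- rewrite urepZ /y urep_linear -urepMx zc urepMx zx urepZ !scalerDr !scalerA.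
  by congr (_ *: _ + _ *: _); rewrite ?[mu * _]mulrC// -mulrA [w * mu]mulrC.
Qed.

Lemma coef_improve_iter (rho e : R) x : 0 < rho <= 100^-1 -> 0 < e -> nrm x = 1 ->
  (forall g, 1 - rho <= cabs '[pi g x, x]) ->
  exists y, [/\ nrm y = 1, forall g, 1 - e <= cabs '[pi g y, y] &
    forall z mu, (forall g, commute z g) -> pi z x = mu *: x -> pi z y = mu *: y].
Proof.
move=> rhoP e0 x1 xrho.
have iter n : exists y, [/\ nrm y = 1, forall g, 1 - (3 / 4) ^+ n * rho <= cabs '[pi g y, y] &
    forall z mu, (forall g, commute z g) -> pi z x = mu *: x -> pi z y = mu *: y].
  elim: n => [|n [y [y1 yrho yz]]].
    by exists x; split=> // g; rewrite expr0 mul1r.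
  have q0 : 0 < (3 / 4 : R) ^+ n by rewrite exprn_gt0.
  have q1 : (3 / 4 : R) ^+ n <= 1 by rewrite exprn_ile1//; lra.
  have [|z [z1 zrho zz]] := @coef_improve ((3 / 4) ^+ n * rho) y _ y1 yrho.
    case/andP: rhoP => r0 r1; rewrite mulr_gt0//= (le_trans _ r1)//.
    by rewrite ler_piMl// ltW.
  exists z; split=> // [g|a mu ac ax]; first by rewrite exprS -mulrA; exact: zrho.
  by apply: zz => //; apply: yz.
have [n hn] : exists n, (3 / 4) ^+ n * rho <= e.
  have q34 : `|3 / 4 : R| < 1 by rewrite ger0_norm; lra.
  have /cvgrPdist_le /(_ e e0) [n _ hn] := @cvg_expr R (3 / 4) q34.
  exists n; have := hn n (leqnn n); rewrite sub0r normrN /=.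
  rewrite ger0_norm ?exprn_ge0//; case/andP: rhoP => r0 r1; apply: le_trans.
  by rewrite ler_piMr ?exprn_ge0//; lra.
have [y [y1 yrho yz]] := iter n; exists y; split=> // g.
by apply: le_trans (yrho g); rewrite lerD2l lerN2.
Qed.

(** The elements [z] with this property form a subgroup by near-multiplicativity. It contains the
    commutators, since the coefficient at [[~ g, h]] is close to the product of those at g^-1, h^-1,
    g, h, which is the positive number |f g|^2 |f h|^2, itself close to 1. The bound [rho] depends
    on [z] and [eta] but not on the vector. *)
Lemma coef_derived (z : G) : derived_subgroup z -> forall eta : R, 0 < eta ->
  exists2 rho : R, 0 < rho & forall x, nrm x = 1 ->
    (forall g, 1 - rho <= cabs '[pi g x, x]) -> cabs ('[pi z x, x] - 1) <= eta.
Proof.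
pose S : set G := [set z | forall eta : R, 0 < eta ->
  exists2 rho : R, 0 < rho & forall x, nrm x = 1 ->
    (forall g, 1 - rho <= cabs '[pi g x, x]) -> cabs ('[pi z x, x] - 1) <= eta].
suff : derived_subgroup (G := G) `<=` S by move=> /(_ z); apply.
have coef_le1 x g : nrm x = 1 -> cabs '[pi g x, x] <= 1.
  by move=> x1; apply: le_trans (cauchy_schwarz HS _ _) _; rewrite urep_norm x1 mulr1.
apply: smallest_sub.
have xx x : nrm x = 1 -> '[x, x] = 1 by move=> x1; rewrite -(sip_norm2C HS) x1 expr1n.
- split=> [eta eta0|a b aS bS eta eta0|a aS eta /aS [rho rho0 h]].
  + by exists 1 => // x x1 _; rewrite urep1x xx// subrr cabs0 ltW.
  + have e3 : 0 < eta / 3 by rewrite divr_gt0.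
    have [r1 r10 h1] := aS _ e3; have [r2 r20 h2] := bS _ e3.
    pose r := Num.min 1 (Num.min (eta / 6) (Num.min r1 r2)).
    have r0 : 0 < r by rewrite !lt_min ltr01 r10 r20 divr_gt0.
    exists r => // x x1 xr.
    have [l1 l2 l3 l4] : [/\ r <= 1, r <= eta / 6, r <= r1 & r <= r2].
      by split; rewrite /r !ge_min lexx ?orbT.
    have k1 := h1 x x1 (fun g => le_trans (lerB (lexx _) l3) (xr g)).
    have k2 := h2 x x1 (fun g => le_trans (lerB (lexx _) l4) (xr g)).
    have k3 := coef_mul a b x1 xr (introT andP (conj (ltW r0) l1)).
    rewrite -[_ - 1](subrKA ('[pi a x, x] * '[pi b x, x])).
    have -> : '[pi a x, x] * '[pi b x, x] - 1 =
      ('[pi a x, x] - 1) * '[pi b x, x] + ('[pi b x, x] - 1) by ring.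
    apply: le_trans (cabsD _ _) _; have := cabsD (('[pi a x, x] - 1) * '[pi b x, x]) ('[pi b x, x] - 1).
    rewrite cabsM; have := ler_pM (cabs_ge0 _) (cabs_ge0 _) k1 (coef_le1 x b x1); lra.
  + exists rho => // x x1 xr; rewrite coef_inv -conjC1 -rmorphB cabs_conj; exact: h.
- move=> _ [g [h ->]] eta eta0; pose r := Num.min 1 (eta / 10).
  have r0 : 0 < r by rewrite lt_min ltr01 divr_gt0.
  have [l1 l2] : r <= 1 /\ r <= eta / 10 by rewrite /r !ge_min !lexx ?orbT.
  have r01 : 0 <= r <= 1 by rewrite l1 ltW.
  exists r => // x x1 xr.
  set f := fun g => '[pi g x, x].
  have fM a b : cabs (f (a * b)%g - f a * f b) <= 2 * r by exact: coef_mul.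
  have f1 a : cabs (f a) <= 1 by exact: coef_le1.
  have -> : [~ g, h]%g = (g^-1 * (h^-1 * (g * h)))%g by rewrite /commg /conjg.
  have e1 : cabs (f (h^-1 * (g * h))%g - f h^-1%g * (f g * f h)) <= 4 * r.
    rewrite -[X in cabs X](subrKA (f h^-1%g * f (g * h)%g)) -mulrBr.
    apply: le_trans (cabsD _ _) _; rewrite cabsM.
    have := fM h^-1%g (g * h)%g; have := ler_pM (cabs_ge0 _) (cabs_ge0 _) (f1 h^-1%g) (fM g h); lra.
  have e2 : cabs (f (g^-1 * (h^-1 * (g * h)))%g - f g^-1%g * (f h^-1%g * (f g * f h))) <= 6 * r.
    rewrite -[X in cabs X](subrKA (f g^-1%g * f (h^-1 * (g * h))%g)) -mulrBr.
    apply: le_trans (cabsD _ _) _; rewrite cabsM.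
    have := fM g^-1%g (h^-1 * (g * h))%g; have := ler_pM (cabs_ge0 _) (cabs_ge0 _) (f1 g^-1%g) e1; lra.
  have -> : f (g^-1 * (h^-1 * (g * h)))%g - 1 =
    (f (g^-1 * (h^-1 * (g * h)))%g - f g^-1%g * (f h^-1%g * (f g * f h))) +
    (((cabs (f g) * cabs (f h)) ^+ 2)%:C%C - 1).
    rewrite exprMn rmorphM /= -!mul_conj /f !coef_inv; ring.
  apply: le_trans (cabsD _ _) _.
  suff : cabs (((cabs (f g) * cabs (f h)) ^+ 2)%:C%C - 1) <= 4 * r by lra.
  rewrite -[1](rmorph1 (real_complex R)) -rmorphB cabs_real /=.
  have := xr g; have := xr h; have := f1 g; have := f1 h.
  have := cabs_ge0 (f g); have := cabs_ge0 (f h).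
  rewrite -/(f g) -/(f h); set a := cabs (f g); set b := cabs (f h) => b0 a0 b1 a1 br ar.
  have : (1 - r) * (1 - r) <= a * b by rewrite ler_pM//; lra.
  have : 0 <= a * b by rewrite mulr_ge0.
  have : a * b <= 1 by rewrite mulr_ile1.
  set c := a * b => c1 c0 cr.
  have c2r : 1 - 2 * r <= c by nra.
  rewrite ler_norml; apply/andP; split; nra.
Qed.

End UnitaryRep.

(** * Consequences of property (T) *)

Section CyclicRep.
Variables (R : realType) (G : groupType) (H : hilbertSpace R) (pi : G -> {linear H -> H}) (x : H).
Variable f : G -> R[i].
Hypothesis Hpi : unitary_rep pi.
Hypothesis Hf : forall g, hdot H (pi g x) x = f g.
Hypothesis cyc : forall y, (forall g, hdot H y (pi g x) = 0) -> y = 0.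
Local Notation HS := (hdot_sip H).

Lemma cyclic_norm2 : sip_norm (hdot H) x ^+ 2 = complex.Re (f 1%g).
Proof. by rewrite (sip_norm2 HS) -Hf (urep1x Hpi). Qed.

Lemma cyclic_dot g h : hdot H (pi g x) (pi h x) = f (h^-1 * g)%g.
Proof. by rewrite -Hf (urepMx Hpi) [in RHS](urep_adj Hpi) invgK. Qed.

Lemma cyclic_bound g : cabs (f g) <= complex.Re (f 1%g).
Proof.
rewrite -cyclic_norm2 -Hf expr2 -[X in _ <= X * _](urep_norm Hpi g).
exact: (cauchy_schwarz HS).
Qed.

Lemma cyclic_scalar z mu : (forall g, f (g * z)%g = mu * f g) -> pi z x = mu *: x.
Proof.
move=> fz; apply/eqP; rewrite -subr_eq0; apply/eqP/cyc => g.
by rewrite (sipBl HS) (sipZl HS) -{3}[x](urep1x Hpi) !cyclic_dot fz mulg1 subrr.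
Qed.

Lemma cyclic_invariant_dot y : invariant_vector pi y -> y != 0 -> hdot H y x != 0.
Proof.
move=> yi; apply: contraNneq => yx; apply/eqP/cyc => g.
by rewrite -(yi g) (urep_isometry Hpi).
Qed.

Lemma cyclic_invariant_scalar y z mu : invariant_vector pi y -> y != 0 ->
  (forall g, commute z g) -> (forall g, f (g * z)%g = mu * f g) -> mu = 1.
Proof.
move=> yi y0 zc /cyclic_scalar zx.
have : hdot H y x = mu^* * hdot H y x.
  by rewrite -(sipZr HS) -zx -{2}(yi z) (urep_isometry Hpi).
move/eqP; rewrite -subr_eq0 -{1}[hdot H y x]mul1r -mulrBl mulf_eq0.
rewrite (negbTE (cyclic_invariant_dot yi y0)) orbF subr_eq0 => /eqP.
by move/(congr1 conjC); rewrite conjC1 conjCK.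
Qed.

Lemma cyclic_combination n (g : 'I_n -> G) (c : 'I_n -> R[i]) :
  \sum_i \sum_j c i * (c j)^* * f ((g j)^-1 * g i)%g =
  hdot H (\sum_i c i *: pi (g i) x) (\sum_i c i *: pi (g i) x).
Proof.
rewrite (sip_suml HS); apply: eq_bigr => i _; rewrite (sip_sumr HS).
by apply: eq_bigr => j _; rewrite (sipZl HS) (sipZr HS) mulrA cyclic_dot.
Qed.

End CyclicRep.

Lemma sum_conj_sq (R : realType) n (c : 'I_n -> R[i]) :
  \sum_i \sum_j c i * (c j)^* = (cabs (\sum_i c i) ^+ 2)%:C%C.
Proof.
rewrite -mul_conj mulr_suml; apply: eq_bigr => i _.
by rewrite rmorph_sum mulr_sumr.
Qed.

(* For the largest constant [c] with [F - c] still positive definite, the GNS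
   representation of [F - c] has no invariant vector. *)
Lemma kazhdan_uniform (R : realType) (Gamma : groupType) (rho : R) :
  property_T R Gamma -> countable [set: Gamma] -> 0 < rho ->
  exists (S : seq Gamma) (delta : R), 0 < delta /\
    forall F : Gamma -> R[i], posdef F -> F 1%g = 1 ->
      (forall s, s \in S -> 1 - complex.Re (F s) < delta) ->
      forall g, 1 - 2 * rho <= cabs (F g).
Proof.
move=> [S [eps [eps0 TS]]] Gc rho0.
(* The squared displacement of the GNS vector of [F - c] by [s] is 2 (1 - Re (F s)), to be compared
   with eps^2 (1 - c), where 1 - c > rho in the case to be excluded. *)
exists S, (eps ^+ 2 * rho / 2); split; first by rewrite divr_gt0// mulr_gt0// exprn_gt0.
move=> F Fpd F1 FS.
pose A := [set c : R | 0 <= c /\ posdef (fun g => F g - c%:C%C)].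
have A0 : A 0.
  split=> //; split=> [g|n g c]; first by rewrite rmorph0 !subr0 Fpd.1.
  by under eq_bigr do under eq_bigr do rewrite rmorph0 subr0; exact: Fpd.2.
have A1 c : A c -> c <= 1.
  move=> [_ [_ /(_ 1%N (fun=> 1%g) (fun=> 1))]].
  by rewrite !big_ord1 invg1 mulg1 F1 conjC1 !mul1r subr_ge0 -[1](rmorph1 (real_complex R)) lecR.
have Asup : has_sup A by split; [exists 0|exists 1 => c /A1].
set c := sup A.
have c0 : 0 <= c by apply: (sup_upper_bound Asup).
(* The supremum is attained: each inequality in [posdef] is affine in the constant, so it passes to
   the limit. *)
have cpd : posdef (fun g => F g - c%:C%C).
  split=> [g|n g a]; first by rewrite rmorphB /= conj_realC Fpd.1.
  have split_sum (r : R) : \sum_i \sum_j a i * (a j)^* * (F ((g j)^-1 * g i)%g - r%:C%C) =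
     \sum_i \sum_j a i * (a j)^* * F ((g j)^-1 * g i)%g - (r * cabs (\sum_i a i) ^+ 2)%:C%C.
    rewrite rmorphM /= -sum_conj_sq mulr_sumr -sumrB; apply: eq_bigr => i _.
    by rewrite mulr_sumr -sumrB; apply: eq_bigr => j _; ring.
  have Q0 := Fpd.2 n g a.
  rewrite split_sum -(ge0_ReK Q0) -rmorphB ler0c /=.
  set Q := complex.Re _; set q := cabs _ ^+ 2.
  have q0 : 0 <= q by rewrite exprn_ge0 ?cabs_ge0.
  rewrite subr_ge0; apply/ler_addgt0Pr => e e0.
  have q1 : 0 < q + 1 by lra.
  have [b Ab cb] := sup_adherent (divr_gt0 e0 q1) Asup.
  have := Ab.2.2 n g a; rewrite split_sum -(ge0_ReK Q0) -rmorphB ler0c /= -/Q -/q => bQ.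
  have : (c - e / (q + 1)) * q <= b * q by rewrite ler_wpM2r// ltW.
  have : e / (q + 1) * q <= e by rewrite mulrAC ler_pdivrMr// ler_pM2l//; lra.
  lra.
have cle1 : c <= 1 by apply: ge_sup => [|r /A1 //]; exists 0.
have [H [pi [x [Hpi Hx cyc]]]] := gns Gc cpd.
have x2 : sip_norm (hdot H) x ^+ 2 = 1 - c by rewrite (cyclic_norm2 Hpi Hx) F1 RecB.
have c_rho : 1 - c <= rho.
  rewrite leNgt; apply/negP => c_lt.
  have x0 : 0 < sip_norm (hdot H) x.
    rewrite lt0r sip_norm_ge0 andbT; apply/eqP => x0.
    by move: x2; rewrite x0 expr0n /=; lra.
  have [|v [v0 vi]] := TS H pi Hpi.
    exists x; apply: (almost_invariantP Hpi) => // s sS.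
    rewrite Hx x2 RecB /=; have := FS s sS.
    have : eps ^+ 2 * rho < eps ^+ 2 * (1 - c) by rewrite ltr_pM2l// exprn_gt0.
    lra.
  have vx := cyclic_invariant_dot Hpi cyc vi v0.
  have vn : 0 < sip_norm (hdot H) v.
    rewrite lt0r sip_norm_ge0 andbT; apply: contraNneq v0 => vn.
    by apply/eqP/hdot_eq0; rewrite -(sip_norm2C (hdot_sip H)) vn expr0n.
  (* This is the squared length of the projection of [x] on the invariant vector [v]. That
     projection has a constant coefficient function, and by Cauchy-Schwarz subtracting it keeps
     positivity, so [c] was not the largest constant. *)
  pose b := (cabs (hdot H v x) / sip_norm (hdot H) v) ^+ 2.
  have b0 : 0 < b.
    by rewrite exprn_gt0// divr_gt0// lt0r cabs_ge0 cabs_eq0 vx.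
  suff : A (c + b) by move=> /(sup_upper_bound Asup); rewrite -/c; lra.
  split; first by rewrite addr_ge0// ltW.
  split=> [g|n g a]; first by rewrite rmorphB /= conj_realC Fpd.1.
  have -> : \sum_i \sum_j a i * (a j)^* * (F ((g j)^-1 * g i)%g - (c + b)%:C%C) =
     \sum_i \sum_j a i * (a j)^* * (F ((g j)^-1 * g i)%g - c%:C%C) -
       (b * cabs (\sum_i a i) ^+ 2)%:C%C.
    rewrite rmorphM /= -sum_conj_sq mulr_sumr -sumrB; apply: eq_bigr => i _.
    by rewrite mulr_sumr -sumrB; apply: eq_bigr => j _; rewrite rmorphD /=; ring.
  rewrite (cyclic_combination Hpi Hx); set y := \sum_i _.
  rewrite -(sip_norm2C (hdot_sip H)) -rmorphB ler0c subr_ge0 -exprMn.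
  rewrite ler_pXn2r ?nnegrE ?mulr_ge0 ?invr_ge0 ?cabs_ge0 ?sip_norm_ge0//.
  rewrite mulrAC ler_pdivrMr// mulrC -(cabs_conj (hdot H v x)) -cabsM.
  suff <- : hdot H y v = (\sum_i a i) * (hdot H v x)^* by exact: cauchy_schwarz (hdot_sip H) _ _.
  rewrite (sip_suml (hdot_sip H)) mulr_suml; apply: eq_bigr => i _.
  rewrite (sipZl (hdot_sip H)) -{1}(vi (g i)) (urep_isometry Hpi).
  by rewrite [hdot H x v](sip_herm (hdot_sip H)).
(* The positive definite function [F - c] is bounded by its value 1 - c <= rho at 1, hence |F g| >=
   c - rho >= 1 - 2 rho. *)
move=> g; have := cyclic_bound Hpi Hx g; rewrite F1 RecB /= => Fg.
have := cabsD (F g - c%:C%C) (- F g); rewrite addrAC subrr add0r !cabsN.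
by rewrite cabs_real ger0_norm//; lra.
Qed.

(** The pair [S], [delta] precedes [f] and [chi], while the conclusion is an exact equality.
    Positivity of |f|^2 is recorded separately because, |chi| being 1, it is this function that
    descends to the quotient group. *)
Definition detects_scalars (R : realType) (A : zmodType) (G : groupType) (i : A -> G) (a : A) :=
  exists (S : seq G) (delta : R), 0 < delta /\
    forall (f : G -> R[i]) (chi : A -> R[i]),
      posdef f -> posdef (fun g => (cabs (f g) ^+ 2)%:C%C) -> f 1%g = 1 ->
      (forall g b, f (g * i b)%g = chi b * f g) -> (forall b, cabs (chi b) = 1) ->
      (forall s, s \in S -> cabs (f s - 1) < delta) -> chi a = 1.

Lemma detects_scalars_kazhdan (R : realType) (A : zmodType) (G : groupType) (i : A -> G) (a : A) :
  property_T R G -> countable [set: G] -> (forall b x, commute (i b) x) ->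
  detects_scalars R i a.
Proof.
move=> [S [eps [eps0 TS]]] Gc ic.
exists S, (eps ^+ 2 / 2); split; first by rewrite divr_gt0// exprn_gt0.
move=> f chi fpd _ f1 fchi _ fS.
have [H [pi [x [Hpi Hx cyc]]]] := gns Gc fpd.
have x2 : sip_norm (hdot H) x ^+ 2 = 1 by rewrite (cyclic_norm2 Hpi Hx) f1.
have x0 : 0 < sip_norm (hdot H) x.
  rewrite lt0r sip_norm_ge0 andbT; apply/eqP => x0.
  by move/eqP: x2; rewrite x0 expr0n /= eq_sym oner_eq0.
have [|v [v0 vi]] := TS H pi Hpi.
  exists x; apply: (almost_invariantP Hpi) => // s sS.
  have := le_lt_trans (normRe_le_cabs _) (fS s sS).
  by rewrite Hx x2 RecB ltr_norml /=; lra.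
apply: (cyclic_invariant_scalar Hpi Hx cyc vi v0 (ic a)) => g; exact: fchi.
Qed.

Lemma detects_scalars_derived (R : realType) (A : zmodType) (G Gamma : groupType)
    (i : A -> G) (p : G -> Gamma) (a : A) :
  property_T R Gamma -> countable [set: Gamma] -> countable [set: G] ->
  central_extension i p -> derived_subgroup (i a) ->
  detects_scalars R i a.
Proof.
move=> TG Gammac Gc ext ia.
have /choice[s sP] := cext_proj_surj ext.
(* With rho = 1/400 one gets |f|^2 >= 1 - 1/200, so |f| >= 1 - 1/100, which is where
   [coef_improve_iter] can start. The tolerance delta / 2 below accounts for the square in |f|^2. *)
have [S [delta [d0 hS]]] := kazhdan_uniform TG Gammac (divr_gt0 ltr01 (ltr0Sn R 399)).
exists [seq s x | x <- S], (delta / 2); split; first by rewrite divr_gt0.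
move=> f chi fpd f2pd f1 fchi chi1 fS.
pose F (x : Gamma) : R[i] := (cabs (f (s x)) ^+ 2)%:C%C.
have p1 : p 1%g = 1%g.
  by apply: (mulgI (p 1%g)); rewrite -(cext_proj_morph ext) !mulg1.
have pV g : p g^-1%g = (p g)^-1%g.
  by apply: (mulgI (p g)); rewrite -(cext_proj_morph ext) !mulgV p1.
(* Two elements of a fibre differ by some [i b], which changes [f] by a factor of modulus 1; so [F]
   does not depend on the section. *)
have Fp g : F (p g) = (cabs (f g) ^+ 2)%:C%C.
  have : [set x | p x = 1%g] ((s (p g))^-1 * g)%g.
    by rewrite /= (cext_proj_morph ext) pV sP mulVg.
  rewrite (cext_exact ext) => -[b _ hb].
  have -> : g = (s (p g) * i b)%g by rewrite hb mulVKg.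
  rewrite fchi cabsM chi1 mul1r /F; congr ((cabs (f (s _)) ^+ 2)%:C%C).
  rewrite (cext_proj_morph ext) sP.
  have -> : p (i b) = 1%g by have : [set x | p x = 1%g] (i b) by rewrite (cext_exact ext); exists b.
  by rewrite mulg1.
have Fpd : posdef F.
  split=> [x|n x c].
    by rewrite -(sP x) -pV !Fp; exact: f2pd.1.
  have := f2pd.2 n (s \o x) c; congr (_ <= _); apply: eq_bigr => j _; apply: eq_bigr => k _.
  by rewrite -Fp (cext_proj_morph ext) pV !sP.
have F1 : F 1%g = 1 by rewrite -p1 Fp f1 cabs1 expr1n.
have fle1 g : cabs (f g) <= 1.
  have [H [pi [x [Hpi Hx cyc]]]] := gns Gc fpd.
  by have := cyclic_bound Hpi Hx g; rewrite f1.
have Funif := hS F Fpd F1 _.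
have {}Funif g : 1 - 2 * (1 / 400) <= cabs (f g) ^+ 2.
  have := Funif _ (p g); rewrite Fp cabs_real ger0_norm ?exprn_ge0 ?cabs_ge0//; apply.
  move=> x xS; have /fS : s x \in [seq s x | x <- S] by apply: map_f.
  rewrite /F /=; have := cabsD (1 - f (s x)) (f (s x)).
  rewrite subrK cabs1 cabs_distC => h1 h2.
  have : (1 - delta / 2) <= cabs (f (s x)) by lra.
  have := cabs_ge0 (f (s x)); set c := cabs _; nra.
have [H [pi [x [Hpi Hx cyc]]]] := gns Gc fpd.
have x1 : sip_norm (hdot H) x = 1.
  apply/eqP; rewrite -(@eqrXn2 _ 2) ?sip_norm_ge0//.
  by rewrite (cyclic_norm2 Hpi Hx) f1 expr1n.
have xf g : 1 - 100^-1 <= cabs (hdot H (pi g x) x).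
  rewrite Hx -(@ler_pXn2r _ 2) ?nnegrE ?cabs_ge0//; last by lra.
  by apply: le_trans (Funif g); lra.
have zx := cyclic_scalar Hpi Hx cyc (fchi ^~ a).
(* The improved vector [y] still satisfies pi (i a) y = chi a y, so its coefficient at [i a] is
   exactly chi a; [coef_derived] then bounds |chi a - 1| by every positive [eta]. *)
apply/eqP; rewrite -subr_eq0 -cabs_eq0 eq_le cabs_ge0 andbT.
apply/ler_addgt0Pr => eta eta0; rewrite add0r.
have [rho rho0 hrho] := coef_derived Hpi ia eta0.
have r100 : 0 < (100^-1 : R) <= 100^-1 by rewrite lexx andbT invr_gt0.
have [y [y1 yrho yz]] := coef_improve_iter Hpi r100 rho0 x1 xf.
have := hrho y y1 yrho; rewrite (yz _ _ (cext_central ext a) zx).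
by rewrite (sipZl (hdot_sip H)) -(sip_norm2C (hdot_sip H)) y1 expr1n mulr1.
Qed.

(** * The Frobenius norm and unitary rounding *)

Section Adjoint.
Variable R : realType.
Local Notation C := R[i].

Lemma adjmxM m n p (x : 'M[C]_(m, n)) (y : 'M[C]_(n, p)) : (x *m y)^t* = y^t* *m x^t*.
Proof. by rewrite trmx_mul map_mxM. Qed.

Lemma adjmxD m n (x y : 'M[C]_(m, n)) : (x + y)^t* = x^t* + y^t*.
Proof. by rewrite linearD map_mxD. Qed.

Lemma adjmxN m n (x : 'M[C]_(m, n)) : (- x)^t* = - x^t*.
Proof. by rewrite linearN map_mxN. Qed.

Lemma adjmxB m n (x y : 'M[C]_(m, n)) : (x - y)^t* = x^t* - y^t*.
Proof. by rewrite adjmxD adjmxN. Qed.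

Lemma adjmx_scalar n (a : C) : (a%:M : 'M[C]_n)^t* = (a^*)%:M.
Proof. by rewrite tr_scalar_mx map_scalar_mx. Qed.

Lemma adjmx1 n : (1%:M : 'M[C]_n)^t* = 1%:M.
Proof. by rewrite adjmx_scalar conjC1. Qed.

Lemma unitarymxPr n (u : 'M[C]_n) : u \is unitarymx -> u^t* *m u = 1%:M.
Proof. by rewrite -trmxC_unitary => /unitarymxP; rewrite trmxCK. Qed.

Lemma unitarymx1 n : (1%:M : 'M[C]_n) \is unitarymx.
Proof. by apply/unitarymxP; rewrite adjmx1 mulmx1. Qed.

End Adjoint.

Section Frobenius.
Variable R : realType.
Local Notation C := R[i].

Definition fro_dot m n (x y : 'M[C]_(m, n)) : C := \tr (x *m y^t*).

Lemma fro_dotE m n (x y : 'M[C]_(m, n)) : fro_dot x y = \sum_i \sum_j x i j * (y i j)^*.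
Proof.
by apply: eq_bigr => i _; rewrite !mxE; apply: eq_bigr => j _; rewrite !mxE.
Qed.

Lemma fro_sip m n : semi_inner_product (@fro_dot m n).
Proof.
split=> [a x y z|x y|x].
- by rewrite /fro_dot mulmxDl -scalemxAl linearD linearZ.
- rewrite !fro_dotE rmorph_sum; apply: eq_bigr => i _.
  rewrite rmorph_sum; apply: eq_bigr => j _.
  by rewrite rmorphM /= conjCK mulrC.
- rewrite fro_dotE !sumr_ge0// => i _; rewrite sumr_ge0// => j _.
  exact: mul_conjC_ge0.
Qed.

Definition fro m n : 'M[C]_(m, n) -> R := sip_norm (@fro_dot m n).

Lemma fro_ge0 m n (x : 'M[C]_(m, n)) : 0 <= fro x.
Proof. exact: sip_norm_ge0. Qed.

Lemma fro2 m n (x : 'M[C]_(m, n)) : fro x ^+ 2 = complex.Re (\tr (x *m x^t*)).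
Proof. exact: (sip_norm2 (fro_sip m n)). Qed.

Lemma fro2E m n (x : 'M[C]_(m, n)) : fro x ^+ 2 = \sum_i \sum_j cabs (x i j) ^+ 2.
Proof.
rewrite fro2 -/(fro_dot x x) fro_dotE Rec_sum; apply: eq_bigr => i _.
by rewrite Rec_sum; apply: eq_bigr => j _; rewrite mul_conj.
Qed.

Lemma fro2C m n (x : 'M[C]_(m, n)) : (fro x ^+ 2)%:C%C = \tr (x *m x^t*).
Proof. exact: (sip_norm2C (fro_sip m n)). Qed.

Lemma eq_fro m n p q (x : 'M[C]_(m, n)) (y : 'M[C]_(p, q)) :
  fro x ^+ 2 = fro y ^+ 2 -> fro x = fro y.
Proof. by move/eqP; rewrite eqrXn2 ?fro_ge0// => /eqP. Qed.

Lemma froD m n (x y : 'M[C]_(m, n)) : fro (x + y) <= fro x + fro y.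
Proof. exact: (sip_normD (fro_sip m n)). Qed.

Lemma froN m n (x : 'M[C]_(m, n)) : fro (- x) = fro x.
Proof. exact: (sip_normN (fro_sip m n)). Qed.

Lemma froB m n (x y : 'M[C]_(m, n)) : fro (x - y) <= fro x + fro y.
Proof. exact: (sip_normB (fro_sip m n)). Qed.

Lemma fro_distC m n (x y : 'M[C]_(m, n)) : fro (x - y) = fro (y - x).
Proof. exact: (sip_distC (fro_sip m n)). Qed.

Lemma fro_triangle m n (z x y : 'M[C]_(m, n)) : fro (x - y) <= fro (x - z) + fro (z - y).
Proof. exact: (sip_dist_triangle (fro_sip m n)). Qed.

Lemma froZ m n a (x : 'M[C]_(m, n)) : fro (a *: x) = cabs a * fro x.
Proof. exact: (sip_normZ (fro_sip m n)). Qed.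

Lemma fro0 m n : fro (0 : 'M[C]_(m, n)) = 0.
Proof. exact: (sip_norm0 (fro_sip m n)). Qed.

Lemma fro_eq0 m n (x : 'M[C]_(m, n)) : fro x = 0 -> x = 0.
Proof.
move=> x0; have : fro x ^+ 2 = 0 by rewrite x0 expr0n.
rewrite fro2E => /eqP; rewrite psumr_eq0; last first.
  by move=> i _; rewrite sumr_ge0// => j _; rewrite exprn_ge0 ?cabs_ge0.
move=> /allP h; apply/matrixP => i j; rewrite mxE.
have /eqP/eqP := h i (mem_index_enum i); rewrite psumr_eq0; last first.
  by move=> k _; rewrite exprn_ge0 ?cabs_ge0.
move=> /allP /(_ j (mem_index_enum j)) /=.
by rewrite expf_eq0 /= cabs_eq0 => /eqP.
Qed.

Lemma le_fro m n p q (x : 'M[C]_(m, n)) (y : 'M[C]_(p, q)) :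
  fro x ^+ 2 <= fro y ^+ 2 -> fro x <= fro y.
Proof. by rewrite ler_pXn2r// nnegrE fro_ge0. Qed.

Lemma fro_adj m n (x : 'M[C]_(m, n)) : fro (x^t*) = fro x.
Proof. by apply: eq_fro; rewrite !fro2 trmxCK mxtrace_mulC. Qed.

Lemma fro_mulr_coisometry m n p (x : 'M[C]_(m, n)) (u : 'M[C]_(n, p)) :
  u *m u^t* = 1%:M -> fro (x *m u) = fro x.
Proof.
by move=> uu; apply: eq_fro; rewrite !fro2 adjmxM mulmxA -(mulmxA x) uu mulmx1.
Qed.

Lemma fro_mull_isometry m n p (u : 'M[C]_(p, m)) (x : 'M[C]_(m, n)) :
  u^t* *m u = 1%:M -> fro (u *m x) = fro x.
Proof.
by move=> uu; rewrite -fro_adj adjmxM fro_mulr_coisometry ?fro_adj// trmxCK.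
Qed.

Lemma fro_mulr_unitary m n (x : 'M[C]_(m, n)) (u : 'M[C]_n) :
  u \is unitarymx -> fro (x *m u) = fro x.
Proof. by move=> /unitarymxP; exact: fro_mulr_coisometry. Qed.

Lemma fro_mull_unitary m n (u : 'M[C]_m) (x : 'M[C]_(m, n)) :
  u \is unitarymx -> fro (u *m x) = fro x.
Proof. by move=> /unitarymxPr; exact: fro_mull_isometry. Qed.

(** Throughout, a corner is a matrix [J] with [J *m J^t* = 1]: the projection is [J^t* *m J], and
    [x] is cut down to [J *m x *m J^t*]. *)
Lemma corner_compl_idem n r (J : 'M[C]_(r, n)) : J *m J^t* = 1%:M ->
  (1%:M - J^t* *m J) *m (1%:M - J^t* *m J) = 1%:M - J^t* *m J.
Proof.
move=> JJ; rewrite mulmxBr mulmx1 mulmxBl mul1mx !mulmxA -(mulmxA _ J) JJ mulmx1.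
by rewrite subrr subr0.
Qed.

Lemma corner_compl_adj n r (J : 'M[C]_(r, n)) : (1%:M - J^t* *m J)^t* = 1%:M - J^t* *m J.
Proof. by rewrite adjmxB adjmx1 adjmxM trmxCK. Qed.

Lemma fro2_split m n r (x : 'M[C]_(m, n)) (J : 'M[C]_(r, n)) : J *m J^t* = 1%:M ->
  fro x ^+ 2 = fro (x *m J^t*) ^+ 2 + fro (x *m (1%:M - J^t* *m J)) ^+ 2.
Proof.
move=> JJ; rewrite !fro2 -RecD -linearD /= !adjmxM corner_compl_adj trmxCK.
congr (complex.Re (\tr _)).
have -> : x *m J^t* *m (J *m x^t*) = x *m (J^t* *m J) *m x^t* by rewrite !mulmxA.
rewrite [X in _ + X]mulmxA -(mulmxA x _ (1%:M - _)) corner_compl_idem//.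
by rewrite -mulmxDl -mulmxDr addrC subrK mulmx1.
Qed.

Lemma fro_mulr_adj_le m n r (x : 'M[C]_(m, n)) (J : 'M[C]_(r, n)) : J *m J^t* = 1%:M ->
  fro (x *m J^t*) <= fro x.
Proof.
move=> JJ; apply: le_fro; rewrite (fro2_split x JJ) lerDl.
by rewrite exprn_ge0 ?fro_ge0.
Qed.

Lemma fro_mull_le m n r (J : 'M[C]_(r, m)) (x : 'M[C]_(m, n)) : J *m J^t* = 1%:M ->
  fro (J *m x) <= fro x.
Proof. by move=> JJ; rewrite -fro_adj adjmxM -(fro_adj x) fro_mulr_adj_le. Qed.

Lemma mxtrace_gram_mul m n p (y : 'M[C]_(m, n)) (w : 'M[C]_(m, p)) :
  \tr (y *m y^t* *m (w *m w^t*)) = \tr (w^t* *m y *m (w^t* *m y)^t*).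
Proof. by rewrite adjmxM trmxCK mulmxA mxtrace_mulC !mulmxA. Qed.

Lemma fro_scalar n (a : C) : fro (a%:M : 'M[C]_n) = cabs a * Num.sqrt n%:R.
Proof.
rewrite -scalemx1 froZ; congr (_ * _); apply/eqP.
rewrite -(@eqrXn2 _ 2) ?fro_ge0 ?sqrtr_ge0// [X in _ == X]sqr_sqrtr ?ler0n//.
by rewrite fro2 adjmx1 mulmx1 mxtrace1 -(rmorph_nat (real_complex R)).
Qed.

Lemma fro_unitary n (u : 'M[C]_n) : u \is unitarymx -> fro u = Num.sqrt n%:R.
Proof. by move=> uu; rewrite -[u]mulmx1 fro_mull_unitary// fro_scalar cabs1 mul1r. Qed.

Lemma hs_normE d (x : 'M[C]_d) : hs_norm x = fro x / Num.sqrt d%:R.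
Proof.
rewrite /hs_norm /normalized_trace mxtrace_mulC -fro2C.
rewrite -(rmorph_nat (real_complex R)) -fmorphV -rmorphM /=.
rewrite mulrC sqrtrM ?exprn_ge0 ?fro_ge0// sqrtr_sqr ger0_norm ?fro_ge0//.
by rewrite sqrtrV ?ler0n.
Qed.

Lemma hs_norm_le d (x : 'M[C]_d) e : (0 < d)%N ->
  (hs_norm x <= e) = (fro x <= e * Num.sqrt d%:R).
Proof. by move=> d0; rewrite hs_normE ler_pdivrMr// sqrtr_gt0 ltr0n. Qed.

Lemma hs_norm_ge d (x : 'M[C]_d) e : (0 < d)%N ->
  (e <= hs_norm x) = (e * Num.sqrt d%:R <= fro x).
Proof. by move=> d0; rewrite hs_normE ler_pdivlMr// sqrtr_gt0 ltr0n. Qed.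

End Frobenius.

Section Rounding.
Variable R : realType.
Local Notation C := R[i].

(** The characteristic polynomial has finitely many roots, so not all of the distinct numbers - e /
    k.+1 are eigenvalues. *)
Lemma invertible_shift n (w : 'M[C]_n) (e : R) : 0 < e ->
  exists t : R, [/\ 0 < t, t <= e & w + (t%:C%C)%:M \in unitmx].
Proof.
move=> e0; apply: contrapT => hn.
pose t (k : nat) : R := e / k.+1%:R.
have t0 k : 0 < t k by rewrite divr_gt0// ltr0n.
have te k : t k <= e by rewrite ler_pdivrMr ?ltr0n// ler_peMr ?(ltW e0)// ler1n.
have tinj : injective t.
  by move=> j k /(mulfI (lt0r_neq0 e0)) /invr_inj /eqP; rewrite eqr_nat eqSS => /eqP.
have rt k : root (char_poly w) (- (t k)%:C%C).
  rewrite -eigenvalue_root_char; apply: contra_notT hn => nev.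
  exists (t k); split=> //.
  rewrite -row_free_unit -kermx_eq0 -[_%:M]opprK -(raddfN (@scalar_mx C n)) /=.
  by move: nev; rewrite /eigenvalue negbK.
pose rs := [seq - (t k)%:C%C | k <- iota 0 (size (char_poly w))].
have := @max_poly_roots _ (char_poly w) rs (monic_neq0 (char_poly_monic w)).
rewrite size_map size_iota ltnn => h; suff : false by [].
apply: h; first by apply/allP => _ /mapP[k _ ->]; exact: rt.
rewrite map_inj_uniq ?iota_uniq// => j k /oppr_inj /complexI; exact: tinj.
Qed.

Lemma normal_diagonalization n (h : 'M[C]_n) : h \is normalmx ->
  exists (S : 'M[C]_n) (D : 'rV[C]_n), S \is unitarymx /\ h = S^t* *m diag_mx D *m S.
Proof.
move=> /orthomx_spectralP hE; exists (spectralmx h), (spectral_diag h).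
split; first exact: spectral_unitarymx.
by rewrite -(invmx_unitary (spectral_unitarymx h)).
Qed.

(** Here [v] is the unitary factor of the polar decomposition of [w]. In an eigenbasis of
    [w *m w^t*] the two norms compare the numbers sqrt (l i) - 1 and l i - 1, and |sqrt l - 1| <=
    |sqrt l - 1| (sqrt l + 1) = |l - 1|. *)
Lemma round_invertible n (w : 'M[C]_n) : w \in unitmx ->
  exists2 v, v \is unitarymx & fro (w - v) <= fro (w *m w^t* - 1%:M).
Proof.
move=> wu; pose h := w *m w^t*.
have hn : h \is normalmx by apply/normalmxP; rewrite /h adjmxM trmxCK.
have [S [D [Su hE]]] := normal_diagonalization hn.
have Su' : S^t* \is unitarymx by rewrite trmxC_unitary.
have SS := unitarymxP Su; have SS' := unitarymxPr Su.
have DE : diag_mx D = (S *m w) *m (S *m w)^t*.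
  rewrite adjmxM mulmxA -(mulmxA S w) -/h hE.
  by rewrite !mulmxA SS mul1mx -mulmxA SS mulmx1.
have Dii i : D 0 i = (\sum_j cabs ((S *m w) i j) ^+ 2)%:C%C.
  have : diag_mx D i i = D 0 i by rewrite mxE eqxx.
  rewrite DE => <-; rewrite [LHS]mxE rmorph_sum; apply: eq_bigr => j _.
  by rewrite !mxE mul_conj.
pose l i : R := \sum_j cabs ((S *m w) i j) ^+ 2.
have l0 i : 0 < l i.
  rewrite lt0r sumr_ge0 ?andbT => [|j _]; last by rewrite exprn_ge0 ?cabs_ge0.
  apply/eqP => li0.
  have Swu : S *m w \in unitmx by rewrite unitmx_mul wu (unitarymx_unit Su).
  have : row i (S *m w) *m invmx (S *m w) = row i 1%:M by rewrite -row_mul mulmxV.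
  have -> : row i (S *m w) = 0.
    apply/rowP => j; rewrite !mxE; apply/eqP; rewrite -cabs_eq0.
    have /eqP := li0; rewrite psumr_eq0 => [/allP /(_ j (mem_index_enum j))|k _]; last first.
      by rewrite exprn_ge0 ?cabs_ge0.
    by rewrite /= expf_eq0 /= !mxE.
  by rewrite mul0mx => /rowP/(_ i); rewrite !mxE eqxx => /eqP; rewrite eq_sym oner_eq0.
pose q : 'rV[C]_n := \row_i (Num.sqrt (l i))%:C%C.
pose q' : 'rV[C]_n := \row_i ((Num.sqrt (l i))^-1)%:C%C.
have qE i : q 0 i = (Num.sqrt (l i))%:C%C by rewrite mxE.
have q'E i : q' 0 i = ((Num.sqrt (l i))^-1)%:C%C by rewrite mxE.
have q0 i : 0 < Num.sqrt (l i) by rewrite sqrtr_gt0.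
clearbody q q'.
have qq' : diag_mx q *m diag_mx q' = 1%:M.
  rewrite mulmx_diag -diag_const_mx; congr diag_mx; apply/rowP => i.
  by rewrite !mxE qE q'E -rmorphM /= divff ?gt_eqF.
have q'adj : (diag_mx q')^t* = diag_mx q'.
  rewrite tr_diag_mx map_diag_mx; congr diag_mx; apply/rowP => i.
  rewrite mxE q'E; exact: conj_realC.
have q'D : diag_mx q' *m diag_mx D *m diag_mx q' = 1%:M.
  rewrite !mulmx_diag -diag_const_mx; congr diag_mx; apply/rowP => i.
  rewrite !mxE q'E Dii -/(l i) -!rmorphM /= -{2}(sqr_sqrtr (ltW (l0 i))) expr2.
  by rewrite !mulrA mulVf ?gt_eqF// mul1r divff// gt_eqF.
pose v := S^t* *m (diag_mx q' *m (S *m w)).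
have vu : v \is unitarymx.
  apply: (mul_unitarymx Su'); apply/unitarymxP.
  by rewrite adjmxM q'adj mulmxA -(mulmxA _ (S *m w)) -DE q'D.
have SvE : S *m v = diag_mx q' *m (S *m w) by rewrite /v [LHS]mulmxA SS mul1mx.
have wE : w = S^t* *m (diag_mx q *m (S *m v)).
  by rewrite SvE (mulmxA (diag_mx q)) qq' mul1mx mulmxA SS' mul1mx.
clearbody v; have Svu : S *m v \is unitarymx by exact: (mul_unitarymx Su vu).
exists v; first exact: vu.
have -> : w - v = S^t* *m ((diag_mx q - 1%:M) *m (S *m v)).
  by rewrite mulmxBl mulmxBr -wE mul1mx mulmxA SS' mul1mx.
rewrite (fro_mull_unitary _ Su') (fro_mulr_unitary _ Svu).
have -> : fro (w *m w^t* - 1%:M) = fro (diag_mx D - 1%:M).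
  have -> : w *m w^t* - 1%:M = S^t* *m ((diag_mx D - 1%:M) *m S).
    by rewrite mulmxBl mul1mx mulmxBr SS' mulmxA -hE.
  by rewrite (fro_mull_unitary _ Su') (fro_mulr_unitary _ Su).
have diag1E (x : 'rV[C]_n) i j : (diag_mx x - 1%:M) i j = (x 0 i - 1) *+ (i == j).
  by rewrite !mxE; case: eqP => _; rewrite ?subrr.
apply: le_fro; rewrite (fro2E (diag_mx q - _)) (fro2E (diag_mx D - _)).
apply: ler_sum => i _; apply: ler_sum => j _.
rewrite (diag1E q) (diag1E D); have [_|_] := eqVneq i j; last by rewrite lexx.
rewrite !mulr1n qE Dii -/(l i) -[1](rmorph1 (real_complex R)) -!rmorphB !cabs_real.
rewrite ler_pXn2r ?nnegrE//= -{2}(sqr_sqrtr (ltW (l0 i))) subr_sqr_1.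
by rewrite normrM ler_peMr// ger0_norm ?lerDr ?addr_ge0// ?ltW.
Qed.

(** A singular [w] is first shifted by a small scalar; the factor 2 pays for the shift. When the
    defect is 0 there is no room for a shift, but then [w] is already unitary. *)
Lemma round_unitary n (w : 'M[C]_n) :
  exists2 v, v \is unitarymx & fro (w - v) <= 2 * fro (w *m w^t* - 1%:M).
Proof.
set E := fro _; have [E0|E0] := eqVneq E 0.
  exists w; last by rewrite subrr fro0 E0 mulr0.
  by apply/unitarymxP/eqP; rewrite -subr_eq0; apply/eqP/fro_eq0.
have Epos : 0 < E by rewrite lt0r E0 fro_ge0.
(* For a shift t <= 1, [w] itself moves by t sqrt n and the defect grows by at most 2 t |w| + t sqrt
   n; the summand 1 keeps [K] positive. So t K <= E bounds the total cost by E. *)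
pose K := 2 * fro w + Num.sqrt n%:R + Num.sqrt n%:R + 1.
have K0 : 0 < K by rewrite ltr_wpDl// !addr_ge0 ?mulr_ge0 ?fro_ge0 ?sqrtr_ge0.
pose e := Num.min 1 (E / K).
have e0 : 0 < e by rewrite lt_min ltr01 divr_gt0.
have [t [t0 te wt]] := invertible_shift w e0.
have [v vu hv] := round_invertible wt; exists v => //.
have t1 : t <= 1 by rewrite (le_trans te)// ge_min lexx.
have tK : t * K <= E by rewrite -ler_pdivlMr// (le_trans te)// ge_min lexx orbT.
set w' := w + _ in wt hv.
have wmw : w - w' = - (t%:C%C)%:M by rewrite /w' opprD addrA subrr sub0r.
have d1 : fro (w - w') = t * Num.sqrt n%:R.
  by rewrite wmw froN fro_scalar cabs_real gtr0_norm.
have d2 : fro (w' *m w'^t* - 1%:M) <= E + (2 * t * fro w + t * Num.sqrt n%:R).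
  have -> : w' *m w'^t* - 1%:M = (w *m w^t* - 1%:M) + (t%:C%C *: w + t%:C%C *: w^t* + (t ^+ 2)%:C%C%:M).
    rewrite /w' adjmxD adjmx_scalar conj_realC mulmxDl !mulmxDr mul_mx_scalar !mul_scalar_mx.
    rewrite scale_scalar_mx -rmorphM /= -expr2.
    by apply/matrixP => j k; rewrite !mxE; ring.
  apply: le_trans (froD _ _) _; rewrite lerD2l.
  apply: le_trans (froD _ _) _; rewrite lerD//; last first.
    rewrite fro_scalar cabs_real ler_wpM2r ?sqrtr_ge0// ger0_norm ?sqr_ge0//.
    by rewrite expr2 ler_piMr// ltW.
  apply: le_trans (froD _ _) _; rewrite !froZ fro_adj cabs_real gtr0_norm//.
  have -> : 2 * t * fro w = t * fro w + t * fro w by ring.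
  exact: lexx.
apply: le_trans (fro_triangle w' _ _) _; rewrite d1.
have tKE : t * K = 2 * t * fro w + t * Num.sqrt n%:R + t * Num.sqrt n%:R + t.
  by rewrite /K; ring.
have {hv d2} := le_trans hv d2; move: tK; rewrite tKE.
move: (fro w) (Num.sqrt n%:R) (fro (w' - v)) t0 => F s D; clear; lra.
Qed.

(* With [J J^* = 1] the defect of [J u J^*] from unitarity is [y y^*], and
   [tr ((y y^* )^2) <= tr (y y^* )] because [y y^* <= 1]. *)
Lemma round_corner d r (u : 'M[C]_d) (J : 'M[C]_(r, d)) : u \is unitarymx ->
  J *m J^t* = 1%:M ->
  exists2 v, v \is unitarymx &
    fro (J *m u *m J^t* - v) <= 2 * fro (J *m u *m (1%:M - J^t* *m J)).
Proof.
move=> uu JJ; have [v vu hv] := round_unitary (J *m u *m J^t*); exists v => //.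
apply: le_trans hv _; rewrite ler_pM2l//.
set w := J *m u *m J^t*; set y := J *m u *m _.
have uuT := unitarymxP uu.
have P2 := corner_compl_idem JJ.
have wwE : w *m w^t* - 1%:M = - (y *m y^t*).
  rewrite /w /y !adjmxM adjmxB adjmx1 adjmxM trmxCK.
  rewrite !mulmxA -(mulmxA (J *m u) _ (1%:M - _)) P2 mulmxBr mulmx1 !mulmxBl !mulmxA.
  by rewrite -(mulmxA J u (u^t*)) uuT mulmx1 JJ opprB.
rewrite wwE froN; apply: le_fro; rewrite !fro2.
move: wwE; set z := y *m y^t* => wwE.
have zadj : z^t* = z by rewrite /z adjmxM trmxCK.
have zz : \tr (z *m z) = \tr z - \tr ((w^t* *m y) *m (w^t* *m y)^t*).
  have -> : z *m z = z - z *m (w *m w^t*).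
    by rewrite -[w *m _](subrK 1%:M) wwE mulmxDr mulmxN mulmx1 opprD opprK addrC addrNK.
  rewrite linearB /=; congr (_ - _).
  exact: mxtrace_gram_mul.
rewrite zadj zz RecB gerBl.
by have := sqr_ge0 (fro (w^t* *m y)); rewrite fro2.
Qed.
End Rounding.

(** * Spectral cells *)

(** Hermite's identity. Passing from [y] to [y.+1] drops the term y %/ L and adds (y + L) %/ L,
    which is larger by 1. *)
Lemma sum_divn_shift (L y : nat) : (0 < L)%N -> (\sum_(s < L) (y + s) %/ L)%N = y.
Proof.
move=> L0; elim: y => [|y IHy].
  by rewrite big1// => s _; rewrite add0n divn_small.
have step : (\sum_(s < L) (y.+1 + s) %/ L + y %/ L = \sum_(s < L) (y + s) %/ L + (y + L) %/ L)%N.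
  rewrite -(big_mkord xpredT (fun s => (y.+1 + s) %/ L)%N).
  rewrite -(big_mkord xpredT (fun s => (y + s) %/ L)%N).
  transitivity (\sum_(0 <= s < L.+1) (y + s) %/ L)%N; last by rewrite big_nat_recr.
  rewrite big_nat_recl// addn0 addnC; congr (_ + _)%N.
  by apply: eq_bigr => s _; rewrite addSnnS.
have := step; rewrite IHy divnDr ?dvdnn// divnn L0; lia.
Qed.

(** For y <= z the indicator of distinct quotients is at most their difference, and Hermite's
    identity adds these differences up to z - y. *)
Lemma count_divn_shift (L y z : nat) : (0 < L)%N ->
  (\sum_(s < L) ((y + s) %/ L != (z + s) %/ L) <= (y - z) + (z - y))%N.
Proof.
move=> L0; wlog yz : y z / (y <= z)%N.
  move=> h; have [/h //|/ltnW zy] := leqP y z.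
  under eq_bigr do rewrite eq_sym.
  by rewrite addnC; exact: h.
rewrite (eqP (yz : (y - z == 0)%N)) add0n -{2}(sum_divn_shift z L0) -{2}(sum_divn_shift y L0).
rewrite leq_subRL; last by apply: leq_sum => s _; rewrite leq_div2r// leq_add2r.
rewrite -big_split /=; apply: leq_sum => s _.
have : ((y + s) %/ L <= (z + s) %/ L)%N by rewrite leq_div2r// leq_add2r.
by case: ltngtP => //= h _; rewrite ?h ?addn0 ?addn1.
Qed.

Section Cells.
Variables (R : realType) (I : finType).

(* The offset of the grid of mesh [1 / N] is chosen by averaging over [L] shifts. *)
Lemma random_grid (x : I -> R) (w : I -> I -> R) (N L : nat) :
  (0 < N)%N -> (0 < L)%N -> (forall i, `|x i| <= 1) -> (forall i j, 0 <= w i j) ->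
  exists q : I -> nat,
    (forall i j, q i = q j -> `|x i - x j| <= 2 / N%:R) /\
    \sum_i \sum_j (q i != q j)%:R * w i j <=
      N%:R * (\sum_i \sum_j w i j * `|x i - x j|) + L%:R^-1 * (\sum_i \sum_j w i j).
Proof.
move=> N0 L0 x1 w0; pose NL : R := N%:R * L%:R.
have NR : 0 < N%:R :> R by rewrite ltr0n.
have LR : 0 < L%:R :> R by rewrite ltr0n.
have NL0 : 0 < NL by rewrite mulr_gt0.
(* Positions are rounded to multiples of 1 / (N L), and a cell consists of L consecutive multiples,
   so there are L possible offsets. The rounding error of one unit produces the term with L^-1. *)
pose y i := Num.truncn ((x i + 1) * NL).
have yP i : (y i)%:R <= (x i + 1) * NL < (y i).+1%:R.
  by rewrite truncn_itv// mulr_ge0 ?(ltW NL0)//; have := x1 i; rewrite ler_norml; lra.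
pose q s i := ((y i + s) %/ L)%N.
pose T (s : 'I_L) := \sum_i \sum_j (q s i != q s j)%:R * w i j.
pose B := N%:R * (\sum_i \sum_j w i j * `|x i - x j|) + L%:R^-1 * (\sum_i \sum_j w i j).
have ydist i j : ((y i - y j) + (y j - y i))%N%:R <= NL * `|x i - x j| + 1.
  have /andP[a1 a2] := yP i; have /andP[b1 b2] := yP j.
  have n1 : x i - x j <= `|x i - x j| := ler_norm _.
  have n2 : x j - x i <= `|x i - x j| by rewrite distrC ler_norm.
  have m1 := ler_pM2l NL0; rewrite -(m1 (x i - x j)) in n1; rewrite -(m1 (x j - x i)) in n2.
  rewrite -[(y i).+1]addn1 natrD in a2; rewrite -[(y j).+1]addn1 natrD in b2.
  by have [h|/ltnW h] := leqP (y i) (y j);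
    rewrite (eqP (h : (_ - _ == 0)%N)) ?add0n ?addn0 natrB//; lra.
have sumT : \sum_s T s <= L%:R * B.
  rewrite /T exchange_big /= /B mulrDr mulrA [L%:R * N%:R]mulrC -/NL mulrA divff ?gt_eqF// mul1r.
  rewrite mulr_sumr -big_split /=; apply: ler_sum => i _.
  rewrite exchange_big /= mulr_sumr -big_split /=; apply: ler_sum => j _.
  rewrite -mulr_suml -natr_sum.
  have c1 : (\sum_(s < L) (q s i != q s j))%N%:R <= NL * `|x i - x j| + 1.
    by apply: le_trans (ydist i j); rewrite ler_nat; exact: count_divn_shift.
  apply: le_trans (ler_wpM2r (w0 i j) c1) _.
  by rewrite mulrDl mul1r [w i j * _]mulrC mulrA.
have [s sB] : exists s, T s <= B.
  apply: contrapT => /forallNP h.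
  have : \sum_(s < L) B < \sum_s T s.
    apply: ltr_sum => [|s _]; last by rewrite ltNge; apply/negP/h.
    by apply/hasP; exists (Ordinal L0); rewrite ?mem_index_enum.
  by rewrite sumr_const card_ord -mulr_natl; lra.
exists (q s); split=> // i j qij.
have hL : (y i - y j < L)%N /\ (y j - y i < L)%N.
  have := ltn_pmod (y i + s) L0; have := ltn_pmod (y j + s) L0.
  have := divn_eq (y i + s) L; have := divn_eq (y j + s) L; rewrite -/(q s i) -/(q s j) qij; lia.
have /andP[a1 a2] := yP i; have /andP[b1 b2] := yP j.
have L1 : (1 : R) <= L%:R by rewrite ler1n.
have d1 : (y i)%:R + 1 <= (y j)%:R + L%:R :> R by rewrite natr1 -natrD ler_nat; case: hL => h1 h2; clear -h1 h2; lia.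
have d2 : (y j)%:R + 1 <= (y i)%:R + L%:R :> R by rewrite natr1 -natrD ler_nat; case: hL => h1 h2; clear -h1 h2; lia.
rewrite -[(y i).+1]addn1 natrD in a2; rewrite -[(y j).+1]addn1 natrD in b2.
rewrite ler_pdivlMr// -(ler_pM2r LR) -mulrA -/NL -[X in _ * X](gtr0_norm NL0) -normrM ler_norml.
by apply/andP; split; lra.
Qed.

Lemma positive_cell (T : finType) (q : I -> T) (t : I -> R) :
  0 < \sum_i t i -> exists k, 0 < \sum_(i | q i == k) t i.
Proof.
rewrite (partition_big q xpredT)//= => h; apply: contrapT => /forallNP n.
move: h; rewrite ltNge => /negP; apply; apply: sumr_le0 => k _.
by rewrite leNgt; apply/negP/n.
Qed.

End Cells.

Section CutDiagonal.
Variable R : realType.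
Local Notation C := R[i].

Definition row_sq m n (z : 'M[C]_(m, n)) i : R := \sum_j cabs (z i j) ^+ 2.

Lemma row_sq_ge0 m n (z : 'M[C]_(m, n)) i : 0 <= row_sq z i.
Proof. by apply: sumr_ge0 => j _; rewrite exprn_ge0 ?cabs_ge0. Qed.

Lemma nat_above (x : R) : exists2 n : nat, (0 < n)%N & x <= n%:R.
Proof.
exists (Num.truncn `|x|).+1 => //; apply: le_trans (ler_norm x) _.
by apply/ltW; case/andP: (truncn_itv (normr_ge0 x)).
Qed.

(* The corner is spanned by the basis vectors with [l] in one cell of a grid of the plane: a
   well chosen offset of the grid leaves little of [vs] between different cells, and
   averaging over the cells then produces a cell satisfying all the bounds. *)
Lemma cut_diagonal (eta : R) (nv nx : nat) : 0 < eta -> eta <= 1 ->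
  exists2 delta : R, 0 < delta &
  forall d (l : 'I_d -> C) (vs xs : seq 'M[C]_d) (y : 'M[C]_d) (c : R),
    (0 < d)%N -> 0 <= c -> (size vs <= nv)%N -> (size xs <= nx)%N ->
    (forall i, cabs (l i) = 1) ->
    (forall v, v \in vs -> fro v ^+ 2 = d%:R) ->
    (forall v, v \in vs ->
      \sum_i \sum_j cabs (l i - l j) ^+ 2 * cabs (v i j) ^+ 2 <= delta * d%:R) ->
    (forall x, x \in xs -> fro x ^+ 2 <= delta * d%:R) ->
    (forall i, row_sq y i <= 4) -> c * d%:R <= fro y ^+ 2 ->
  exists I : {set 'I_d},
    [/\ (0 < #|I|)%N,
        forall i j, i \in I -> j \in I -> cabs (l i - l j) ^+ 2 <= eta,
        forall v, v \in vs ->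
          \sum_(i in I) \sum_(j | j \notin I) cabs (v i j) ^+ 2 <= eta * #|I|%:R,
        forall x, x \in xs -> \sum_(i in I) row_sq x i <= eta * #|I|%:R &
        (c - eta) * #|I|%:R <= \sum_(i in I) row_sq y i].
Proof.
move=> eta0 eta1.
(* [N] makes the squared side (2 / N)^2 at most eta / 2 in each coordinate. Then [L], [e] and
   [delta] are chosen so that each of the three contributions [b1], [b2], [b3] to the bad mass is at
   most eta^2 / 64, below eta^2 / 16 in total. *)
have [N N0 N8] := nat_above (8 / eta + 1).
have NR : 0 < N%:R :> R by rewrite ltr0n.
have NR1 : 1 <= N%:R :> R by rewrite ler1n.
have eta2 : 0 < eta ^+ 2 by rewrite exprn_gt0.
have [L L0 L128] := nat_above (128 * nv%:R / eta ^+ 2).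
have LR : 0 < L%:R :> R by rewrite ltr0n.
have nv0 : 0 <= nv%:R :> R by rewrite ler0n.
have nx0 : 0 <= nx%:R :> R by rewrite ler0n.
have [e e0 eE] : exists2 e : R, 0 < e & e = eta ^+ 2 / (128 * N%:R * (nv%:R + 1)).
  by eexists; last reflexivity; rewrite divr_gt0// !mulr_gt0// ltr_wpDl.
have den0 : 0 < 2 * N%:R * nv%:R / e + nx%:R + 1.
  by rewrite ltr_wpDl// addr_ge0// divr_ge0 ?(ltW e0)// !mulr_ge0// ltW.
have [delta delta0 deltaE] : exists2 r : R, 0 < r &
    r = eta ^+ 2 / (64 * (2 * N%:R * nv%:R / e + nx%:R + 1)).
  by eexists; last reflexivity; rewrite divr_gt0// mulr_gt0.
exists delta => // d l vs xs y c d0 c0 svs sxs l1 vfro vcomm xsmall y4 cy.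
have dR : 0 < d%:R :> R by rewrite ltr0n.
pose w i j : R := \sum_(v <- vs) cabs (v i j) ^+ 2.
have w0 i j : 0 <= w i j by apply: sumr_ge0 => v _; rewrite exprn_ge0 ?cabs_ge0.
have bound_seq (T : eqType) (s : seq T) (F : T -> R) (n : nat) (B : R) : 0 <= B ->
    (size s <= n)%N -> (forall v, v \in s -> F v <= B) -> \sum_(v <- s) F v <= n%:R * B.
  move=> B0 sn FB; apply: (@le_trans _ _ ((size s)%:R * B)).
    rewrite -sum1_size natr_sum mulr_suml big_seq [leRHS]big_seq; apply: ler_sum => v vs'.
    by rewrite mul1r FB.
  by rewrite ler_wpM2r// ler_nat.
have exch (g : 'I_d -> 'I_d -> R) : \sum_i \sum_j g i j * w i j =
    \sum_(v <- vs) \sum_i \sum_j g i j * cabs (v i j) ^+ 2.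
  rewrite [RHS]exchange_big; apply: eq_bigr => i _.
  rewrite [RHS]exchange_big; apply: eq_bigr => j _; by rewrite mulr_sumr.
have wsum : \sum_i \sum_j w i j <= nv%:R * d%:R.
  have -> : \sum_i \sum_j w i j = \sum_i \sum_j 1 * w i j.
    by apply: eq_bigr => i _; apply: eq_bigr => j _; rewrite mul1r.
  rewrite exch; apply: bound_seq => // v /vfro <-.
  by rewrite fro2E; do 2!(apply: ler_sum => ? _); rewrite mul1r.
have wcomm : \sum_i \sum_j cabs (l i - l j) ^+ 2 * w i j <= nv%:R * (delta * d%:R).
  by rewrite exch; apply: bound_seq => //; rewrite mulr_ge0// ltW.
have grid (x : 'I_d -> R) : (forall i, `|x i| <= 1) ->
    (forall i j, `|x i - x j| <= cabs (l i - l j)) ->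
    exists q : 'I_d -> nat,
    (forall i j, q i = q j -> `|x i - x j| <= 2 / N%:R) /\
    \sum_i \sum_j (q i != q j)%:R * w i j <=
      (N%:R * (e * nv%:R + nv%:R * delta / e) + L%:R^-1 * nv%:R) * d%:R.
  move=> x1 xl; have [q [q1 q2]] := random_grid N0 L0 x1 w0; exists q; split=> //.
  apply: le_trans q2 _; rewrite mulrDl -(mulrA N%:R) -(mulrA L%:R^-1).
  rewrite lerD// ?ler_pM2l ?invr_gt0//.
  (* The grid charges first powers of distances while commutators control squares; the inequality t
     <= e + T^2 / e converts one into the other. *)
  have amgm i j : w i j * `|x i - x j| <= e * w i j + e^-1 * (cabs (l i - l j) ^+ 2 * w i j).
    set t := `|x i - x j|; set T := cabs _.
    have tT : t <= T := xl i j; have t0 : 0 <= t := normr_ge0 _.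
    have : t <= e + e^-1 * T ^+ 2.
      have h : 0 <= e^-1 * (T - e) ^+ 2 by rewrite mulr_ge0 ?sqr_ge0// invr_ge0 ltW.
      have h2 : e^-1 * (T - e) ^+ 2 = e^-1 * T ^+ 2 - 2 * T + e by field; rewrite gt_eqF.
      by move: h; rewrite h2; have := cabs_ge0 (l i - l j); rewrite -/T; lra.
    by move/(ler_wpM2l (w0 i j)); rewrite mulrDr; lra.
  apply: (@le_trans _ _ (e * \sum_i \sum_j w i j +
      e^-1 * \sum_i \sum_j cabs (l i - l j) ^+ 2 * w i j)).
    rewrite !mulr_sumr -big_split /=; apply: ler_sum => i _.
    by rewrite !mulr_sumr -big_split /=; apply: ler_sum => j _; exact: amgm.
  rewrite [leRHS]mulrDl lerD//.
    by rewrite -mulrA ler_wpM2l// ltW.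
  have -> : nv%:R * delta / e * d%:R = e^-1 * (nv%:R * (delta * d%:R)) by ring.
  by rewrite ler_wpM2l// invr_ge0 ltW.
have [i|i j|q1 [q1N q1off]] := grid (fun i => complex.Re (l i)).
- by rewrite (le_trans (normRe_le_cabs _))// l1.
- by rewrite -RecB normRe_le_cabs.
have [i|i j|q2 [q2N q2off]] := grid (fun i => complex.Im (l i)).
- by rewrite (le_trans (normIm_le_cabs _))// l1.
- by rewrite -ImcB normIm_le_cabs.
pose cell i : {set 'I_d} := finset (fun j => (q1 j == q1 i) && (q2 j == q2 i)).
have cellP i j : (cell i == cell j) = (q1 i == q1 j) && (q2 i == q2 j).
  apply/eqP/andP => [/setP/(_ i)|[/eqP h1 /eqP h2]]; first by rewrite !inE !eqxx => /esym/andP.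
  by apply/setP => k; rewrite !inE h1 h2.
pose off i := \sum_(v <- vs) \sum_(j | cell j != cell i) cabs (v i j) ^+ 2.
pose o : R := 2 * (N%:R * (e * nv%:R + nv%:R * delta / e) + L%:R^-1 * nv%:R).
have offsum : \sum_i off i <= o * d%:R.
  apply: le_trans (le_trans (lerD q1off q2off) _); last by rewrite /o; lra.
  rewrite -big_split /=; apply: ler_sum => i _; rewrite -big_split /= /off exchange_big /=.
  rewrite big_mkcond /=; apply: ler_sum => j _; rewrite -mulrDl -/(w i j).
  rewrite cellP negb_and [q1 j == _]eq_sym [q2 j == _]eq_sym.
  by case: (q1 i == q1 j); case: (q2 i == q2 j) => /=; rewrite ?add0r ?addr0 ?mul1r ?mul0r//;
    rewrite -?mulr2n ?mulr_natl ?ler_wMn2l//; have := w0 i j; lra.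
pose M : R := 8 / eta.
have M0 : 0 < M by rewrite divr_gt0.
pose bad i := off i + \sum_(x <- xs) row_sq x i.
have bad0 i : 0 <= bad i.
  by rewrite addr_ge0// sumr_ge0// => [v _|x _]; [apply: sumr_ge0 => j _; rewrite exprn_ge0 ?cabs_ge0|exact: row_sq_ge0].
have badsum : \sum_i bad i < eta ^+ 2 / 16 * d%:R.
  rewrite big_split /= [X in _ + X]exchange_big /=.
  have xb : \sum_(x <- xs) \sum_i row_sq x i <= nx%:R * (delta * d%:R).
    apply: bound_seq => // [|x /xsmall]; first by rewrite mulr_ge0// ltW.
    by rewrite fro2E.
  apply: le_lt_trans (lerD offsum xb) _; rewrite mulrA -mulrDl ltr_pM2r//.
  have b1 : 2 * (N%:R * (e * nv%:R)) <= eta ^+ 2 / 64.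
    have -> : 2 * (N%:R * (e * nv%:R)) = eta ^+ 2 / 64 * (nv%:R / (nv%:R + 1)).
      by rewrite eE; field; rewrite !gt_eqF// ltr_wpDl.
    by rewrite ger_pMr ?divr_gt0// ler_pdivrMr ?ltr_wpDl// mul1r lerDl.
  have b2 : 2 * (L%:R^-1 * nv%:R) <= eta ^+ 2 / 64.
    rewrite mulrCA mulrC ler_pdivrMr// -ler_pdivrMl ?divr_gt0//.
    by apply: le_trans L128; rewrite invf_div le_eqVlt; apply/orP; left; apply/eqP; ring.
  have b3 : 2 * (N%:R * (nv%:R * delta / e)) + nx%:R * delta <= eta ^+ 2 / 64.
    have -> : 2 * (N%:R * (nv%:R * delta / e)) + nx%:R * delta =
        delta * (2 * N%:R * nv%:R / e + nx%:R) by ring.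
    have -> : eta ^+ 2 / 64 = delta * (2 * N%:R * nv%:R / e + nx%:R + 1).
      rewrite deltaE; move: den0; set K := _ + 1 => K0.
      by rewrite invfM mulrA mulfVK// gt_eqF.
    by rewrite ler_pM2l// lerDl.
  rewrite /o; move: b1 b2 b3; clear -eta2; move: (eta ^+ 2) eta2 => E E0; lra.
have [k kE] : exists k, k = c - eta / 2 by eexists.
(* One function carries all requirements. In a cell where its sum is positive, dropping the penalty
   gives the lower bound for [y]; and since the rows of [y] have square at most 4, the penalty is at
   most 8 #|I|, that is, the bad mass is at most eta #|I|. *)
pose t i := row_sq y i - M * bad i - k.
have tpos : 0 < \sum_i t i.
  rewrite !sumrB sumr_const card_ord -mulr_sumr -fro2E -[k *+ d]mulr_natr kE.
  have : M * (\sum_i bad i) < M * (eta ^+ 2 / 16 * d%:R) by rewrite ltr_pM2l.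
  have -> : M * (eta ^+ 2 / 16 * d%:R) = eta / 2 * d%:R by rewrite /M; field; rewrite gt_eqF.
  move: cy; lra.
have [I tI] := positive_cell cell tpos.
(* A positive sum is not empty, so [I] is the cell of one of its elements, and the index set of the
   sum is [I] itself. *)
have memI i : (i \in I) = (cell i == I).
  have [k' /eqP kI|none] := pickP (fun k' => cell k' == I).
    by rewrite -kI cellP inE.
  by move: tI; rewrite big_pred0 ?ltxx//; exact: none.
have tI' : 0 < \sum_(i in I) t i by under eq_bigl do rewrite memI.
have I0 : (0 < #|I|)%N.
  rewrite card_gt0; apply: contraTneq tI' => ->; by rewrite big_set0 ltxx.
have IR : 0 < #|I|%:R :> R by rewrite ltr0n.
rewrite !sumrB sumr_const -mulr_sumr -[_ *+ #|I|]mulr_natr kE in tI'.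
have badI0 : 0 <= \sum_(i in I) bad i by apply: sumr_ge0.
have yI : \sum_(i in I) row_sq y i <= 4 * #|I|%:R.
  by rewrite mulr_natr -sumr_const; apply: ler_sum.
have badI : \sum_(i in I) bad i <= eta * #|I|%:R.
  rewrite -(@ler_pM2l _ M)// [leRHS]mulrA divfK ?gt_eqF//.
  have : 0 <= c * #|I|%:R by rewrite mulr_ge0// ltW.
  have : eta / 2 * #|I|%:R <= 1 * #|I|%:R by rewrite ler_pM2r//; clear -eta0 eta1; lra.
  by move: tI' yI IR; clear; lra.
have MbadI0 : 0 <= M * \sum_(i in I) bad i by rewrite mulr_ge0// ltW.
have cle i j : i \in I -> j \in I -> q1 i = q1 j /\ q2 i = q2 j.
  by rewrite !memI => /eqP <-; rewrite eq_sym cellP => /andP[/eqP ? /eqP ?].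
exists I; split=> // [i j iI jI|v vv|x xx|].
- have [h1 h2] := cle i j iI jI.
  have := q1N _ _ h1; have := q2N _ _ h2; rewrite cabs2 RecB ImcB.
  set a := complex.Re _ - _; set b := complex.Im _ - _ => hb ha.
  have sq (z : R) : `|z| <= 2 / N%:R -> z ^+ 2 <= eta / 2.
    move=> hz; rewrite -real_normK ?num_real//.
    apply: (@le_trans _ _ ((2 / N%:R) ^+ 2)).
      by rewrite ler_pXn2r// nnegrE ?divr_ge0// ltW.
    rewrite exprMn -[2 ^+ 2]/(2 * 2) exprVn ler_pdivrMr ?exprn_gt0//.
    have e8 : 8 <= eta * N%:R by rewrite mulrC -ler_pdivrMr//; clear -N8; lra.
    have : eta * N%:R <= eta * N%:R ^+ 2 by rewrite ler_pM2l// expr2 ler_peMr// ltW.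
    by move: e8; clear; lra.
  by have := sq a ha; have := sq b hb; clear; lra.
- apply: le_trans badI; apply: ler_sum => i iI.
  apply: (@le_trans _ _ (off i)); last first.
    by rewrite lerDl; apply: sumr_ge0 => x _; exact: row_sq_ge0.
  rewrite /off (big_rem v)//=.
  have -> : \sum_(j | j \notin I) cabs (v i j) ^+ 2 = \sum_(j | cell j != cell i) cabs (v i j) ^+ 2.
    by apply: eq_bigl => j; rewrite !memI in iI *; rewrite (eqP iI).
  rewrite lerDl; apply: sumr_ge0 => v' _; apply: sumr_ge0 => j _.
  by rewrite exprn_ge0 ?cabs_ge0.
- apply: le_trans badI; apply: ler_sum => i iI.
  apply: (@le_trans _ _ (\sum_(x <- xs) row_sq x i)); last first.
    rewrite lerDr; apply: sumr_ge0 => v _; apply: sumr_ge0 => j _.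
    by rewrite exprn_ge0 ?cabs_ge0.
  by rewrite (big_rem x)//= lerDl; apply: sumr_ge0 => x' _; exact: row_sq_ge0.
- have : 0 <= eta / 2 * #|I|%:R by rewrite mulr_ge0 ?ltW// divr_gt0.
  by move: tI' MbadI0; clear; lra.
Qed.
End CutDiagonal.

Section CutCorner.
Variable R : realType.
Local Notation C := R[i].

Lemma row_sq_unitary n (u : 'M[C]_n) i : u \is unitarymx -> row_sq u i = 1.
Proof.
move=> /unitarymxP/matrixP/(_ i i); rewrite !mxE eqxx /= => h.
apply: complexI; transitivity (1 : C); last by [].
rewrite -[RHS]h rmorph_sum; apply: eq_bigr => j _.
by rewrite !mxE mul_conj.
Qed.

Lemma row_sqB m n (x y : 'M[C]_(m, n)) i :
  row_sq (x - y) i <= 2 * row_sq x i + 2 * row_sq y i.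
Proof.
rewrite !mulr_sumr -big_split /=; apply: ler_sum => j _; rewrite !mxE.
have := cabsB (x i j) (y i j); set a := cabs (x i j); set b := cabs (y i j).
have a0 : 0 <= a := cabs_ge0 _; have b0 : 0 <= b := cabs_ge0 _.
set c := cabs _; have c0 : 0 <= c := cabs_ge0 _ => cab.
have : c ^+ 2 <= (a + b) ^+ 2 by rewrite ler_pXn2r// nnegrE addr_ge0.
by have := sqr_ge0 (a - b); clear; lra.
Qed.

Section CoordinateCorner.
Variables (d : nat) (I : {set 'I_d}).

Definition set_corner : 'M[C]_(#|I|, d) := \matrix_(k, j) (enum_val k == j)%:R.

Lemma set_corner_mul p (z : 'M[C]_(d, p)) k j : (set_corner *m z) k j = z (enum_val k) j.
Proof.
rewrite mxE (bigD1 (enum_val k))//= big1 => [|l lk]; rewrite !mxE.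
  by rewrite eqxx mul1r addr0.
by rewrite eq_sym (negbTE lk) mul0r.
Qed.

Lemma set_corner_mul_adj p (z : 'M[C]_(p, d)) k j :
  (z *m set_corner^t*) k j = z k (enum_val j).
Proof.
rewrite mxE (bigD1 (enum_val j))//= big1 => [|l lk]; rewrite !mxE.
  by rewrite eqxx conjC1 mulr1 addr0.
by rewrite eq_sym (negbTE lk) conjC0 mulr0.
Qed.

Lemma set_corner_isometry : set_corner *m set_corner^t* = 1%:M.
Proof.
apply/matrixP => k l; rewrite set_corner_mul_adj !mxE.
by rewrite (inj_eq enum_val_inj).
Qed.

Lemma fro2_set_corner p (z : 'M[C]_(d, p)) :
  fro (set_corner *m z) ^+ 2 = \sum_(i in I) row_sq z i.
Proof.
rewrite fro2E [RHS]big_enum_val; apply: eq_bigr => k _; apply: eq_bigr => j _.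
by rewrite set_corner_mul.
Qed.

Lemma fro2_set_corner_off (v : 'M[C]_d) :
  fro (set_corner *m v *m (1%:M - set_corner^t* *m set_corner)) ^+ 2 =
  \sum_(i in I) \sum_(j | j \notin I) cabs (v i j) ^+ 2.
Proof.
have inside : fro (set_corner *m v *m set_corner^t*) ^+ 2 =
    \sum_(i in I) \sum_(j in I) cabs (v i j) ^+ 2.
  rewrite fro2E [RHS]big_enum_val; apply: eq_bigr => k _.
  rewrite [RHS]big_enum_val; apply: eq_bigr => j _.
  by rewrite set_corner_mul_adj set_corner_mul.
apply: (addrI (fro (set_corner *m v *m set_corner^t*) ^+ 2)).
rewrite -(fro2_split _ set_corner_isometry) inside fro2_set_corner -big_split /=.
by apply: eq_bigr => i _; rewrite /row_sq [LHS](bigID (mem I)).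
Qed.

End CoordinateCorner.

Lemma unitary_diagonalization d (u : 'M[C]_d) : u \is unitarymx ->
  exists (S : 'M[C]_d) (l : 'I_d -> C), [/\ S \is unitarymx,
    S *m u *m S^t* = diag_mx (\row_i l i) & forall i, cabs (l i) = 1].
Proof.
move=> uu; have un : u \is normalmx.
  by apply/normalmxP; rewrite (unitarymxP uu) (unitarymxPr uu).
have [S [D [Su uE]]] := normal_diagonalization un.
have DE : S *m u *m S^t* = diag_mx D.
  by rewrite uE !mulmxA (unitarymxP Su) mul1mx -mulmxA (unitarymxP Su) mulmx1.
exists S, (fun i => D 0 i); split=> //.
  by rewrite DE; congr diag_mx; apply/rowP => i; rewrite mxE.
move=> i; have Du : diag_mx D \is unitarymx.
  have Su' : S^t* \is unitarymx by rewrite trmxC_unitary.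
  by rewrite -DE (mul_unitarymx (mul_unitarymx Su uu) Su').
have := row_sq_unitary i Du; rewrite /row_sq (bigD1 i)//= big1 => [|j ji]; last first.
  by rewrite mxE eq_sym (negbTE ji) cabs0 expr0n.
rewrite mxE eqxx mulr1n addr0 => /eqP; rewrite sqrf_eq1 => /orP[/eqP//|/eqP h].
by have := cabs_ge0 (D 0 i); rewrite h; lra.
Qed.

Lemma diag_comm_entry d (D : 'rV[C]_d) (v : 'M[C]_d) i j :
  (diag_mx D *m v - v *m diag_mx D) i j = (D 0 i - D 0 j) * v i j.
Proof. by rewrite mul_diag_mx mul_mx_diag !mxE; ring. Qed.

(** In an eigenbasis of [u] the commutator with [v] has entries (l i - l j) v i j, so its norm is
    the weighted sum that [cut_diagonal] expects. The row bound 4 there comes from z - 1 with [z]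
    unitary. *)
Lemma cut_corner (eta : R) (nv nx : nat) : 0 < eta -> eta <= 1 ->
  exists2 delta : R, 0 < delta &
  forall d (u : 'M[C]_d) (vs xs : seq 'M[C]_d) (z : 'M[C]_d) (c : R),
    (0 < d)%N -> 0 <= c -> (size vs <= nv)%N -> (size xs <= nx)%N ->
    u \is unitarymx -> z \is unitarymx -> (forall v, v \in vs -> v \is unitarymx) ->
    (forall v, v \in vs -> fro (u *m v - v *m u) ^+ 2 <= delta * d%:R) ->
    (forall x, x \in xs -> fro x ^+ 2 <= delta * d%:R) ->
    c * d%:R <= fro (z - 1%:M) ^+ 2 ->
  exists (r : nat) (J : 'M[C]_(r, d)) (l : C),
    [/\ (0 < r)%N /\ J *m J^t* = 1%:M,
        cabs l = 1 /\ fro (J *m u *m J^t* - l%:M) ^+ 2 <= eta * r%:R,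
        forall v, v \in vs ->
          fro (J *m v *m (1%:M - J^t* *m J)) ^+ 2 <= eta * r%:R,
        forall x, x \in xs -> fro (J *m x) ^+ 2 <= eta * r%:R &
        (c - eta) * r%:R <= fro (J *m (z - 1%:M)) ^+ 2].
Proof.
move=> eta0 eta1; have [delta delta0 H] := cut_diagonal nv nx eta0 eta1.
exists delta => // d u vs xs z c d0 c0 svs sxs uu zu vu vcomm xsmall cz.
have [S [l [Su uE l1]]] := unitary_diagonalization uu.
have Su' : S^t* \is unitarymx by rewrite trmxC_unitary.
pose cj (x : 'M[C]_d) := S *m x *m S^t*.
have frocj x : fro (cj x) = fro x by rewrite /cj (fro_mulr_unitary _ Su') (fro_mull_unitary _ Su).
have cjM x y : cj (x *m y) = cj x *m cj y.
  by rewrite /cj !mulmxA -(mulmxA (S *m x) (S^t*) S) (unitarymxPr Su) mulmx1.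
have cjB x y : cj (x - y) = cj x - cj y by rewrite /cj mulmxBr mulmxBl.
have cj1 : cj 1%:M = 1%:M by rewrite /cj mulmx1 (unitarymxP Su).
have cju x : x \is unitarymx -> cj x \is unitarymx.
  by move=> xu; exact: (mul_unitarymx (mul_unitarymx Su xu) Su').
have cjE x : cj x = S *m x *m S^t* by [].
have cjuE : cj u = diag_mx (\row_i l i) by exact: uE.
clearbody cj.
have svs' : (size (map cj vs) <= nv)%N by rewrite size_map.
have sxs' : (size (map cj xs) <= nx)%N by rewrite size_map.
have [] := H d l (map cj vs) (map cj xs) (cj (z - 1%:M)) c d0 c0 svs' sxs' l1.
- by move=> _ /mapP[v vv ->]; rewrite frocj fro_unitary ?vu// sqr_sqrtr ?ler0n.
- move=> _ /mapP[v vv ->]; apply: le_trans (vcomm v vv).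
  rewrite -frocj cjB !cjM fro2E le_eqVlt; apply/orP; left; apply/eqP.
  apply: eq_bigr => i _; apply: eq_bigr => j _.
  by rewrite -exprMn -cabsM cjuE diag_comm_entry !mxE.
- by move=> _ /mapP[x xx ->]; rewrite frocj xsmall.
- move=> i; rewrite cjB cj1; apply: le_trans (row_sqB _ _ _) _.
  by rewrite (row_sq_unitary _ (cju _ zu)) (row_sq_unitary _ (unitarymx1 _ _)); clear; lra.
- by rewrite frocj.
move=> I [I0 Il Iv Ix Iz].
(* All eigenvalues in the cell are close to each other, so any one of them can serve as the
   scalar. *)
have [i0 i0I] : exists i, i \in I by apply/set0Pn; rewrite -card_gt0.
have [J0 J0E] : exists J0, J0 = set_corner I by eexists.
have [J JE] : exists J, J = J0 *m S by eexists.
have JJ : J *m J^t* = 1%:M.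
  by rewrite JE adjmxM mulmxA -(mulmxA J0) (unitarymxP Su) mulmx1 J0E set_corner_isometry.
have froJ x : fro (J *m x) = fro (J0 *m cj x).
  by rewrite cjE JE mulmxA (fro_mulr_unitary _ Su') mulmxA.
exists #|I|, J, (l i0); split.
- by [].
- split=> //.
  have -> : J *m u *m J^t* = J0 *m cj u *m J0^t* by rewrite JE cjE adjmxM !mulmxA.
  rewrite fro2E; apply: (@le_trans _ _ (\sum_(k < #|I|) eta)); last first.
    by rewrite sumr_const card_ord mulr_natr.
  apply: ler_sum => k _; rewrite (bigD1 k)//= big1 => [|j jk].
    rewrite addr0 cjuE J0E mxE set_corner_mul_adj set_corner_mul !mxE eqxx !mulr1n.
    by rewrite eqxx mulr1n; apply: Il => //; exact: enum_valP.
  rewrite cjuE J0E mxE set_corner_mul_adj set_corner_mul !mxE.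
  rewrite (inj_eq enum_val_inj) [k == j]eq_sym (negbTE jk) !mulr0n subr0 cabs0.
  by rewrite expr0n.
- move=> v vv; have := Iv (cj v) (map_f cj vv); rewrite -fro2_set_corner_off -J0E.
  have E : fro (J *m v *m (1%:M - J^t* *m J)) =
            fro (J0 *m cj v *m (1%:M - J0^t* *m J0)); last by rewrite E.
  rewrite -[LHS](fro_mulr_unitary _ Su'); congr fro.
  rewrite cjE JE adjmxM mulmxBr mulmx1 mulmxBl [RHS]mulmxBr mulmx1 !mulmxA.
  by rewrite -(mulmxA _ S (S^t*)) (unitarymxP Su) mulmx1.
- by move=> x xx; rewrite froJ J0E fro2_set_corner; apply: Ix; exact: map_f.
- by rewrite froJ J0E fro2_set_corner.
Qed.

End CutCorner.

(** * Almost representations *)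

Lemma fro_chain (R : realType) m n (y x z : 'M[R[i]]_(m, n)) (k l : R) :
  fro (x - y) <= k -> fro (y - z) <= l -> fro (x - z) <= k + l.
Proof. by move=> xy yz; apply: le_trans (fro_triangle y x z) _; exact: lerD xy yz. Qed.

Lemma fro_near (R : realType) m n (z x y : 'M[R[i]]_(m, n)) (k s : R) :
  fro (x - z) <= k * s -> fro (y - z) <= k * s -> fro (x - y) <= 2 * k * s.
Proof.
move=> xz yz; apply: le_trans (fro_triangle z x y) _.
rewrite [X in _ + X <= _]fro_distC -mulrA mulrDl !mul1r.
exact: lerD xz yz.
Qed.

Section CornerEstimates.
Variable R : realType.
Local Notation C := R[i].
Variables (d r : nat) (J : 'M[C]_(r, d)).
Hypothesis JJ : J *m J^t* = 1%:M.

Lemma fro_corner_le (x : 'M[C]_d) : fro (J *m x *m J^t*) <= fro (J *m x).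
Proof. exact: fro_mulr_adj_le. Qed.

Lemma fro_corner_contract p (x : 'M[C]_d) (y : 'M[C]_(r, p)) : x \is unitarymx ->
  fro (J *m x *m J^t* *m y) <= fro y.
Proof.
move=> xu; rewrite -!mulmxA; apply: le_trans (fro_mull_le _ JJ) _.
by rewrite (fro_mull_unitary _ xu) fro_mull_isometry// trmxCK.
Qed.

(** Inserting [J^t* *m J] between [x] and [y] costs the part of [J *m x] that leaves the corner; the
    rest is the distance from [x *m y] to [z]. *)
Lemma fro_corner_mul (x y z : 'M[C]_d) : y \is unitarymx ->
  fro (J *m x *m J^t* *m (J *m y *m J^t*) - J *m z *m J^t*) <=
  fro (J *m x *m (1%:M - J^t* *m J)) + fro (J *m (x *m y - z)).
Proof.
move=> yu.
have -> : J *m x *m J^t* *m (J *m y *m J^t*) - J *m z *m J^t* =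
    J *m (x *m y - z) *m J^t* - J *m x *m (1%:M - J^t* *m J) *m y *m J^t*.
  rewrite [J *m x *m (_ - _)]mulmxBr mulmx1 !mulmxBl mulmxBr mulmxBl !mulmxA.
  by rewrite opprB [RHS]addrC addrA subrK.
apply: le_trans (froB _ _) _; rewrite addrC lerD//; last exact: fro_corner_le.
apply: le_trans (fro_mulr_adj_le _ JJ) _.
by rewrite (fro_mulr_unitary _ yu).
Qed.

Lemma corner_near_mul (vg vh vgh : 'M[C]_r) (x y z : 'M[C]_d) (k l : R) :
  vh \is unitarymx -> x \is unitarymx -> y \is unitarymx ->
  fro (vg - J *m x *m J^t*) <= k -> fro (vh - J *m y *m J^t*) <= k ->
  fro (J *m z *m J^t* - vgh) <= k ->
  fro (J *m x *m (1%:M - J^t* *m J)) <= l -> fro (J *m (x *m y - z)) <= l ->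
  fro (vg *m vh - vgh) <= k + (k + (l + l + k)).
Proof.
move=> vu xu yu hg hh hgh hx hxy.
apply: (@fro_chain _ _ _ (J *m x *m J^t* *m vh)).
  rewrite -mulmxBl (fro_mulr_unitary _ vu); exact: hg.
apply: (@fro_chain _ _ _ (J *m x *m J^t* *m (J *m y *m J^t*))).
  rewrite -mulmxBr; apply: le_trans hh; exact: fro_corner_contract.
apply: (fro_chain _ hgh); apply: le_trans (fro_corner_mul _ _ yu) _.
exact: lerD hx hxy.
Qed.

Lemma fro_corner_sub1 (x : 'M[C]_d) :
  fro (J *m (x - 1%:M)) <=
  fro (J *m x *m J^t* - 1%:M) + fro (J *m x *m (1%:M - J^t* *m J)).
Proof.
have -> : J *m (x - 1%:M) = (J *m x *m J^t* - 1%:M) *m J + J *m x *m (1%:M - J^t* *m J).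
  rewrite mulmxBr mulmx1 [X in _ = X + _]mulmxBl mul1mx [X in _ = _ + X]mulmxBr mulmx1.
  by rewrite mulmxA [RHS]addrC addrA subrK.
apply: le_trans (froD _ _) _; rewrite lerD2r.
by rewrite fro_mulr_coisometry.
Qed.

End CornerEstimates.

Section NearRepresentations.
Variables (R : realType) (G : groupType).
Local Notation C := R[i].

Definition near_rep (E : seq G) (e : R) d (th : G -> 'M[C]_d) : Prop :=
  [/\ (0 < d)%N, forall g, th g \is unitarymx &
      forall g h, g \in E -> h \in E -> (g * h)%g \in E ->
        hs_norm (th g *m th h - th (g * h)%g) <= e].

Lemma hyperlinear_near_rep (a : G) (E : seq G) (e : R) : hyperlinear R G ->
  a != 1%g -> 0 < e -> exists d (th : G -> 'M[C]_d),
    near_rep E e th /\ Num.sqrt 2 - e <= hs_norm (th a - 1%:M).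
Proof.
move=> hG a1 e0; have [d [phi [d0 pu pm p1]]] := hG e (a :: E) e0.
exists d, (fun g => if g \in a :: E then phi g else 1%:M); split; last first.
  by rewrite mem_head; apply/ltW/p1 => //; rewrite mem_head.
split=> // [g|g h gE hE ghE]; first by case: ifP => [/pu //|_]; exact: unitarymx1.
have sub k : k \in E -> k \in a :: E by rewrite inE orbC => ->.
by rewrite !sub//; apply/ltW/pm; apply: sub.
Qed.

End NearRepresentations.

(** Induction on [B], one spectral cut per element. Each cut must keep what was achieved before: the
    images of [E1] have to stay almost block diagonal, and [xs] collects the defects of
    multiplicativity and of the earlier scalars, which must not concentrate on the corner. *)
Lemma cut_scalars (R : realType) (G : groupType) (A : zmodType) (i : A -> G)
    (a : A) (B : seq A) (E : seq G) (e : R) :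
  (forall a x, commute (i a) x) -> hyperlinear R G -> i a != 1%g -> 0 < e ->
  exists d (th : G -> 'M[R[i]]_d) (l : A -> R[i]),
    [/\ near_rep E e th,
        forall b, b \in B -> cabs (l b) = 1 /\ hs_norm (th (i b) - (l b)%:M) <= e &
        Num.sqrt 2 - e <= hs_norm (th (i a) - 1%:M)].
Proof.
move=> ic hG a1; elim: B E e => [|b B IHB] E e e0.
  by have [d [th [thE tha]]] := hyperlinear_near_rep E hG a1 e0; exists d, th, (fun=> 1).
wlog e1 : e e0 / e <= 1.
  move=> h; pose e' := Num.min e 1; have e'0 : 0 < e' by rewrite lt_min e0 ltr01.
  have e'e : e' <= e by rewrite ge_min lexx.
  have e'1 : e' <= 1 by rewrite ge_min lexx orbT.
  have [d [th [l [[d0 thu thm] thl tha]]]] := h e' e'0 e'1; exists d, th, l; split=> //.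
  - by split=> // g k gE kE gkE; apply: le_trans (thm g k gE kE gkE) e'e.
  - by move=> k /thl[l1 h1]; split=> //; apply: le_trans h1 e'e.
  - by apply: le_trans tha; rewrite lerD2l lerN2.
have [E1 [ia1 ib1 iB1 inE1]] : exists E1 : seq G, [/\ i a \in E1, i b \in E1,
    forall b', b' \in B -> i b' \in E1 & forall x, x \in E -> x \in E1].
  exists (i a :: i b :: map i B ++ E); split; rewrite ?inE ?eqxx ?orbT//.
    by move=> b' b'B; rewrite !inE mem_cat map_f ?orbT.
  by move=> x xE; rewrite !inE mem_cat xE !orbT.
(* In units of e / 16 the passage to the corner costs 8 for multiplicativity and less for the other
   two claims. *)
pose eta := (e / 16) ^+ 2.
have e16 : 0 < e / 16 by rewrite divr_gt0.
have eta0 : 0 < eta by rewrite exprn_gt0.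
have eta1 : eta <= 1 by rewrite exprn_ile1//; [exact: ltW|clear -e1; lra].
have [delta delta0 cut] := cut_corner (size E1) (size E1 * size E1 + size B) eta0 eta1.
have [e' [e'0 e'16 e'4 e'd]] : exists e' : R, [/\ 0 < e', e' <= e / 16, e' <= 4^-1 & e' <= delta].
  exists (Num.min (e / 16) (Num.min 4^-1 delta)); split.
  - by rewrite !lt_min e16 delta0 invr_gt0 ltr0n.
  - by rewrite ge_min lexx.
  - by rewrite !ge_min lexx ?orbT.
  - by rewrite !ge_min lexx ?orbT.
have [d [th [l [[d0 thu thm] thl tha]]]] := IHB (E1 ++ [seq (i b * g)%g | g <- E1]) e' e'0.
have dR : 0 < Num.sqrt d%:R :> R by rewrite sqrtr_gt0 ltr0n.
have sqd : Num.sqrt d%:R ^+ 2 = d%:R :> R by rewrite sqr_sqrtr ?ler0n.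
have E1in g : g \in E1 -> g \in E1 ++ [seq (i b * g)%g | g <- E1] by rewrite mem_cat => ->.
have sq_small (x : 'M[R[i]]_d) (k : R) : fro x <= k * Num.sqrt d%:R -> 0 <= k -> k ^+ 2 <= delta ->
    fro x ^+ 2 <= delta * d%:R.
  move=> xk k0 kd; apply: (@le_trans _ _ ((k * Num.sqrt d%:R) ^+ 2)).
    by rewrite ler_pXn2r// nnegrE ?fro_ge0// mulr_ge0// ltW.
  by rewrite exprMn sqd ler_wpM2r.
have e'sq : e' ^+ 2 <= delta.
  by apply: le_trans e'd; rewrite expr2 ger_pMr//; clear -e'4; lra.
have e'sq2 : (2 * e') ^+ 2 <= delta.
  apply: le_trans e'd; have -> : (2 * e') ^+ 2 = e' * (4 * e') by ring.
  by rewrite ger_pMr//; clear -e'4; lra.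
pose xs := [seq th g.1 *m th g.2 - th (g.1 * g.2)%g |
    g <- [seq g <- [seq (g, h) | g <- E1, h <- E1] | (g.1 * g.2)%g \in E1]] ++
  [seq th (i b') - (l b')%:M | b' <- B].
have s2 : 1 <= Num.sqrt 2 :> R by rewrite -[leLHS]sqrtr1 ler_sqrt ?ler1n.
pose c := (Num.sqrt 2 - e') ^+ 2.

have [] := cut d (th (i b)) (map th E1) xs (th (i a)) c d0.
- by rewrite sqr_ge0.
- by rewrite size_map.
- rewrite size_cat !size_map leq_add2r.
  by rewrite size_filter -(size_allpairs (fun g h => (g, h))) count_size.
- exact: thu.
- exact: thu.
- by move=> _ /mapP[g _ ->]; exact: thu.
- move=> _ /mapP[g gE ->].
  have ibg : (i b * g)%g \in E1 ++ [seq (i b * g)%g | g <- E1].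
    by rewrite mem_cat; apply/orP; right; exact: map_f.
  apply: (sq_small _ (2 * e')) => //; last by rewrite mulr_ge0// ltW.
  (* As [i b] is central, both orders of the product are close to the same [th (i b * g)]; this
     bounds the commutator and is why the earlier stage is asked for these products too. *)
  have h1 := thm _ _ (E1in _ ib1) (E1in _ gE) ibg.
  have h2 : hs_norm (th g *m th (i b) - th (i b * g)%g) <= e'.
    have gb : (i b * g = g * i b)%g by exact: ic.
    by rewrite gb in ibg *; apply: thm => //; exact: E1in.
  rewrite hs_norm_le in h1; last exact: d0.
  rewrite hs_norm_le in h2; last exact: d0.
  exact: fro_near h1 h2.
- move=> x; rewrite mem_cat => /orP[/mapP[[g h] /=]|/mapP[b' b'B ->]].
    rewrite mem_filter => /andP[/= gh /allpairsP[[g' h'] /= [g'E h'E [gg hh]]]] ->.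
    rewrite -gg -hh in g'E h'E; apply: (sq_small _ e') => //; last exact: ltW.
    by rewrite -hs_norm_le//; apply: thm; apply: E1in.
  have [_ h] := thl b' b'B; rewrite hs_norm_le// in h.
  by apply: (sq_small _ e') => //; exact: ltW.
- rewrite hs_norm_ge// in tha; rewrite -sqd -exprMn ler_pXn2r// nnegrE ?fro_ge0//.
  by rewrite mulr_ge0 ?(ltW dR)//; clear -s2 e'4; lra.
move=> r [J [m [[r0 JJ] [m1 mb] Jv Jx Ja]]].
have rR : 0 < Num.sqrt r%:R :> R by rewrite sqrtr_gt0 ltr0n.
have sqr : Num.sqrt r%:R ^+ 2 = r%:R :> R by rewrite sqr_sqrtr ?ler0n.
have [k kE] : exists k, k = e / 16 * Num.sqrt r%:R by eexists.
have k0 : 0 < k by rewrite kE mulr_gt0.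
have le_k p q (x : 'M[R[i]]_(p, q)) : fro x ^+ 2 <= eta * r%:R -> fro x <= k.
  by rewrite -sqr -exprMn -kE ler_pXn2r// nnegrE ?fro_ge0// ltW.
have /choice[v vP] : forall g, exists v : 'M[R[i]]_r, v \is unitarymx /\
    (g \in E1 -> fro (J *m th g *m J^t* - v) <= 2 * k).
  move=> g; have [v vu hv] := round_corner (thu g) JJ; exists v; split=> // gE.
  by apply: le_trans hv _; rewrite ler_pM2l// le_k// Jv// map_f.
have vu g : v g \is unitarymx := (vP g).1.
have vclose g : g \in E1 -> fro (v g - J *m th g *m J^t*) <= 2 * k.
  by move=> gE; rewrite fro_distC; exact: (vP g).2.
have Joff g : g \in E1 -> fro (J *m th g *m (1%:M - J^t* *m J)) <= k.
  by move=> gE; apply/le_k/Jv/map_f.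
have ke : k <= e / 16 * Num.sqrt r%:R by rewrite kE.
exists r, v, (fun b' => if b' == b then m else l b'); split.
- split=> // g h gE hE ghE; rewrite hs_norm_le//.

  have gE1 := inE1 _ gE; have hE1 := inE1 _ hE; have ghE1 := inE1 _ ghE.
  have t1 : fro (J *m (th g *m th h - th (g * h)%g)) <= k.
    apply/le_k/Jx; rewrite mem_cat; apply/orP; left.
    apply/mapP; exists (g, h) => //; rewrite mem_filter /= ghE1 /=.
    by apply/allpairsP; exists (g, h).
  have t := corner_near_mul JJ (vu h) (thu g) (thu h) (vclose g gE1) (vclose h hE1)
    ((vP (g * h)%g).2 ghE1) (Joff g gE1) t1.
  by apply: le_trans t _; move: ke k0; clear; lra.
- move=> b'; rewrite inE; have [-> _|b'b /= b'B] := eqVneq b' b.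
    split=> //; rewrite hs_norm_le//.
    have t := fro_chain (vclose _ ib1) (le_k _ _ _ mb).
    by apply: le_trans t _; move: ke k0; clear; lra.
  have [l1 _] := thl b' b'B; split=> //; rewrite hs_norm_le//.
  have b'E1 := iB1 _ b'B.
  have t1 : fro (J *m th (i b') *m J^t* - (l b')%:M) <= k.
    have -> : J *m th (i b') *m J^t* - (l b')%:M = J *m (th (i b') - (l b')%:M) *m J^t*.
      rewrite mulmxBr mulmxBl; congr (_ - _).
      by rewrite mul_mx_scalar -scalemxAl JJ scalemx1.
    apply: le_trans (fro_corner_le JJ _) _; apply/le_k/Jx.
    by rewrite mem_cat; apply/orP; right; apply/mapP; exists b'.
  have t := fro_chain (vclose _ b'E1) t1.
  by apply: le_trans t _; move: ke k0; clear; lra.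
- rewrite hs_norm_ge//.
  have t1 := le_trans (fro_corner_sub1 JJ (th (i a)))
    (lerD (fro_triangle (v (i a)) (J *m th (i a) *m J^t*) 1%:M) (Joff _ ia1)).
  (* With p >= q >= 0 one has (p - q)^2 <= p^2 - q^2, which turns the bound c - eta on squares into
     one on norms. *)
  have t4 : (Num.sqrt 2 - e' - e / 16) * Num.sqrt r%:R <= fro (J *m (th (i a) - 1%:M)).
    rewrite -(@ler_pXn2r _ 2) ?nnegrE ?fro_ge0//; last first.
      by rewrite mulr_ge0 ?(ltW rR)//; clear -s2 e'4 e1; lra.
    apply: le_trans Ja; rewrite exprMn sqr ler_wpM2r ?ler0n// /c /eta.
    set p := _ - e'; set q := e / 16.
    have -> : (p - q) ^+ 2 = p ^+ 2 - q ^+ 2 - 2 * q * (p - q) by ring.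
    have pq : 0 <= p - q by rewrite /p /q; clear -s2 e'4 e1; lra.
    by rewrite gerBl; apply: mulr_ge0 pq; apply: mulr_ge0 (ltW e16).
  have t6 := (vP (i a)).2 ia1.
  have t8 := le_trans (le_trans t4 t1) (lerD (lerD t6 (lexx _)) (lexx _)).
  have t7 : e' * Num.sqrt r%:R <= k by rewrite kE ler_wpM2r// ltW.
  move: t8 t7 kE k0; move: (fro (v (i a) - _)) => x; clear.
  move: (Num.sqrt 2) (Num.sqrt r%:R) => s t; lra.
Qed.

(** * Approximate characters *)

Section Enumerations.

Lemma countable_enum (T : choiceType) (x0 : T) : countable [set: T] ->
  exists e : nat -> T, forall x, exists n, e n = x.
Proof.
move=> /countable_injP[k kinj].
exists (fun n => if pselect (exists x, k x = n) is left P then projT1 (cid P) else x0).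
move=> x; exists (k x); case: pselect => [P|[]]; last by exists x.
by case: cid => y /= yx; apply: kinj; rewrite ?inE.
Qed.

Lemma mem_enum_prefix (T : choiceType) (e : nat -> T) (E : seq T) :
  (forall x, exists n, e n = x) ->
  \forall n \near \oo, {subset E <= map e (iota 0 n)}.
Proof.
move=> esurj; elim: E => [|x E IHE]; first by exists 0%N.
have [k ek] := esurj x.
near=> n => y; rewrite inE => /orP[/eqP->|yE].
  rewrite -ek map_f// mem_iota add0n /=; near: n; exact: nbhs_infty_gt.
by have /(_ y yE) : {subset E <= map e (iota 0 n)} by near: n.
Unshelve. all: by end_near. Qed.

Lemma near_all_seq (I : eqType) (U : Type) (F : set_system U) {FF : Filter F} (S : seq I)
    (P : I -> U -> Prop) : (forall x, \forall n \near F, P x n) ->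
  \forall n \near F, forall x, x \in S -> P x n.
Proof.
move=> h; elim: S => [|x S IHS]; first exact: nearW.
near=> n => y; rewrite inE => /orP[/eqP->|yS]; first by near: n.
by have /(_ y yS) : forall x, x \in S -> P x n by near: n.
Unshelve. all: by end_near. Qed.

End Enumerations.

Section HSNorm.
Variable R : realType.
Local Notation C := R[i].

Lemma hs_chain d (y x z : 'M[C]_d) (k l : R) :
  hs_norm (x - y) <= k -> hs_norm (y - z) <= l -> hs_norm (x - z) <= k + l.
Proof.
rewrite !hs_normE => xy yz; apply: le_trans (lerD xy yz).
by rewrite -mulrDl ler_wpM2r ?invr_ge0 ?sqrtr_ge0//; exact: fro_triangle.
Qed.

Lemma hs_distC d (x y : 'M[C]_d) : hs_norm (x - y) = hs_norm (y - x).
Proof. by rewrite !hs_normE fro_distC. Qed.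

Lemma hs_norm_ge0 d (x : 'M[C]_d) : 0 <= hs_norm x.
Proof. exact: sqrtr_ge0. Qed.

Lemma hs_scalar d (a : C) : (0 < d)%N -> hs_norm (a%:M : 'M[C]_d) = cabs a.
Proof.
by move=> d0; rewrite hs_normE fro_scalar mulfK// gt_eqF// sqrtr_gt0 ltr0n.
Qed.

Lemma hs_mulr_unitary d (x u : 'M[C]_d) : u \is unitarymx -> hs_norm (x *m u) = hs_norm x.
Proof. by move=> uu; rewrite !hs_normE (fro_mulr_unitary _ uu). Qed.

Lemma hs_mull_unitary d (u x : 'M[C]_d) : u \is unitarymx -> hs_norm (u *m x) = hs_norm x.
Proof. by move=> uu; rewrite !hs_normE (fro_mull_unitary _ uu). Qed.

Lemma hs_unitary d (u : 'M[C]_d) : (0 < d)%N -> u \is unitarymx -> hs_norm u = 1.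
Proof.
by move=> d0 uu; rewrite hs_normE (fro_unitary uu) divff// gt_eqF// sqrtr_gt0 ltr0n.
Qed.

Lemma hs_mul_dist d (x y z w : 'M[C]_d) (k l : R) : y \is unitarymx -> z \is unitarymx ->
  hs_norm (x - z) <= k -> hs_norm (y - w) <= l -> hs_norm (x *m y - z *m w) <= k + l.
Proof.
move=> yu zu xz yw; apply: (@hs_chain _ (z *m y)).
  by rewrite -mulmxBl (hs_mulr_unitary _ yu).
by rewrite -mulmxBr (hs_mull_unitary _ zu).
Qed.

Lemma unitary_scalar d (a : C) : cabs a = 1 -> (a%:M : 'M[C]_d) \is unitarymx.
Proof.
move=> a1; apply/unitarymxP; rewrite adjmx_scalar -scalar_mxM.
by rewrite mul_conj a1 expr1n.
Qed.

End HSNorm.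

Section Tensor.
Variable R : realType.
Local Notation C := R[i].

Lemma adjmx_tens m n p q (x : 'M[C]_(m, n)) (y : 'M[C]_(p, q)) :
  (tensmx x y)^t* = tensmx (x^t*) (y^t*).
Proof. by rewrite trmx_tens map_mxT. Qed.

Lemma tens_scalar2 m n (a b : C) :
  tensmx (a%:M : 'M[C]_m) (b%:M : 'M[C]_n) = (a * b)%:M :> 'M[C]_(m * n).
Proof.
apply/matrixP => k l; case: (mxtens_indexP k) => i j; case: (mxtens_indexP l) => i' j'.
rewrite tensmxE !mxE (can_eq (@mxtens_indexK m n)) xpair_eqE.
by case: (i == i'); case: (j == j'); rewrite ?mulr0n ?mulr1n ?mul0r ?mulr0.
Qed.

Lemma mxtrace_tens m n (x : 'M[C]_m) (y : 'M[C]_n) :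
  \tr (tensmx x y) = \tr x * \tr y.
Proof.
rewrite /mxtrace (reindex (@mxtens_index m n)); last first.
  by exists (@mxtens_unindex m n) => k _; rewrite (mxtens_indexK, mxtens_unindexK).
rewrite big_distrlr /= pair_bigA /=; apply: eq_bigr => -[i j] _.
by rewrite tensmxE.
Qed.

Lemma tensmx_unitary m n (x : 'M[C]_m) (y : 'M[C]_n) :
  x \is unitarymx -> y \is unitarymx -> tensmx x y \is unitarymx.
Proof.
move=> /unitarymxP xu /unitarymxP yu; apply/unitarymxP.
by rewrite adjmx_tens tensmx_mul xu yu tens_scalar2 mul1r.
Qed.

Lemma hs_tens m n (x : 'M[C]_m) (y : 'M[C]_n) :
  hs_norm (tensmx x y) = hs_norm x * hs_norm y.
Proof.
rewrite !hs_normE natrM sqrtrM ?ler0n// invfM [RHS]mulrACA; congr (_ * _).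
apply/eqP; rewrite -(@eqrXn2 _ 2) ?mulr_ge0 ?fro_ge0// exprMn; apply/eqP.
by rewrite fro2 adjmx_tens tensmx_mul mxtrace_tens -!fro2C -rmorphM.
Qed.

End Tensor.

Lemma sqrt2_ge (R : realType) : 14 / 10 <= Num.sqrt 2 :> R.
Proof.
have h : 0 <= 14 / 10 :> R by rewrite divr_ge0 ?ler0n.
rewrite -[leLHS](ger0_norm h) -sqrtr_sqr ler_sqrt ?ler0n//; lra.
Qed.

Section Dirichlet.
Variable R : realType.
Local Notation C := R[i].

(** Pigeonhole on the powers with exponents from 0 to [Q], where [Q] is the number of cells of a
    grid. That [Q] does not depend on [z] is essential: it has to be known before the character is
    chosen. *)
Lemma simultaneous_recurrence m (eps : R) : 0 < eps -> exists Q : nat, forall z : 'I_m -> C,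
  (forall k, cabs (z k) = 1) ->
  exists q, [/\ (0 < q)%N, (q <= Q)%N & forall k, cabs (z k ^+ q - 1) < eps].
Proof.
move=> eps0; have [N N0 hN] := nat_above (4 / eps).
have N0R : 0 < N%:R :> R by rewrite ltr0n.
have small : 2 / N%:R < eps.
  by move: hN; rewrite ltr_pdivrMr// ler_pdivrMr// mulrC; move: (eps * _) => x; lra.
pose cell (x : R) : 'I_(N + N).+1 := inord (Num.truncn (N%:R * (x + 1))).
have cellP (x y : R) : `|x| <= 1 -> `|y| <= 1 -> cell x = cell y -> `|x - y| <= N%:R^-1.
  have bnd (w : R) : `|w| <= 1 -> 0 <= N%:R * (w + 1) /\
      (Num.truncn (N%:R * (w + 1)) < (N + N).+1)%N.
    rewrite ler_norml => /andP[w1 w2].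
    have w0 : 0 <= N%:R * (w + 1) by rewrite mulr_ge0 ?ler0n//; lra.
    split=> //; rewrite ltnS -(@ler_nat R); case/andP: (truncn_itv w0) => h _.
    apply: (le_trans h); have -> : (N + N)%:R = N%:R * 2 :> R by rewrite addnn -muln2 natrM.
    by rewrite ler_pM2l//; lra.
  move=> /bnd[x0 xN] /bnd[y0 yN] /(congr1 val).
  rewrite /cell /= !inordK// => xy.
  have := truncn_itv x0; have := truncn_itv y0; rewrite xy.
  move: (Num.truncn _) => t; rewrite -(@natr1 R) => /andP[a1 a2] /andP[b1 b2].
  rewrite -(ler_pM2l N0R) divff ?gt_eqF// -{1}(ger0_norm (ltW N0R)) -normrM ler_norml mulrBr.
  move: a1 a2 b1 b2; rewrite !mulrDr !mulr1; move: (N%:R * x) (N%:R * y) => u v; lra.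
pose T := {ffun 'I_m -> 'I_(N + N).+1 * 'I_(N + N).+1}.
exists #|T| => z z1.
pose f (s : 'I_#|T|.+1) : T :=
  [ffun k => (cell (complex.Re (z k ^+ s)), cell (complex.Im (z k ^+ s)))].
have [s [t [st fst]]] : exists s t : 'I_#|T|.+1, (s < t)%N /\ f s = f t.
  have /injectivePn[s [t st fst]] : ~~ injectiveb f.
    apply/negP => /injectiveP/leq_card; by rewrite card_ord ltnn.
  have [h|h|h] := ltngtP s t; [by exists s, t|by exists t, s|].
  by rewrite (val_inj h) eqxx in st.
exists (t - s)%N; split; [by rewrite subn_gt0| |].
  by apply: leq_trans (leq_subr _ _) _; rewrite -ltnS.
move=> k; have zX n : cabs (z k ^+ n) = 1 by rewrite cabsX z1 expr1n.
have -> : cabs (z k ^+ (t - s) - 1) = cabs (z k ^+ t - z k ^+ s).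
  by rewrite -[in RHS](subnK (ltnW st)) exprD -{2}[z k ^+ s]mul1r -mulrBl cabsM zX mulr1.
apply: le_lt_trans (cabs_le_ReIm _) _; apply: le_lt_trans small.
have /ffunP/(_ k) := fst; rewrite !ffunE => -[re im].
have h n : `|complex.Re (z k ^+ n)| <= 1 by rewrite -(zX n) normRe_le_cabs.
have h' n : `|complex.Im (z k ^+ n)| <= 1 by rewrite -(zX n) normIm_le_cabs.
rewrite RecB ImcB mulrDl mul1r lerD//; apply: cellP => //.
Qed.

End Dirichlet.

Section ApproximateCharacters.
Variables (R : realType) (G : groupType) (A : zmodType) (i : A -> G).
Hypothesis iD : {morph i : a b / a + b >-> (a * b)%g}.
Local Notation C := R[i].

(** Realisation on all finite sets [E], [B] and to all precisions already makes [chi] a character,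
    as [approx_charD] shows. *)
Definition approx_char (chi : A -> C) : Prop := (forall b, cabs (chi b) = 1) /\
  forall (E : seq G) (B : seq A) (e : R), 0 < e -> exists d (th : G -> 'M[C]_d),
    near_rep E e th /\ forall b, b \in B -> hs_norm (th (i b) - (chi b)%:M) <= e.

Lemma approx_charD chi a b : approx_char chi -> chi (a + b) = chi a * chi b.
Proof.
move=> [chi1 happ]; apply/eqP; rewrite -subr_eq0 -cabs_eq0 eq_le cabs_ge0 andbT; apply/ler_addgt0Pl => e e0.
have e4 : 0 < e / 4 by rewrite divr_gt0.
have [d [th [[d0 thu thm] hth]]] := happ [:: i a; i b; i (a + b)] [:: a; b; a + b] _ e4.
rewrite addr0 -(@hs_scalar _ d) // raddfB /=.
have e4E : e = e / 4 + (e / 4 + (e / 4 + e / 4)) by field.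
rewrite e4E; apply: (@hs_chain _ _ (th (i (a + b)))).
  by rewrite hs_distC hth// !inE eqxx !orbT.
apply: (@hs_chain _ _ (th (i a) *m th (i b))).
  by rewrite hs_distC iD thm// -?iD !inE eqxx ?orbT.
rewrite scalar_mxM; apply: hs_mul_dist; first exact: thu.
- exact: unitary_scalar.
- by rewrite hth// !inE eqxx.
- by rewrite hth// !inE eqxx ?orbT.
Qed.

Lemma approx_char0 chi : approx_char chi -> chi 0 = 1.
Proof.
move=> h; have := approx_charD 0 0 h; rewrite addr0 => /esym/eqP.
rewrite -subr_eq0 -{3}[chi 0]mulr1 -mulrBr mulf_eq0 subr_eq0 => /orP[/eqP z|/eqP//].
by have := h.1 0; rewrite z cabs0 => /eqP; rewrite eq_sym oner_eq0.
Qed.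

Lemma approx_charMn chi a n : approx_char chi -> chi (a *+ n) = chi a ^+ n.
Proof.
move=> h; elim: n => [|n IHn]; first by rewrite mulr0n expr0 (approx_char0 h).
by rewrite mulrS (approx_charD _ _ h) IHn exprS.
Qed.

Lemma approx_char_mul chi psi : approx_char chi -> approx_char psi ->
  approx_char (fun b => chi b * psi b).
Proof.
move=> [chi1 hchi] [psi1 hpsi]; split=> [b|E B e e0]; first by rewrite cabsM chi1 psi1 mulr1.
have e2 : 0 < e / 2 by rewrite divr_gt0.
have [d [th [[d0 thu thm] hth]]] := hchi E B _ e2.
have [d' [th' [[d'0 thu' thm'] hth']]] := hpsi E B _ e2.
have tens_dist (x y : 'M[C]_d) (x' y' : 'M[C]_d') : y \is unitarymx -> x' \is unitarymx ->
    hs_norm (x - y) <= e / 2 -> hs_norm (x' - y') <= e / 2 ->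
    hs_norm (tensmx x x' - tensmx y y') <= e.
  move=> yu xu' h h'; rewrite [e]splitr; apply: (@hs_chain _ _ (tensmx y x')).
    have -> : tensmx x x' - tensmx y x' = tensmx (x - y) x'.
      by apply/matrixP => k l; rewrite !mxE mulrBl.
    by rewrite hs_tens (hs_unitary d'0 xu') mulr1.
  have -> : tensmx y x' - tensmx y y' = tensmx y (x' - y').
    by apply/matrixP => k l; rewrite !mxE mulrBr.
  by rewrite hs_tens (hs_unitary d0 yu) mul1r.
exists (d * d')%N, (fun g => tensmx (th g) (th' g)); split.
  split; first by rewrite muln_gt0 d0.
    by move=> g; apply: tensmx_unitary.
  move=> g h gE hE ghE; rewrite tensmx_mul; apply: tens_dist.
  - exact: thu.
  - exact: mul_unitarymx (thu' g) (thu' h).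
  - exact: thm.
  - exact: thm'.
move=> b bB; rewrite -tens_scalar2; apply: tens_dist.
- exact: unitary_scalar.
- exact: thu'.
- exact: hth.
- exact: hth'.
Qed.

Lemma approx_charX chi n : approx_char chi -> approx_char (fun b => chi b ^+ n.+1).
Proof.
move=> h; elim: n => [//|n IHn].
by have := approx_char_mul h IHn; under eq_fun do rewrite -exprS.
Qed.

Lemma approx_char_exists (a : A) : countable [set: G] -> countable [set: A] ->
  (forall a x, commute (i a) x) -> hyperlinear R G -> i a != 1%g ->
  exists chi, approx_char chi /\ 1 <= cabs (chi a - 1).
Proof.
move=> Gc Ac ic hG a1.
have [eG eGs] := countable_enum 1%g Gc; have [eA eAs] := countable_enum 0 Ac.
pose en (n : nat) : R := n.+1%:R^-1.
have en0 n : 0 < en n by rewrite invr_gt0 ltr0n.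
have /choice[l lP] : forall n, exists (l : A -> C) d (th : G -> 'M[C]_d),
    [/\ near_rep (map eG (iota 0 n)) (en n) th,
        forall b, b \in a :: map eA (iota 0 n) ->
          cabs (l b) = 1 /\ hs_norm (th (i b) - (l b)%:M) <= en n &
        Num.sqrt 2 - en n <= hs_norm (th (i a) - 1%:M)].
  move=> n; have [d [th [l h]]] := cut_scalars (a :: map eA (iota 0 n))
    (map eG (iota 0 n)) ic hG a1 (en0 n).
  by exists l, d, th.
have [U [UU sU]] := ultraFilterLemma (F := \oo) _.

(* The default 1 keeps the modulus equal to 1 at the stages where [b] has not been treated yet; each
   [b] is treated from some stage on. *)
pose z b n := if b \in a :: map eA (iota 0 n) then l n b else 1.
have z1 b n : cabs (z b n) = 1.
  rewrite /z; case: ifPn => [bn|_]; last exact: cabs1.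
  by have [d [th [_ /(_ b bn)[]]]] := lP n.
have /choice[chi chiP] : forall b, exists c, limC U (z b) c.
  by move=> b; apply: (@ultra_limC _ _ _ 1 UU) => n; rewrite z1.
have chi1 b : cabs (chi b) = 1.
  have h : (fun n => cabs (z b n)) @ U --> cabs (chi b) by apply: limC_cabs.
  rewrite (_ : (fun n => cabs (z b n)) = fun=> 1) in h; last first.
    by apply/funext => n; rewrite z1.
  by apply: (cvg_unique _ h); [exact: Rhausdorff|exact: cvg_cst].
have near_en e : 0 < e -> \forall n \near U, en n < e.
  move=> e0; apply: sU; near=> n; rewrite /en; near: n.
  by have /cvgrPdist_lt/(_ e e0) := @cvg_harmonic R; apply: filterS => n /=;
    rewrite sub0r normrN gtr0_norm ?invr_gt0 ?ltr0n.
have near_z (B : seq A) e : 0 < e ->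
    \forall n \near U, forall b, b \in B -> cabs (z b n - chi b) < e.
  by move=> e0; apply: near_all_seq => b; have /limC_cabsP := chiP b; apply.
have near_l (B : seq A) : \forall n \near U, {subset B <= a :: map eA (iota 0 n)}.
  have := sU _ (mem_enum_prefix B eAs); apply: filterS => n h b /h bn.
  by rewrite inE bn orbT.
exists chi; split; first split=> // E B e e0.
  have e2 : 0 < e / 2 by rewrite divr_gt0.
  have [n [hE [hB [hz hen]]]] : exists n, {subset E <= map eG (iota 0 n)} /\
      {subset B <= a :: map eA (iota 0 n)} /\
      (forall b, b \in B -> cabs (z b n - chi b) < e / 2) /\ en n < e / 2.
    apply/(@filter_ex _ U); near=> n; do ! split; near: n.
    - exact: sU _ (mem_enum_prefix E eGs).
    - exact: near_l.
    - exact: near_z.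
    - exact: near_en.
  have [d [th [[d0 thu thm] thl _]]] := lP n; exists d, th; split.
    split=> // g h gE hE0 ghE; apply: le_trans (thm g h _ _ _) _; try exact: hE.
    by rewrite (le_trans (ltW hen))// ler_pdivrMr// ler_peMr ?ler1n// ltW.
  move=> b bB; rewrite [e]splitr; apply: (@hs_chain _ _ (l n b)%:M).
    by apply: le_trans (ltW hen); exact: (thl b (hB b bB)).2.
  rewrite -raddfB /= (hs_scalar _ d0); apply: ltW.
  by have := hz b bB; rewrite /z hB.
(* Three errors below 1/10 are subtracted from sqrt 2 >= 14/10: two from the near representation and
   one from passing to the limit. More than 1 remains. *)
have e10 : 0 < 10^-1 :> R by rewrite invr_gt0 ltr0n.
have [n [hz hen]] : exists n, (forall b, b \in [:: a] -> cabs (z b n - chi b) < 10^-1) /\ en n < 10^-1.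
  by apply/(@filter_ex _ U); near=> n; split; near: n; [exact: near_z|exact: near_en].
have := hz a (mem_head _ _); rewrite /z mem_head.
have [d [th [[d0 thu thm] thl hs]]] := lP n.
have [_ h1] := thl a (mem_head _ _).
have h2 : hs_norm ((l n a)%:M - 1%:M : 'M[C]_d) = cabs (l n a - 1).
  by rewrite -(hs_scalar _ d0) raddfB.
have h3 := le_trans hs (hs_chain h1 (lexx (hs_norm ((l n a)%:M - 1%:M : 'M[C]_d)))).
rewrite h2 in h3.
have h4 := cabsD (l n a - chi a) (chi a - 1).
rewrite addrA subrK in h4.
have s2 : 14 / 10 <= Num.sqrt 2 :> R.
  exact: sqrt2_ge.
move: h3 h4 hen s2; clear; move: (cabs _) (cabs _) (cabs _) (en n) (Num.sqrt _) => u v w r s.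
lra.
Unshelve. all: by end_near. Qed.

(** The character is first chosen far from 1 at the multiple of [a] by the factorial of [Q], which
    is nonzero as A is torsion free. A power of exponent at most [Q] brings it near 1 on [B]; were
    this power 1 at [a], the original character would be 1 at that multiple, because the exponent
    divides the factorial. *)
Lemma approx_char_near_one (a : A) (B : seq A) (eps : R) :
  countable [set: G] -> countable [set: A] -> injective i -> torsion_free A ->
  (forall a x, commute (i a) x) -> hyperlinear R G -> a != 0 -> 0 < eps ->
  exists chi, [/\ approx_char chi, forall b, b \in B -> cabs (chi b - 1) < eps & chi a != 1].
Proof.
move=> Gc Ac iinj tf ic hG a0 eps0.
have [Q hQ] := @simultaneous_recurrence R (size B) eps eps0.
have i0 : i 0 = 1%g by apply: (@mulgI _ (i 0)); rewrite -iD addr0 mulg1.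
have aN : i (a *+ Q`!) != 1%g.
  rewrite -i0 (inj_eq iinj); apply: contraNneq a0 => h.
  by apply/eqP; apply: tf h; exact: fact_gt0.
have [chi [hchi chia]] := approx_char_exists Gc Ac ic hG aN.
have [|[|q] [q0 qQ hq]] := hQ (fun k => chi (tnth (in_tuple B) k)).
- by move=> k; exact: hchi.1.
- by [].
exists (fun b => chi b ^+ q.+1); split; first exact: approx_charX.
  by move=> b bB; have [k ->] := tnthP (in_tuple B) b bB; exact: hq.
apply/negP => /eqP ha; move: chia; rewrite (approx_charMn _ _ hchi).
have /dvdnP[k ->] : (q.+1 %| Q`!)%N by rewrite dvdn_fact.
by rewrite mulnC exprM ha expr1n subrr cabs0 ler10.
Qed.

End ApproximateCharacters.

(** * Ultraproduct coefficients and stability *)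

Section GramLimits.
Variables (R : realType) (G : groupType) (U : set_system nat).
Context {UU : ProperFilter U}.
Local Notation C := R[i].

Lemma eq_limC (z w : nat -> C) l : z =1 w -> limC U z l -> limC U w l.
Proof. by move=> /funext->. Qed.

(** Each finite stage is a Gram matrix, hence positive, although its entries depend on [h^-1 * g]
    alone only in the limit. *)
Lemma posdef_gram_limit (T : nat -> finType) (v : forall k, G -> T k -> C) (f : G -> C) :
  (forall g h, limC U (fun k => \sum_t v k g t * (v k h t)^*) (f (h^-1 * g)%g)) -> posdef f.
Proof.
move=> vf; split=> [g|n g c].
  have h1 := vf 1%g g; rewrite mulg1 in h1; have h2 := vf g 1%g; rewrite invg1 mul1g in h2.
  apply: limC_unique h1 _; apply: eq_limC (limC_conj h2) => k.
  by rewrite rmorph_sum; apply: eq_bigr => t _; rewrite rmorphM /= conjCK mulrC.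
have lim : limC U (fun k => \sum_i \sum_j c i * (c j)^* * \sum_t v k (g i) t * (v k (g j) t)^*)
    (\sum_i \sum_j c i * (c j)^* * f ((g j)^-1 * g i)%g).
  by apply: limC_sum => i; apply: limC_sum => j; apply: limCMl; exact: vf.
apply: (limC_ge0 lim); apply: nearW => k.
have -> : \sum_i \sum_j c i * (c j)^* * (\sum_t v k (g i) t * (v k (g j) t)^*) =
    \sum_t (\sum_i c i * v k (g i) t) * (\sum_i c i * v k (g i) t)^*.
  transitivity (\sum_i \sum_j \sum_t (c i * v k (g i) t) * (c j * v k (g j) t)^*).
    apply: eq_bigr => i _; apply: eq_bigr => j _; rewrite big_distrr /=.
    by apply: eq_bigr => t _; rewrite rmorphM /= mulrACA.
  under eq_bigr do rewrite exchange_big /=.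
  by rewrite exchange_big /=; apply: eq_bigr => t _; rewrite rmorph_sum big_distrlr.
by apply: sumr_ge0 => t _; exact: mul_conjC_ge0.
Qed.

(* [|<v, w>|^2 = <v (x) v^*, w (x) w^*>]. *)
Lemma posdef_sq_gram_limit (T : nat -> finType) (v : forall k, G -> T k -> C) (f : G -> C) :
  (forall g h, limC U (fun k => \sum_t v k g t * (v k h t)^*) (f (h^-1 * g)%g)) ->
  posdef (fun g => (cabs (f g) ^+ 2)%:C%C).
Proof.
move=> vf.
apply: (@posdef_gram_limit (fun k => (T k * T k)%type)
  (fun k g t => v k g t.1 * (v k g t.2)^*)) => g h.
rewrite -mul_conj; apply: eq_limC (limCM (vf g h) (limC_conj (vf g h))) => k.
rewrite rmorph_sum big_distrlr /= pair_bigA /=.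
by apply: eq_bigr => -[t u] _ /=; rewrite !rmorphM /= mulrACA.
Qed.

End GramLimits.

Section Compressions.
Variables (R : realType) (d D : nat).
Hypotheses (d0 : (0 < d)%N) (dD : (d <= D)%N).
Local Notation C := R[i].
Local Notation P := (pid_mx d : 'M[C]_(d, D)).

Lemma pid_mx_adj : P^t* = P^T.
Proof. by apply/matrixP => k l; rewrite !mxE conjC_nat. Qed.

Lemma pid_mx_isometry : P *m P^t* = 1%:M.
Proof. by rewrite pid_mx_adj tr_pid_mx mul_pid_mx minnn (minn_idPr dD) pid_mx_1. Qed.

Lemma hs_compression_le (x : 'M[C]_D) : x \is unitarymx -> hs_norm (compression d x) <= 1.
Proof.
move=> xu; rewrite hs_norm_le// mul1r /compression -pid_mx_adj.
apply: le_trans (fro_mulr_adj_le _ pid_mx_isometry) _.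
rewrite (fro_mulr_unitary _ xu) -(fro_unitary (unitarymx1 R d)).
by rewrite -[X in fro X <= _]mul1mx fro_mulr_coisometry// pid_mx_isometry.
Qed.

End Compressions.

Lemma fro_dot_gram (R : realType) d D (J : 'M[R[i]]_(d, D)) (u v : 'M[R[i]]_D)
    (y w : 'M[R[i]]_d) :
  fro_dot (u *m J^t* *m y^t*) (v *m J^t* *m w^t*) =
  fro_dot (J *m (v^t* *m u) *m J^t*) (w^t* *m y).
Proof.
rewrite /fro_dot (adjmxM (v *m J^t*) (w^t*)) (adjmxM v (J^t*)) (adjmxM (w^t*) y).
rewrite (trmxCK w) (trmxCK J).
transitivity (\tr ((u *m J^t* *m y^t* *m w) *m (J *m v^t*))); first by rewrite !mulmxA.
by rewrite mxtrace_mulC !mulmxA.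
Qed.

Lemma fro_dot_le (R : realType) d (x y : 'M[R[i]]_d) : (0 < d)%N ->
  cabs (d%:R^-1 * fro_dot x y) <= hs_norm x * hs_norm y.
Proof.
move=> d0; rewrite cabsM !hs_normE mulrACA -invfM -expr2 sqr_sqrtr ?ler0n// mulrC.
have -> : d%:R^-1 = (d%:R^-1)%:C%C :> R[i] by rewrite fmorphV rmorph_nat.
rewrite cabs_real ger0_norm ?invr_ge0 ?ler0n//.
by rewrite ler_wpM2r ?invr_ge0 ?ler0n//; exact: (cauchy_schwarz (@fro_sip R d d)).
Qed.

Section UltraCoefficient.
Variables (R : realType) (Gamma G : groupType) (p : G -> Gamma) (U : set_system nat).
Hypotheses (UU : UltraFilter U) (pM : {morph p : x y / (x * y)%g}).
Local Notation C := R[i].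
Variables (d D : nat -> nat) (psi : forall k, G -> 'M[C]_(d k)) (pi : forall k, Gamma -> 'M[C]_(D k)).
Hypotheses (d0 : forall k, (0 < d k)%N) (dD : forall k, (d k <= D k)%N).
Hypotheses (psiu : forall k g, psi k g \is unitarymx) (pih : forall k, unitary_hom (pi k)).
Hypothesis psiM : forall g h (e : R), 0 < e ->
  \forall k \near U, hs_norm (psi k (g * h)%g - psi k g *m psi k h) <= e.

Let z g k : C := (d k)%:R^-1 * fro_dot (compression (d k) (pi k (p g))) (psi k g).

Lemma limC_dist (w w' : nat -> C) l : limC U w l ->
  (forall e : R, 0 < e -> \forall k \near U, cabs (w' k - w k) <= e) -> limC U w' l.
Proof.
move=> /limC_cabsP wl ww; apply/limC_cabsP => e e0.
have e2 : 0 < e / 2 by rewrite divr_gt0.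
near=> k; have h := cabsD (w' k - w k) (w k - l); rewrite addrA subrK in h.
apply: (le_lt_trans h); rewrite [e]splitr; apply: ler_ltD.
  by near: k; exact: ww.
by near: k; exact: wl.
Unshelve. all: by end_near. Qed.

Lemma hom1 (k : nat) : pi k 1%g = 1%:M.
Proof.
have [piu piM] := pih k; have h := piM 1%g 1%g; rewrite mulg1 in h.
have := congr1 (fun u => (pi k 1%g)^t* *m u) h.
by rewrite /= mulmxA (unitarymxPr (piu 1%g)) mul1mx => <-.
Qed.

Lemma hom_conjM k x y : (pi k x)^t* *m pi k y = pi k (x^-1 * y)%g.
Proof.
have [piu piM] := pih k; rewrite -{1}[y](mulVKg x) piM mulmxA.
by rewrite (unitarymxPr (piu x)) mul1mx.
Qed.

Lemma trace_dotB n (x y y' : 'M[C]_n) :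
  n%:R^-1 * fro_dot x y - n%:R^-1 * fro_dot x y' = n%:R^-1 * fro_dot x (y - y').
Proof. by rewrite -mulrBr (sipBr (@fro_sip R n n)). Qed.

Lemma hs_compr k x : hs_norm (compression (d k) (pi k x)) <= 1.
Proof. by apply: hs_compression_le => //; exact: (pih k).1. Qed.

Lemma trace_dist k x (y y' : 'M[C]_(d k)) :
  cabs ((d k)%:R^-1 * fro_dot (compression (d k) (pi k x)) y -
        (d k)%:R^-1 * fro_dot (compression (d k) (pi k x)) y') <= hs_norm (y - y').
Proof.
rewrite trace_dotB; apply: le_trans (fro_dot_le _ _ (d0 k)) _.
by rewrite ler_piMl ?hs_norm_ge0 ?hs_compr.
Qed.

Lemma ultra_coefficient : exists f : G -> C,
  [/\ posdef f, posdef (fun g => (cabs (f g) ^+ 2)%:C%C), f 1%g = 1,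
    forall g x c, p x = 1%g ->
      (forall e : R, 0 < e -> \forall k \near U, hs_norm (psi k x - c%:M) <= e) ->
      f (g * x)%g = c^* * f g &
    forall g (e : R), (\forall k \near U,
      hs_norm (psi k g - compression (d k) (pi k (p g))) <= e) -> cabs (f g - 1) <= e].
Proof.
have z1 g k : cabs (z g k) <= 1.
  apply: le_trans (fro_dot_le _ _ (d0 k)) _.
  by rewrite (hs_unitary (d0 k) (psiu k g)) mulr1 hs_compr.
have /choice[f fP] : forall g, exists l, limC U (z g) l.
  by move=> g; exact: (@ultra_limC _ U (z g) 1 UU).
(* The matrices pi (p g) P^t* psi(g)^t*, viewed as vectors of length d D and normalised. Their Gram
   matrix involves psi(h)^t* psi(g), which is asymptotically psi(h^-1 g), so its limit is given by
   [f]. *)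
pose v k g (t : 'I_(D k) * 'I_(d k)) : C := ((Num.sqrt (d k)%:R)^-1)%:C%C *
  (pi k (p g) *m (pid_mx (d k))^t* *m (psi k g)^t*) t.1 t.2.
have vE k g h : \sum_t v k g t * (v k h t)^* =
    (d k)%:R^-1 * fro_dot (compression (d k) (pi k (p (h^-1 * g)%g))) ((psi k h)^t* *m psi k g).
  have pV x : p x^-1%g = (p x)^-1%g.
    apply: (mulgI (p x)); rewrite -pM !mulgV; apply: (mulgI (p 1%g)).
    by rewrite -pM !mulg1.
  have -> : compression (d k) (pi k (p (h^-1 * g)%g)) =
      pid_mx (d k) *m ((pi k (p h))^t* *m pi k (p g)) *m (pid_mx (d k))^t*.
    by rewrite /compression pid_mx_adj hom_conjM pM pV.
  rewrite -fro_dot_gram fro_dotE pair_bigA /= big_distrr /=; apply: eq_bigr => -[x y] _.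
  rewrite /v /= rmorphM /= mulrACA conj_realC -rmorphM /= -invfM -expr2 sqr_sqrtr ?ler0n//.
  by rewrite fmorphV rmorph_nat.
have gram g h : limC U (fun k => \sum_t v k g t * (v k h t)^*) (f (h^-1 * g)%g).
  apply: limC_dist (fP (h^-1 * g)%g) _ => e e0.
  have := psiM h (h^-1 * g)%g e0; rewrite mulVKg; apply: filterS => k hk.
  rewrite vE; apply: le_trans (trace_dist _ _ _) _; apply: le_trans hk.
  rewrite -(hs_mull_unitary (psi k g - _) (_ : (psi k h)^t* \is unitarymx)); last first.
    by rewrite trmxC_unitary.
  by rewrite mulmxBr mulmxA (unitarymxPr (psiu k h)) mul1mx.
have close g (e : R) : (\forall k \near U,
    hs_norm (psi k g - compression (d k) (pi k (p g))) <= e) -> cabs (f g - 1) <= e.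
  move=> ge; have gl : limC U (fun k => z g k - 1) (f g - 1).
    by apply: limCB (fP g) _; exact: limC_cst.
  apply: (limC_cabs_le gl).
  apply: filterS ge => k; apply: le_trans.
  have {1}-> : 1 = (d k)%:R^-1 * fro_dot (psi k g) (psi k g).
    by rewrite /fro_dot (unitarymxP (psiu k g)) mxtrace1 mulVf// pnatr_eq0 -lt0n.
  rewrite /z -mulrBr -(sipBl (@fro_sip R _ _)).
  apply: le_trans (fro_dot_le _ _ (d0 k)) _.
  by rewrite (hs_unitary (d0 k) (psiu k g)) mulr1 hs_distC.
exists f; split.
- exact: posdef_gram_limit gram.
- exact: posdef_sq_gram_limit gram.
- apply/eqP; rewrite -subr_eq0 -cabs_eq0 eq_le cabs_ge0 andbT.
  apply/ler_addgt0Pl => e e0; rewrite addr0; apply: close.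
  have p1 : p 1%g = 1%g by apply: (mulgI (p 1%g)); rewrite -pM !mulg1.
  (* Cancelling the unitary [psi k 1] in psi(1) psi(1) ~ psi(1) shows that it is close to the
     identity, while [pi k 1] is the identity exactly. *)
  have := psiM 1%g 1%g e0; apply: filterS => k; rewrite mulg1.
  rewrite p1 hom1 /compression mulmx1 -pid_mx_adj (pid_mx_isometry _ (dD k)) hs_distC.
  by rewrite -{1}[psi k 1%g]mulmx1 -mulmxBr (hs_mull_unitary _ (psiu k 1%g)) hs_distC.
- move=> g x c px xc; apply: limC_unique (fP (g * x)%g) _.
  apply: limC_dist (limCMl c^* (fP g)) _ => e e0.
  have e2 : 0 < e / 2 by rewrite divr_gt0.
  apply: filterS2 (psiM g x e2) (xc _ e2) => k gx xk.
  rewrite /z pM px mulg1 mulrCA -(sipZr (@fro_sip R _ _)).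
  apply: le_trans (trace_dist _ _ _) _; rewrite [e]splitr.
  apply: (hs_chain gx).
  rewrite -mul_mx_scalar -mulmxBr (hs_mull_unitary _ (psiu k g)); exact: xk.
- exact: close.
Qed.

End UltraCoefficient.

Section UniformStability.
Variables (R : realType) (Gamma : groupType).
Local Notation C := R[i].

(** Stability speaks of sequences only. If no finite set and tolerance worked, counterexamples for
    longer and longer prefixes of Gamma with tolerance 1 / n.+1 would form an asymptotic
    homomorphism, and the representations near it would refute one of them. *)
Lemma uniform_stability (S : seq Gamma) (eps : R) :
  countable [set: Gamma] -> flexibly_HS_stable R Gamma -> 0 < eps ->
  exists (F : seq Gamma) (delta : R), 0 < delta /\
    forall d (phi : Gamma -> 'M[C]_d), near_rep F delta phi ->
    exists D (pi : Gamma -> 'M[C]_D), [/\ (d <= D)%N, unitary_hom pi &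
      forall g, g \in S -> hs_norm (phi g - compression d (pi g)) <= eps].
Proof.
move=> Gc stab eps0; apply: contrapT => nex.
have [e es] := countable_enum 1%g Gc.
pose en (n : nat) : R := n.+1%:R^-1.
have en0 n : 0 < en n by rewrite invr_gt0 ltr0n.
have bad n : exists X : {d & Gamma -> 'M[C]_d},
    near_rep (map e (iota 0 n)) (en n) (projT2 X) /\
    ~ exists D (pi : Gamma -> 'M[C]_D), [/\ (projT1 X <= D)%N, unitary_hom pi &
        forall g, g \in S -> hs_norm (projT2 X g - compression (projT1 X) (pi g)) <= eps].
  apply: contrapT => nX; apply: nex; exists (map e (iota 0 n)), (en n); split=> // d phi hphi.
  by apply: contrapT => h; apply: nX; exists (existT _ d phi).
have /choice[X XP] := bad.
have [|D [pi [pih dD _ lim]]] := stab (fun n => projT1 (X n)) (fun n => projT2 (X n)).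
  split=> [n|n g|g h]; try by case: (XP n) => -[].
  apply/cvgrPdist_le => r r0; near=> n.
  rewrite sub0r normrN ger0_norm ?hs_norm_ge0//.
  have [[_ _ hX] _] := XP n; apply: (@le_trans _ _ (en n)).
    have sub : {subset [:: g; h; (g * h)%g] <= map e (iota 0 n)}.
      by near: n; exact: mem_enum_prefix.
    by apply: hX; apply: sub; rewrite !inE eqxx ?orbT.
  near: n; have /cvgrPdist_lt/(_ r r0) := @cvg_harmonic R; apply: filterS => n /=.
  by rewrite sub0r normrN gtr0_norm// => /ltW.
have /filter_ex[n hn] : \forall n \near \oo, forall g, g \in S ->
    hs_norm (projT2 (X n) g - compression (projT1 (X n)) (pi n g)) <= eps.
  apply: near_all_seq => g; have /cvgrPdist_le/(_ eps eps0) := lim g; apply: filterS => n.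
  by rewrite sub0r normrN ger0_norm ?hs_norm_ge0.
by case: (XP n) => _; apply; exists (D n), (pi n).
Unshelve. all: by end_near. Qed.

End UniformStability.

(** * Central extensions *)

Section CentralExtensions.
Variables (A : zmodType) (G Gamma : groupType) (i : A -> G) (p : G -> Gamma).
Hypothesis ext : central_extension i p.

Lemma cext_proj1 : p 1%g = 1%g.
Proof. by apply: (mulgI (p 1%g)); rewrite -(cext_proj_morph ext) !mulg1. Qed.

Lemma cext_projV x : p x^-1%g = (p x)^-1%g.
Proof. by apply: (mulgI (p x)); rewrite -(cext_proj_morph ext) !mulgV cext_proj1. Qed.

Lemma cext_proj_incl a : p (i a) = 1%g.
Proof. by have : range i (i a) by [exists a]; rewrite -(cext_exact ext). Qed.

Lemma cext_diff x y : p x = p y -> exists a, y = (x * i a)%g.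
Proof.
move=> xy; have : [set z | p z = 1%g] (x^-1 * y)%g.
  by rewrite /= (cext_proj_morph ext) cext_projV xy mulVg.
by rewrite (cext_exact ext) => -[a _ ha]; exists a; rewrite ha mulVKg.
Qed.

Lemma cext_countable : countable [set: Gamma] -> countable [set: A] -> countable [set: G].
Proof.
move=> /countable_injP[k kinj] /countable_injP[l linj].
have /choice[s sP] := cext_proj_surj ext.
have /choice[beta bP] : forall g, exists a, g = (s (p g) * i a)%g.
  by move=> g; apply: cext_diff; rewrite sP.
apply/countable_injP; exists (fun g => pickle (k (p g), l (beta g))) => g h _ _.
move=> /(pcan_inj pickleK)[] /kinj gh /linj bgh.
by rewrite (bP g) (bP h) gh ?inE// bgh ?inE.
Qed.

Lemma perfect_nonsplit : perfect Gamma -> ~ split_extension p ->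
  exists2 a, a != 0 & derived_subgroup (i a).
Proof.
move=> perf nsplit; apply: contrapT => na; apply: nsplit.
have a0 a : derived_subgroup (i a) -> a = 0.
  by move=> ia; apply/eqP/negP => /negP an0; apply: na; exists a.
have i0 : i 0 = 1%g by apply: (mulgI (i 0)); rewrite -(cext_incl_morph ext) addr0 mulg1.
have dM (x y : G) : derived_subgroup x -> derived_subgroup y -> derived_subgroup (x * y)%g.
  by move=> dx dy M MP; case: (MP) => -[M1 MM MV] _; apply: MM; [exact: dx|exact: dy].
have dV (x : G) : derived_subgroup x -> derived_subgroup x^-1%g.
  by move=> dx M MP; case: (MP) => -[M1 MM MV] _; apply: MV; exact: dx.
(* The image of the derived subgroup of G is a subgroup containing all commutators of Gamma, hence
   everything. Lifts chosen there are multiplicative, since their defect is an element [i a] of the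
   derived subgroup. *)
have lift y : exists x, derived_subgroup x /\ p x = y.
  have : derived_subgroup y by rewrite perf.
  move=> /(_ [set y | exists x, derived_subgroup x /\ p x = y]); apply; split; last first.
    move=> _ [u [v ->]].
    have [x xu] := cext_proj_surj ext u; have [z zv] := cext_proj_surj ext v.
    exists [~ x, z]%g; split; first by move=> M [_ cM]; apply: cM; exists x, z.
    by rewrite /commg /conjg !(cext_proj_morph ext) !cext_projV xu zv.
  split=> [|x z [x' [dx <-]] [z' [dz <-]]|x [x' [dx <-]]].
  - by exists 1%g; split; [move=> M MP; case: (MP) => -[]|exact: cext_proj1].
  - by exists (x' * z')%g; split; [exact: dM|exact: (cext_proj_morph ext)].
  - by exists x'^-1%g; split; [exact: dV|exact: cext_projV].
have /choice[s sP] := lift.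
exists s; split=> [x y|x]; last by case: (sP x).
have [a ha] : exists a, s (x * y)%g = (s x * s y * i a)%g.
  apply: cext_diff; rewrite (cext_proj_morph ext).
  by rewrite (sP x).2 (sP y).2 (sP (x * y)%g).2.
rewrite ha (a0 a) ?i0 ?mulg1//.
have -> : i a = ((s x * s y)^-1 * s (x * y))%g by rewrite ha mulKg.
exact: dM _ _ (dV _ (dM _ _ (sP x).1 (sP y).1)) (sP _).1.
Qed.

End CentralExtensions.

(** The order of the choices is the point: [S] and [delta] come from detection, [F] and [rho] from
    uniform stability, then [eta] and the finite set [B], and only then the character. *)
Lemma stable_not_detects (R : realType) (Gamma G : groupType) (A : zmodType)
    (i : A -> G) (p : G -> Gamma) (a : A) :
  countable [set: Gamma] -> countable [set: A] -> torsion_free A ->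
  central_extension i p -> flexibly_HS_stable R Gamma -> hyperlinear R G ->
  a != 0 -> ~ detects_scalars R i a.
Proof.
move=> Gammac Ac tf ext stab hG a0 [S [delta [delta0 det]]].
have Gc := cext_countable ext Gammac Ac.
have delta4 : 0 < delta / 4 by rewrite divr_gt0.
have [F [rho [rho0 hF]]] := uniform_stability (map p S) Gammac stab delta4.
(* Almost multiplicativity on [F] costs eta + 3 eta, where 3 eta is the price of discarding a factor
   [i b]; on [S] the total is 3 eta + delta / 4 <= 5/8 delta. *)
have [eta [eta0 eta_rho eta_delta]] : exists eta : R,
    [/\ 0 < eta, 4 * eta <= rho & 8 * eta <= delta].
  exists (Num.min (rho / 4) (delta / 8)); split.
  - by rewrite lt_min !divr_gt0.
  - by rewrite mulrC -ler_pdivlMr// ge_min lexx.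
  - by rewrite mulrC -ler_pdivlMr// ge_min lexx orbT.
have /choice[s sP] := cext_proj_surj ext.
have /choice[beta bP] : forall g, exists b, g = (s (p g) * i b)%g.
  by move=> g; apply: (cext_diff ext); rewrite sP.
have /choice[c cP] : forall xy, exists b, (s xy.1 * s xy.2)%g = (s (xy.1 * xy.2)%g * i b)%g.
  by move=> xy; apply: (cext_diff ext); rewrite (cext_proj_morph ext) !sP.
pose FF := [seq (x, y) | x <- F, y <- F].
(* The values of the cocycle on pairs from [F], and the deviations of the elements of [S] from the
   section. *)
pose B := map c FF ++ map beta S.
have [chi [hchi chiB chia]] :=
  approx_char_near_one (cext_incl_morph ext) B Gc Ac (cext_incl_inj ext) tf (cext_central ext) hG a0 eta0.
have [eG eGs] := countable_enum 1%g Gc; have [eA eAs] := countable_enum 0 Ac.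
have [X [XS XF XFF XB]] : exists X : seq G, [/\ forall g, g \in S -> s (p g) \in X,
    forall x, x \in F -> s x \in X,
    forall xy, xy \in FF -> s (xy.1 * xy.2)%g \in X & forall b, b \in B -> i b \in X].
  exists ([seq s (p g) | g <- S] ++ map s F ++ [seq s (xy.1 * xy.2)%g | xy <- FF] ++ map i B).
  split=> x xin; rewrite !mem_cat.
  - by rewrite (map_f (fun g => s (p g))).
  - by rewrite (map_f s) ?orbT.
  - by rewrite (map_f (fun xy => s (xy.1 * xy.2)%g)) ?orbT.
  - by rewrite (map_f i) ?orbT.
(* The fixed part makes every stage usable for stability with error [eta]; the growing prefix, with
   [en] tending to 0, makes the sequence asymptotically multiplicative on all of G. *)
pose E k := X ++ [seq (x * y)%g | x <- X, y <- X] ++ map eG (iota 0 k).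
pose en (n : nat) : R := Num.min eta n.+1%:R^-1.
have en0 n : 0 < en n by rewrite lt_min eta0 invr_gt0 ltr0n.
have en_eta n : en n <= eta by rewrite ge_min lexx.
have /choice[Y YP] : forall k, exists Y : {d & G -> 'M[R[i]]_d},
    near_rep (E k) (en k) (projT2 Y) /\
    forall b, b \in B ++ map eA (iota 0 k) ->
      hs_norm (projT2 Y (i b) - (chi b)%:M) <= en k.
  move=> k; have [d [th h]] := hchi.2 (E k) (B ++ map eA (iota 0 k)) _ (en0 k).
  by exists (existT _ d th).
have d0 k : (0 < projT1 (Y k))%N by have [[]] := YP k.
have psiu k g : projT2 (Y k) g \is unitarymx by have [[_ h _] _] := YP k; exact: h.
have XE k x y : x \in X -> y \in X ->
    hs_norm (projT2 (Y k) x *m projT2 (Y k) y - projT2 (Y k) (x * y)%g) <= eta.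
  move=> xX yX; have [[_ _ h] _] := YP k; apply: le_trans (en_eta k).
  apply: h; rewrite !mem_cat ?xX ?yX//.
  by rewrite (allpairs_f (fun x y => (x * y)%g)) ?orbT.
have psiB k x b : x \in X -> b \in B ->
    hs_norm (projT2 (Y k) (x * i b)%g - projT2 (Y k) x) <= 3 * eta.
  move=> xX bB; have -> : 3 * eta = eta + (eta + eta) by ring.
  apply: (@hs_chain _ _ (projT2 (Y k) x *m projT2 (Y k) (i b))).
    by rewrite hs_distC; apply: XE; last exact: XB.
  rewrite -[X in _ - X]mulmx1 -mulmxBr (hs_mull_unitary _ (psiu k x)).
  apply: (@hs_chain _ _ (chi b)%:M).
    by apply: le_trans (en_eta k); apply: (YP k).2; rewrite mem_cat bB.
  by rewrite -raddfB /= (hs_scalar _ (d0 k)) ltW// chiB.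
have /choice[Z ZP] : forall k, exists Z : {D & Gamma -> 'M[R[i]]_D},
    [/\ (projT1 (Y k) <= projT1 Z)%N, unitary_hom (projT2 Z) &
      forall g, g \in S ->
        hs_norm (projT2 (Y k) g - compression (projT1 (Y k)) (projT2 Z (p g))) <= 5 / 8 * delta].
  move=> k; have [|D [pi [dD pih hpi]]] := hF _ (fun x => projT2 (Y k) (s x)).
    split=> // x y xF yF xyF; apply: le_trans eta_rho.
    have xy : (x, y) \in FF by apply: allpairs_f.
    have -> : 4 * eta = eta + 3 * eta by ring.
    apply: (hs_chain (XE k _ _ (XF _ xF) (XF _ yF))).
    rewrite (cP (x, y)) /=; apply: psiB; first exact: (XFF (x, y)).
    by rewrite mem_cat (map_f c).
  exists (existT _ D pi); split=> // g gS /=.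
  have h : 3 * eta + delta / 4 <= 5 / 8 * delta by move: eta_delta; clear; lra.
  apply: le_trans h; rewrite {1}(bP g).
  apply: (hs_chain (psiB k _ _ (XS _ gS) _)); first by rewrite mem_cat (map_f beta) ?orbT.
  by apply: hpi; exact: map_f.
have [U [UU sU]] := ultraFilterLemma (F := \oo) _.
have near_en e : 0 < e -> \forall n \near U, en n <= e.
  move=> e0; apply: sU; have /cvgrPdist_lt/(_ e e0) := @cvg_harmonic R.
  apply: filterS => n /=; rewrite sub0r normrN gtr0_norm ?invr_gt0 ?ltr0n// => /ltW h.
  by rewrite ge_min h orbT.
have [|f [fpd f2pd f1 fx fclose]] := @ultra_coefficient R Gamma G p U UU (cext_proj_morph ext)
    (fun k => projT1 (Y k)) (fun k => projT1 (Z k)) (fun k => projT2 (Y k))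
    (fun k => projT2 (Z k)) d0 (fun k => let: And3 h _ _ := ZP k in h) psiu
    (fun k => let: And3 _ h _ := ZP k in h).
  move=> g h e e0; have := sU _ (mem_enum_prefix [:: g; h; (g * h)%g] eGs).
  apply: filterS2 (near_en e e0) => k ek sub; apply: le_trans ek.
  have inE1 x : x \in [:: g; h; (g * h)%g] -> x \in E k by move=> /sub xk; rewrite !mem_cat xk !orbT.
  have [[_ _ hY] _] := YP k; rewrite hs_distC; apply: hY; apply: inE1; rewrite !inE eqxx ?orbT//.
(* In [ultra_coefficient] the almost representation sits in the conjugate-linear slot, so [f]
   transforms by the conjugate of [chi]. *)
move/eqP: chia; apply; apply: (can_inj conjCK); rewrite conjC1.
apply: (det f (fun b => (chi b)^*) fpd f2pd f1).
- move=> g b; apply: fx; first exact: (cext_proj_incl ext).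
  move=> e e0; have := sU _ (mem_enum_prefix [:: b] eAs).
  apply: filterS2 (near_en e e0) => k ek sub; apply: le_trans ek.
  by apply: (YP k).2; rewrite mem_cat sub ?mem_head ?orbT.
- by move=> b; rewrite cabs_conj; exact: hchi.1.
- move=> g gS; apply: (@le_lt_trans _ _ (5 / 8 * delta)); last by move: delta0; clear; lra.
  by apply: fclose; apply: nearW => k; have [_ _] := ZP k; apply.
Qed.

Theorem theorem1p3 (R : realType) (Gamma G : groupType) (A : zmodType)
    (i : A -> G) (p : G -> Gamma) :
  countable [set: Gamma] ->
  property_T R Gamma ->
  countable [set: A] ->
  torsion_free A ->
  central_extension i p ->
  ~ split_extension p ->
  perfect Gamma \/ (property_T R G /\ infinite_cyclic A) ->
  flexibly_HS_stable R Gamma ->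
  ~ hyperlinear R G.
Proof.
move=> Gammac TGamma Ac tf ext nsplit hyp stab hG.
have Gc := cext_countable ext Gammac Ac.
case: hyp => [perf|[TG [f fbij]]].
  have [a a0 ia] := perfect_nonsplit ext perf nsplit.
  apply: (stable_not_detects Gammac Ac tf ext stab hG a0).
  exact: detects_scalars_derived TGamma Gammac Gc ext ia.
have f1 : f 1 != 0 by rewrite -(raddf0 f) (inj_eq (bij_inj fbij)).
apply: (stable_not_detects Gammac Ac tf ext stab hG f1).
exact: detects_scalars_kazhdan TG Gc (cext_central ext).
Qed.
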